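(* Let $\mathfrak g$ be a complete dg Lie-graph algebra. The deformation gauge group $\mathfrak G=(\mathbf 1+F_1\mathfrak g_0,\circledcirc,\mathbf 1)$ acts on the set $\mathrm{MC}(\mathfrak g)$ of Maurer--Cartan elements as follows. For $\lambda\in F_1\mathfrak g_0$ and $\bar\alpha\in\mathrm{MC}(\mathfrak g)$, with $\alpha=\delta+\bar\alpha$, the action is given in the differential extension $\mathfrak g^+$ by $$\exp(\lambda)\cdot\alpha:=\lambda.\alpha=\exp(\lambda)\overset{\alpha}{\bowtie}\exp(-\lambda),$$ and in $\mathfrak g$ by $$\begin{aligned}\exp(\lambda)\cdot\bar\alpha:=\lambda.\bar\alpha&=\exp(\lambda)\overset{\bar\alpha}{\bowtie}\exp(-\lambda)-\big(\exp(\lambda);d(\exp(\lambda))\big)\circledcirc\exp(-\lambda)\\&=\exp(\lambda)\overset{\bar\alpha}{\bowtie}\exp(-\lambda)+\exp(\lambda)\circledcirc\big(\exp(-\lambda);d(\exp(-\lambda))\big).\end{aligned}$$ Here $\lambda.\alpha$ and $\lambda.\bar\alpha$ denote the classical gauge group action.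
   Context: Fix a field $k$ of characteristic $0$; complexes are $\mathbb Z$-graded with differentials of degree $-1$. A *directed simple graph* is a finite non-empty connected graph whose edges are directed, without directed cycles (edges go from top to bottom: the source of an edge lies above its target), without external legs, with at most one edge between any two vertices. With vertices labelled bijectively by $1,\dots,n$ ($n=|\mathsf g|$) the set of isomorphism classes is $\mathsf{dsGra}(n)$. The operad $\mathrm{Lie}\text{-}\mathrm{gra}$ has $\mathrm{Lie}\text{-}\mathrm{gra}(n)=k\,\mathsf{dsGra}(n)$ (symmetric groups permute labels, unit the one-vertex graph); $\mathsf g_1\circ_i\mathsf g_2$ is the sum of all graphs obtained by replacing vertex $i$ of $\mathsf g_1$ by $\mathsf g_2$ and, independently for each edge of $\mathsf g_1$ between a vertex $j$ and $i$, replacing this edge by edges (of the same direction) joining $j$ to all the vertices of some non-empty subset of the vertices of $\mathsf g_2$ (sum over all choices); labels $1,\dots,i-1$ of $\mathsf g_1$ are kept, labels of $\mathsf g_2$ are shifted by $i-1$, remaining labels of $\mathsf g_1$ are shifted by $|\mathsf g_2|-1$. A *dg Lie-graph algebra* is an algebra over this operad in chain complexes (so $d$ is a derivation for all operations). A *complete dg Lie-graph algebra* is a dg Lie-graph algebra $\mathfrak g$ with a degreewise descending filtration $\mathfrak g=F_0\mathfrak g\supset F_1\mathfrak g\supset\cdots$, complete ($\mathfrak g\cong\varprojlim_k\mathfrak g/F_k\mathfrak g$), preserved by $d$, with each $\mathsf g\in\mathsf{dsGra}(n)$ mapping $F_{i_1}\mathfrak g\otimes\cdots\otimes F_{i_n}\mathfrak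 g$ to $F_{i_1+\cdots+i_n}\mathfrak g$. $x\star y$ denotes the action of the two-vertex graph with bottom vertex labelled $x$ and top vertex labelled $y$; $[x,y]=x\star y-(-1)^{|x||y|}y\star x$ is a Lie bracket and $\mathrm{ad}_\lambda=[\lambda,-]$. $\mathrm{MC}(\mathfrak g)=\{\bar\alpha\in\mathfrak g_{-1}\mid d\bar\alpha+\bar\alpha\star\bar\alpha=0\}$. *Differential extension.* An internal complete dg Lie-graph algebra is a complete dg Lie-graph algebra with a distinguished degree $-1$ element $\delta$ such that $dx=\delta\star x-(-1)^{|x|}x\star\delta$ for all $x$ and $d\delta=0$; morphisms preserve $\delta$. The differential extension $\mathfrak g^+$ is the image of $\mathfrak g$ under the left adjoint of the functor forgetting $\delta$; $\mathfrak g$ embeds in $\mathfrak g^+$. One associates to $\bar\alpha\in\mathrm{MC}(\mathfrak g)$ the element $\alpha=\delta+\bar\alpha\in\mathfrak g^+$. *Classical gauge action* of $\lambda\in F_1\mathfrak g_0$: $\lambda.\alpha=e^{\mathrm{ad}_\lambda}(\alpha)$ in $\mathfrak g^+$, equivalently $\lambda.\bar\alpha=e^{\mathrm{ad}_\lambda}(\bar\alpha)+\frac{\mathrm{id}-e^{\mathrm{ad}_\lambda}}{\mathrm{ad}_\lambda}(d\lambda)$ in $\mathfrak g$. *Leveled graphs.* A $p$-leveled directed simple graph is a directed simple graph with unlabelled vertices, each placed on one of $p$ ordered levels (levels may be empty), such that every edge goes from a level to a strictly lower one; up to isomorphism preserving levels. $\mathrm{Aut}(\mathsf g)$ is the group of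 vertex permutations preserving edges and levels. On $\mathbf 1+F_1\mathfrak g_0=\{\mathbf 1+x\mid x\in F_1\mathfrak g_0\}$ ($\mathbf 1$ a formal symbol), $$(\mathbf 1+x)\circledcirc(\mathbf 1+y)=\mathbf 1+\sum_{\mathsf g\ 2\text{-leveled}}\frac1{|\mathrm{Aut}(\mathsf g)|}\,\mathsf g(x,y),$$ with bottom vertices labelled by $x$ and top vertices labelled by $y$; this is a group with unit $\mathbf 1$, the deformation gauge group. *Graph exponential.* $\exp(x)=\mathbf 1+\sum_{\mathsf g}\frac{\ell_{\mathsf g}}{|\mathsf g|!}\mathsf g(x)$, the sum over isomorphism classes of directed simple graphs with unlabelled vertices, all vertices being labelled by $x$, and $\ell_{\mathsf g}$ the number of total levelisations: isomorphism classes of ways to place the vertices on $|\mathsf g|$ ordered levels, one per level, each edge going from a higher to a lower level. The map $\exp\colon F_1\mathfrak g_0\to\mathbf 1+F_1\mathfrak g_0$ is a bijection. Set $d(\mathbf 1+x)=dx$. *Bowtie element.* A bowtie graph is a $3$-leveled directed simple graph with exactly one vertex on the middle level (top and bottom levels possibly empty). Then $$(\mathbf 1+x)\overset{\alpha}{\bowtie}(\mathbf 1+y)=\sum_{\mathsf g\text{ bowtie}}\frac1{|\mathrm{Aut}(\mathsf g)|}\,\mathsf g(x,\alpha,y),$$ with $x$ labelling the bottom vertices, $\alpha$ the middle vertex, $y$ the top vertices. *Notation $(\,\cdot\,;\,\cdot\,)$.* In a $\circledcirc$-product, writing $(\mathbf 1+x;y)$ on a level means that all vertices of this level are labelled by $x$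 except exactly one, which is labelled by $y$; i.e. $(\mathbf 1+x;y)\circledcirc(\mathbf 1+z)$ is the part linear in $y$ of $(\mathbf 1+x+y)\circledcirc(\mathbf 1+z)$, and similarly $(\mathbf 1+z)\circledcirc(\mathbf 1+x;y)$ is the part linear in $y$ of $(\mathbf 1+z)\circledcirc(\mathbf 1+x+y)$. *)

(* Defs.v *)
From HB Require Import structures.
From Stdlib Require Import ClassicalEpsilon.
From mathcomp Require Import all_boot all_order all_fingroup all_algebra.

Set Implicit Arguments.
Unset Strict Implicit.
Unset Printing Implicit Defensive.

Import Order.TTheory GRing.Theory Num.Theory.
Local Open Scope ring_scope.

(* The pair (a, b) is an edge with source a (above) and target b (below).
   Edges form a set and there is no directed cycle, so there is neither a loop
   nor more than one edge between two vertices. *)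
Definition is_dsgraph (n : nat) (E : {set 'I_n * 'I_n}) : bool :=
  [&& (0 < n)%N,
      [forall a, forall b,
        connect (fun u v => ((u, v) \in E) || ((v, u) \in E)) a b]
    & [forall e in E, ~~ connect (fun u v => (u, v) \in E) e.2 e.1]].

(* dsGra(n): a graph with vertices labelled bijectively by 0, ..., n-1 is, up to
   isomorphism, a set of edges on 'I_n. *)
Record dsgraph (n : nat) := DSGraph {
  edges :> {set 'I_n * 'I_n};
  dsgraphP : is_dsgraph edges }.

HB.instance Definition _ n := [isSub for @edges n].
HB.instance Definition _ n := [Finite of dsgraph n by <:].

Lemma star_is_dsgraph : is_dsgraph [set ((ord_max : 'I_2), (ord0 : 'I_2))].
Proof.
have ord2 (a : 'I_2) : a = ord0 \/ a = ord_max.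
  by case: a => [[|[|//]] lt_a]; [left | right]; apply: val_inj.
apply/and3P; split=> //.
  apply/forallP=> a; apply/forallP=> b.
  by case: (ord2 a) => ->; case: (ord2 b) => ->;
     rewrite ?connect0 //; apply: connect1; rewrite !inE !eqxx ?orbT.
apply/forall_inP=> e; rewrite inE => /eqP-> /=; apply/negP.
by case/connectP=> [[|v p]] //= /andP[]; rewrite !inE !xpair_eqE.
Qed.


Definition star_graph : dsgraph 2 := DSGraph star_is_dsgraph.

Section Insertion.
Variables (m n : nat) (G1 : dsgraph m.+1) (i : 'I_m.+1) (G2 : dsgraph n.+1).

(* Relabelling of the vertices of G1 other than i, resp. of those of G2. *)
Definition outer_lab (j : 'I_m.+1) : 'I_(m + n).+1 :=
  inord (if (j < i)%N then j : nat else (j + n)%N).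
Definition inner_lab (a : 'I_n.+1) : 'I_(m + n).+1 := inord (i + a)%N.

(* S j is the set of vertices of G2 to which the edge between j and i is
   attached; it is empty when j and i are not adjacent. *)
Definition insertion_choice (S : {ffun 'I_m.+1 -> {set 'I_n.+1}}) : bool :=
  [forall j, (S j != set0) == (((j, i) \in edges G1) || ((i, j) \in edges G1))].

Definition insertion_edges (S : {ffun 'I_m.+1 -> {set 'I_n.+1}}) :
    {set 'I_(m + n).+1 * 'I_(m + n).+1} :=
  [set (outer_lab e.1, outer_lab e.2) | e in edges G1 & (e.1 != i) && (e.2 != i)]
  :|: [set (inner_lab e.1, inner_lab e.2) | e in edges G2]
  :|: [set (outer_lab p.1, inner_lab p.2) | p : 'I_m.+1 * 'I_n.+1
                              & ((p.1, i) \in edges G1) && (p.2 \in S p.1)]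
  :|: [set (inner_lab p.2, outer_lab p.1) | p : 'I_m.+1 * 'I_n.+1
                              & ((i, p.1) \in edges G1) && (p.2 \in S p.1)].

End Insertion.

Definition graph_iso (n : nat) (s : 'S_n) (G H : dsgraph n) : bool :=
  [forall a, forall b, ((s a, s b) \in edges H) == ((a, b) \in edges G)].

(* A graph together with a placement of its vertices on p levels, 0 being the
   lowest one. *)
Notation lgraph n p := (dsgraph n * {ffun 'I_n -> 'I_p})%type.

Definition leveled (n p : nat) (L : lgraph n p) : bool :=
  [forall e in edges L.1, (L.2 e.2 < L.2 e.1)%N].

Definition lgraph_iso (n p : nat) (s : 'S_n) (L M : lgraph n p) : bool :=
  graph_iso s L.1 M.1 && [forall v, M.2 (s v) == L.2 v].

Definition lAut (n p : nat) (L : lgraph n p) : {set 'S_n} :=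
  [set s | lgraph_iso s L L].

(* One representative of each isomorphism class of p-leveled graphs with n
   vertices satisfying P. *)
Definition lgraph_classes (n p : nat) (P : pred (lgraph n p)) :
    {set lgraph n p} :=
  let D := [set L | leveled L && P L] in
  transversal
    (equivalence_partition (fun L M => [exists s, lgraph_iso s L M]) D) D.

(* The same for directed simple graphs with unlabelled vertices. *)
Definition graph_classes (n : nat) : {set dsgraph n} :=
  transversal
    (equivalence_partition (fun G H => [exists s, graph_iso s G H]) setT) setT.

Definition total_levelisations (n : nat) (G : dsgraph n) : {set 'S_n} :=
  [set f : 'S_n | [forall e in edges G, (f e.2 < f e.1)%N]].

Definition nb_levelisations (n : nat) (G : dsgraph n) : nat :=
  #|equivalence_partition
      (fun f f' : 'S_n =>
         [exists s, graph_iso s G G && [forall v, f' (s v) == f v]])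
      (total_levelisations G)|.

Definition is_bowtie (n : nat) (L : lgraph n 3) : bool :=
  #|[set v | L.2 v == 1%N :> nat]| == 1%N.

Definition subst_at (V : Type) (n : nat) (x : {ffun 'I_n -> V}) (i : 'I_n)
    (y : V) : {ffun 'I_n -> V} :=
  [ffun j => if j == i then y else x j].

(* Sign of the rearrangement x_0, ..., x_(n-1) |-> x_(s 0), ..., x_(s (n-1)) of
   homogeneous elements of degrees e 0, ..., e (n-1). *)
Definition koszul_sign (k : fieldType) (n : nat) (s : 'S_n) (e : 'I_n -> int) :
    k :=
  \prod_(p : 'I_n * 'I_n | (p.1 < p.2)%N && (s p.2 < s p.1)%N)
     (-1) ^ (e (s p.1) * e (s p.2)).

(* A graded module is a module V with a decomposition into the direct sum of
   the subspaces dg_gr e, e : int.  The operation dg_op G puts x v at the vertex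
   labelled v; the operad being in degree 0, Koszul signs only appear in the
   action of the symmetric groups and in the derivation property. *)
Record dgLieGraph (k : fieldType) := DgLieGraph {
  dg_sort :> lmodType k;
  dg_gr : int -> dg_sort -> Prop;
  dg_d : {linear dg_sort -> dg_sort};
  dg_op : forall n, dsgraph n -> {ffun 'I_n -> dg_sort} -> dg_sort;
  dg_gr0 : forall e, dg_gr e 0;
  dg_grP : forall e (c : k) x y, dg_gr e x -> dg_gr e y -> dg_gr e (c *: x + y);
  dg_gr_span : forall x : dg_sort, exists (s : seq int) (h : int -> dg_sort),
    (forall e, dg_gr e (h e)) /\ x = \sum_(e <- s) h e;
  dg_gr_direct : forall (s : seq int) (h : int -> dg_sort), uniq s ->
    (forall e, dg_gr e (h e)) -> \sum_(e <- s) h e = 0 ->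
    forall e, e \in s -> h e = 0;
  dg_d_gr : forall e x, dg_gr e x -> dg_gr (e - 1) (dg_d x);
  dg_dd : forall x, dg_d (dg_d x) = 0;
  dg_op_multilinear : forall n (G : dsgraph n) x i (c : k) u v,
    dg_op G (subst_at x i (c *: u + v))
    = c *: dg_op G (subst_at x i u) + dg_op G (subst_at x i v);
  dg_op_gr : forall n (G : dsgraph n) (e : 'I_n -> int)
      (x : {ffun 'I_n -> dg_sort}),
    (forall i, dg_gr (e i) (x i)) -> dg_gr (\sum_i e i) (dg_op G x);
  dg_op_unit : forall (G : dsgraph 1) x, dg_op G x = x ord0;
  dg_op_equivariant : forall n (s : 'S_n) (G H : dsgraph n) (e : 'I_n -> int)
      (x : {ffun 'I_n -> dg_sort}),
    graph_iso s G H -> (forall i, dg_gr (e i) (x i)) ->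
    dg_op H x = koszul_sign k s e *: dg_op G [ffun i => x (s i)];
  (* In the inner sum, there is exactly one H. *)
  dg_op_comp : forall m n (G1 : dsgraph m.+1) (i : 'I_m.+1) (G2 : dsgraph n.+1)
      (x : {ffun 'I_(m + n).+1 -> dg_sort}),
    dg_op G1 [ffun j => if j == i then dg_op G2 [ffun a => x (inner_lab i a)]
                        else x (outer_lab n i j)]
    = \sum_(S | insertion_choice G1 i S)
        \sum_(H : dsgraph (m + n).+1 | edges H == insertion_edges G1 i G2 S)
          dg_op H x;
  dg_op_derivation : forall n (G : dsgraph n) (e : 'I_n -> int)
      (x : {ffun 'I_n -> dg_sort}),
    (forall i, dg_gr (e i) (x i)) ->
    dg_d (dg_op G x)
    = \sum_(i < n) (-1) ^ (\sum_(j < n | (j < i)%N) e j)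
             *: dg_op G (subst_at x i (dg_d (x i))) }.

Definition star (k : fieldType) (g : dgLieGraph k) (x y : g) : g :=
  dg_op star_graph [ffun v => if v == ord0 then x else y].

(* The bracket of x of degree e with y of degree f. *)
Definition bracket (k : fieldType) (g : dgLieGraph k) (e f : int) (x y : g) : g :=
  star x y - (-1) ^ (e * f) *: star y x.

(* fil i e is F_i g_e.  The last two fields say that the canonical map from g_e
   to the limit of the g_e / F_i g_e is injective, resp. surjective. *)
Record completeLieGraph (k : fieldType) := CompleteLieGraph {
  cl_base :> dgLieGraph k;
  fil : nat -> int -> cl_base -> Prop;
  fil_0 : forall e x, fil 0 e x <-> dg_gr e x;
  fil_decr : forall i e x, fil i.+1 e x -> fil i e x;
  fil_zero : forall i e, fil i e 0;
  filP : forall i e (c : k) x y, fil i e x -> fil i e y -> fil i e (c *: x + y);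
  fil_d : forall i e x, fil i e x -> fil i (e - 1) (dg_d cl_base x);
  fil_op : forall n (G : dsgraph n) (r : 'I_n -> nat) (e : 'I_n -> int)
      (x : {ffun 'I_n -> cl_base}),
    (forall v, fil (r v) (e v) (x v)) ->
    fil (\sum_v r v)%N (\sum_v e v) (dg_op G x);
  fil_separated : forall e x, (forall i, fil i e x) -> x = 0;
  fil_complete : forall e (u : nat -> cl_base), (forall i, dg_gr e (u i)) ->
    (forall i, fil i e (u i.+1 - u i)) ->
    exists2 x, dg_gr e x & forall i, fil i e (x - u i) }.

(* Limit in g_e for the topology of the filtration. *)
Definition converges (k : fieldType) (g : completeLieGraph k) (e : int)
    (u : nat -> g) (x : g) : Prop :=
  dg_gr e x /\
  forall i, exists N, forall n, (N <= n)%N -> fil i e (u n - x).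

(* Sum in g_e of the series of general term t, when it converges. *)
Definition series (k : fieldType) (g : completeLieGraph k) (e : int)
    (t : nat -> g) : g :=
  epsilon (inhabits 0) (converges e (fun N => \sum_(n < N) t n)).

Definition MC (k : fieldType) (g : completeLieGraph k) (a : g) : Prop :=
  dg_gr (-1) a /\ dg_d g a + star a a = 0.

(* e^(ad_l) on g_(-1), for l of degree 0. *)
Definition exp_ad (k : fieldType) (g : completeLieGraph k) (l x : g) : g :=
  series (-1) (fun n => (n`!%:R)^-1 *: iter n (bracket 0 (-1) l) x).

(* (id - e^(ad_l)) / ad_l = - sum_n (ad_l)^n / (n+1)!. *)
Definition exp_ad_quot (k : fieldType) (g : completeLieGraph k) (l x : g) : g :=
  series (-1) (fun n => - (n.+1`!%:R)^-1 *: iter n (bracket 0 (-1) l) x).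

Definition classical_gauge (k : fieldType) (g : completeLieGraph k)
    (l a : g) : g :=
  exp_ad l a + exp_ad_quot l (dg_d g l).

(* The element 1 + x of 1 + F_1 g_0 is encoded by x; in particular the unit is
   encoded by 0, and d (1 + x) = d x by d x. *)
Definition gauge_group (k : fieldType) (g : completeLieGraph k) (x : g) : Prop :=
  fil 1 0 x.

Definition lgraph_sum (k : fieldType) (g : completeLieGraph k) (n p : nat)
    (P : pred (lgraph n p)) (w : lgraph n p -> g) : g :=
  \sum_(L in lgraph_classes P) (#|lAut L|%:R)^-1 *: w L.

(* (1 + x) (o) (1 + y) *)
Definition gauge_mul (k : fieldType) (g : completeLieGraph k) (x y : g) : g :=
  series 0 (fun n => lgraph_sum predT (fun L : lgraph n 2 =>
    dg_op L.1 [ffun v => if L.2 v == 0%N :> nat then x else y])).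

(* (1 + x; y) (o) (1 + z), for y of degree -1 *)
Definition gauge_mul_linl (k : fieldType) (g : completeLieGraph k)
    (x y z : g) : g :=
  series (-1) (fun n => lgraph_sum predT (fun L : lgraph n 2 =>
    \sum_(u | L.2 u == 0%N :> nat)
      dg_op L.1 (subst_at [ffun v => if L.2 v == 0%N :> nat then x else z] u y))).

(* (1 + z) (o) (1 + x; y), for y of degree -1 *)
Definition gauge_mul_linr (k : fieldType) (g : completeLieGraph k)
    (z x y : g) : g :=
  series (-1) (fun n => lgraph_sum predT (fun L : lgraph n 2 =>
    \sum_(u | L.2 u == 1%N :> nat)
      dg_op L.1 (subst_at [ffun v => if L.2 v == 0%N :> nat then z else x] u y))).

(* The bowtie of 1 + x and 1 + y through a, for a of degree -1. *)
Definition bowtie (k : fieldType) (g : completeLieGraph k) (x a y : g) : g :=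
  series (-1) (fun n => lgraph_sum (@is_bowtie n) (fun L : lgraph n 3 =>
    dg_op L.1 [ffun v => if L.2 v == 0%N :> nat then x
                         else if L.2 v == 1%N :> nat then a else y])).

Definition graph_exp (k : fieldType) (g : completeLieGraph k) (x : g) : g :=
  series 0 (fun n => \sum_(G in graph_classes n)
    ((nb_levelisations G)%:R / n`!%:R) *: dg_op G [ffun=> x]).

(* The inverse of the bijection graph_exp from F_1 g_0 to 1 + F_1 g_0. *)
Definition graph_log (k : fieldType) (g : completeLieGraph k) (u : g) : g :=
  epsilon (inhabits 0) (fun l => fil 1 0 l /\ graph_exp l = u).

Definition gauge_act (k : fieldType) (g : completeLieGraph k) (u a : g) : g :=
  classical_gauge (graph_log u) a.

Definition is_group_action (T U : Type) (D : T -> Prop) (mul : T -> T -> T)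
    (one : T) (X : U -> Prop) (act : T -> U -> U) : Prop :=
  [/\ forall u a, D u -> X a -> X (act u a),
      forall a, X a -> act one a = a
    & forall u v a, D u -> D v -> X a -> act (mul u v) a = act u (act v a)].

Record internalLieGraph (k : fieldType) := InternalLieGraph {
  il_base :> completeLieGraph k;
  delta : il_base;
  delta_gr : dg_gr (-1) delta;
  delta_d : forall e x, dg_gr e x ->
    dg_d il_base x = star delta x - (-1) ^ e *: star x delta;
  d_delta : dg_d il_base delta = 0 }.

Definition is_morphism (k : fieldType) (g h : completeLieGraph k)
    (f : {linear g -> h}) : Prop :=
  [/\ forall i e x, fil i e x -> fil i e (f x),
      forall x, f (dg_d g x) = dg_d h (f x)
    & forall n (G : dsgraph n) x, f (dg_op G x) = dg_op G [ffun i => f (x i)]].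

(* gp, with unit eta, is the image of g under the left adjoint of the functor
   that forgets delta. *)
Definition is_differential_extension (k : fieldType) (g : completeLieGraph k)
    (gp : internalLieGraph k) (eta : {linear g -> gp}) : Prop :=
  is_morphism eta /\
  forall (h : internalLieGraph k) (f : {linear g -> h}), is_morphism f ->
    exists phi : {linear gp -> h},
      [/\ is_morphism phi, phi (delta gp) = delta h, forall x, phi (eta x) = f x
        & forall psi : {linear gp -> h},
            is_morphism psi -> psi (delta gp) = delta h ->
            (forall x, psi (eta x) = f x) -> forall y, psi y = phi y].

(* Main.v *)
Require Import Defs.
From HB Require Import structures.
From Stdlib Require Import ClassicalEpsilon.
From mathcomp Require Import all_boot all_order all_fingroup all_algebra.

Set Implicit Arguments.
Unset Strict Implicit.
Unset Printing Implicit Defensive.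

Import GRing.Theory.
Local Open Scope ring_scope.

(** * Graphs on subsets of a finite type *)

Definition pullback (W W' : finType) (f : W -> W') (E : {set W' * W'}) :
    {set W * W} :=
  [set e | (f e.1, f e.2) \in E].

Definition pushforward (W W' : finType) (f : W -> W') (E : {set W * W}) :
    {set W' * W'} :=
  [set (f e.1, f e.2) | e in E].

Definition contract (W W' : finType) (f : W -> W') (E : {set W * W}) :
    {set W' * W'} :=
  [set e in pushforward f E | e.1 != e.2].

Definition restrict (W : finType) (A : {set W}) (E : {set W * W}) :=
  E :&: setX A A.

Definition good_graph (W : finType) (A : {set W}) (E : {set W * W}) : bool :=
  [&& A != set0, E \subset setX A A,
      [forall a in A, forall b in A,
        connect (fun u v => ((u, v) \in E) || ((v, u) \in E)) a b]
    & [forall e in E, ~~ connect (fun u v => (u, v) \in E) e.2 e.1]].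

Section GraphLemmas.
Variables (W W' : finType).
Implicit Types (A B : {set W}) (E H : {set W * W}).

Lemma pullbackE (f : W' -> W) E a b : ((a, b) \in pullback f E) = ((f a, f b) \in E).
Proof. by rewrite inE. Qed.

Lemma contractP (f : W -> W') E a b :
  reflect (a <> b /\ exists u v, [/\ (u, v) \in E, f u = a & f v = b])
          ((a, b) \in contract f E).
Proof.
rewrite inE /=; apply: (iffP andP).
  case=> /imsetP[[u v] Huv [-> ->]] /eqP ne; split=> //; by exists u, v.
case=> /eqP ne [u [v [Huv Ea Eb]]]; split=> //; rewrite -Ea -Eb.
by apply/imsetP; exists (u, v).
Qed.

Lemma restrictE A E a b :
  ((a, b) \in restrict A E) = [&& (a, b) \in E, a \in A & b \in A].
Proof. by rewrite !inE. Qed.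

Lemma connect_const (T : finType) (r : rel T) (S : eqType) (c : T -> S) :
  (forall a b, r a b -> c a = c b) -> forall a b, connect r a b -> c a = c b.
Proof.
move=> rc a b /connectP[p]; elim: p a => [|u p IH] a /=; first by move=> _ ->.
by case/andP=> /rc -> /IH; apply.
Qed.

Lemma good_graphP A E :
  reflect [/\ exists a, a \in A,
              forall a b, (a, b) \in E -> a \in A /\ b \in A,
              forall c : pred W, (forall a b, (a, b) \in E -> c a = c b) ->
                forall a b, a \in A -> b \in A -> c a = c b
            & exists h : W -> nat, forall a b, (a, b) \in E -> (h b < h a)%N]
          (good_graph A E).
Proof.
apply: (iffP and4P).
  case=> /set0Pn A0 /subsetP sEA /forall_inP cE /forall_inP aE; split=> //.
  - by move=> a b /sEA; rewrite inE => /andP.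
  - move=> c Ec a b /cE/forall_inP/[apply].
    by apply: connect_const => u v /orP[] /Ec.
  - exists (fun v => #|[set w | connect (fun u v => (u, v) \in E) v w]|) => a b Eab.
    apply: proper_card; apply/properP; split.
      apply/subsetP=> w; rewrite !inE; apply: connect_trans.
      by apply: connect1.
    by exists a; rewrite !inE ?connect0 //; apply: (aE (a, b)).
case=> A0 sEA cE [h hE]; split.
- exact/set0Pn.
- by apply/subsetP=> -[a b] /sEA[? ?]; rewrite inE; apply/andP.
- apply/forall_inP=> a Aa; apply/forall_inP=> b Ab.
  set r := (fun u v => _); rewrite -(cE (connect r a) _ a b Aa Ab) ?connect0 //.
  move=> u v Euv; apply/idP/idP => /connect_trans; apply; apply: connect1.
    by rewrite /r Euv.
  by rewrite /r Euv orbT.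
- apply/forall_inP=> -[a b] Eab /=; apply/negP=> /connectP[p pp Ea].
  have: (h (last b p) <= h b)%N.
    elim: p b pp {Ea Eab} => [|u p IH] b //= /andP[/hE/ltnW hb /IH le_u].
    exact: leq_trans le_u hb.
  by rewrite -Ea leqNgt hE.
Qed.

End GraphLemmas.

Lemma good_graph_setT n (E : {set 'I_n * 'I_n}) :
  good_graph setT E = is_dsgraph E.
Proof.
rewrite /good_graph /is_dsgraph.
have ->: ([set: 'I_n] != set0) = (0 < n)%N.
  by rewrite -card_gt0 cardsT card_ord.
have ->: (E \subset setX setT setT) by apply/subsetP=> e; rewrite !inE.
rewrite andTb; congr [&& _, _ & _]; apply/forall_inP/forallP => H a.
  by apply/forallP=> b; exact: (forall_inP (H a (in_setT a)) b (in_setT b)).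
by move=> _; apply/forall_inP=> b _; exact: (forallP (H a) b).
Qed.

Lemma good_pullback (W W' : finType) (f : W -> W') (A : {set W})
    (E : {set W' * W'}) :
  injective f -> E \subset setX (f @: A) (f @: A) ->
  good_graph A (pullback f E) = good_graph (f @: A) E.
Proof.
move=> inj_f /subsetP sE; apply/good_graphP/good_graphP.
  case=> [[a0 Aa0] _ cE [h hE]]; split.
  - by exists (f a0); apply: imset_f.
  - by move=> a b /sE; rewrite inE => /andP.
  - move=> c Ec _ _ /imsetP[a Aa ->] /imsetP[b Ab ->].
    by apply: (cE (fun a => c (f a))) => // u v; rewrite pullbackE => /Ec.
  - exists (fun w => h (odflt a0 [pick a | f a == w])).
    have pE a : odflt a0 [pick b | f b == f a] = a.
      by case: pickP => [b /eqP/inj_f //|/(_ a)]; rewrite eqxx.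
    move=> a b /[dup]/sE/setXP[] /imsetP[u _ ->] /imsetP[v _ ->].
    by rewrite !pE -pullbackE => /hE.
case=> [[_ /imsetP[a0 Aa0 _]] _ cE [h hE]]; split.
- by exists a0.
- move=> a b; rewrite pullbackE => /sE/setXP[] /imsetP[u Au /inj_f ->].
  by case/imsetP=> v Av /inj_f ->.
- move=> c Ec a b Aa Ab.
  have pE u : odflt a0 [pick b | f b == f u] = u.
    by case: pickP => [v /eqP/inj_f //|/(_ u)]; rewrite eqxx.
  rewrite -(pE a) -(pE b).
  apply: (cE (fun w => c (odflt a0 [pick a | f a == w]))); try exact: imset_f.
  move=> _ _ /[dup]/sE/setXP[] /imsetP[u _ ->] /imsetP[v _ ->].
  by rewrite !pE -pullbackE => /Ec.
- by exists (fun a => h (f a)) => a b; rewrite pullbackE => /hE.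
Qed.

(** * The operations of a Lie-graph algebra on arbitrary finite vertex sets *)

Definition opE (k : fieldType) (g : dgLieGraph k) n (E : {set 'I_n * 'I_n})
    (x : {ffun 'I_n -> g}) : g :=
  if insub E is Some G then dg_op (G : dsgraph n) x else 0.

Section OpE.
Variables (k : fieldType) (g : dgLieGraph k) (n : nat).
Implicit Types (E : {set 'I_n * 'I_n}) (x : {ffun 'I_n -> g}).

Lemma opE_edges (G : dsgraph n) x : opE (edges G) x = dg_op G x.
Proof. by rewrite /opE valK. Qed.

Lemma opE_bad E x : ~~ is_dsgraph E -> opE E x = 0.
Proof. by move=> nE; rewrite /opE insubN. Qed.

Lemma sum_dsgraph (P : pred {set 'I_n * 'I_n}) (F : dsgraph n -> g) (F' : _ -> g) :
    (forall G : dsgraph n, P G -> F G = F' (edges G)) ->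
    (forall E, ~~ is_dsgraph E -> F' E = 0) ->
  \sum_(G : dsgraph n | P (edges G)) F G = \sum_(E | P E) F' E.
Proof.
move=> FF' F'0.
rewrite (bigID (fun E => is_dsgraph E)) /= [X in _ + X]big1 ?addr0; last first.
  by move=> E /andP[_ /F'0].
rewrite (reindex_omap (@edges n) insub) /=; last first.
  by move=> E /andP[_ dE]; rewrite insubT.
apply: eq_big => [G|G PG]; last exact: FF'.
by rewrite (dsgraphP G) valK eqxx !andbT.
Qed.

Lemma sum_opE (P : pred {set 'I_n * 'I_n}) x :
  \sum_(G : dsgraph n | P (edges G)) dg_op G x = \sum_(E | P E) opE E x.
Proof.
by apply: sum_dsgraph => [G _|E]; [rewrite opE_edges | exact: opE_bad].
Qed.

End OpE.

Lemma dsgraph_irr N (G : dsgraph N) (a : 'I_N) : ((a, a) \in edges G) = false.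
Proof.
apply/negP=> Gaa; have /and3P[_ _ /forall_inP/(_ _ Gaa)] := dsgraphP G.
by rewrite /= connect0.
Qed.

Lemma dsgraph_asym N (G : dsgraph N) (a b : 'I_N) :
  (a, b) \in edges G -> ((b, a) \in edges G) = false.
Proof.
move=> Gab; apply/negP=> Gba; have /and3P[_ _ /forall_inP/(_ _ Gab)] := dsgraphP G.
by rewrite /= connect1.
Qed.

Section InsertionLabels.
Variables (m n : nat) (i : 'I_m.+1).
Implicit Types (j : 'I_m.+1) (a : 'I_n.+1).

Definition collapse (w : 'I_(m + n).+1) : 'I_m.+1 :=
  inord (if (w < i)%N then w : nat else if (w <= i + n)%N then i : nat
         else (w - n)%N).

Lemma val_inner a : inner_lab i a = (i + a)%N :> nat.
Proof.
rewrite inordK // ltnS; apply: leq_add; rewrite -ltnS; exact: ltn_ord.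
Qed.

Lemma val_outer j : outer_lab n i j = (if (j < i)%N then j : nat else j + n)%N :> nat.
Proof.
rewrite inordK // ltnS; have := ltn_ord j; rewrite ltnS => lj.
by case: ifP => _; [apply: leq_trans (leq_addr _ _) | rewrite leq_add2r].
Qed.

Lemma inner_inj : injective (@inner_lab m n i).
Proof.
by move=> a b /(congr1 val) /=; rewrite !val_inner => /addnI/val_inj.
Qed.

Lemma collapse_inner a : collapse (inner_lab i a) = i.
Proof.
apply: val_inj; rewrite /collapse val_inner ltnNge leq_addr /= leq_add2l.
by rewrite -ltnS ltn_ord inord_val.
Qed.

Lemma collapse_outer j : j != i -> collapse (outer_lab n i j) = j.
Proof.
move=> ne; apply: val_inj; rewrite /collapse val_outer; case: (ltnP j i) => [lt|le].
  by rewrite lt inord_val.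
have lt: (i < j)%N by rewrite ltn_neqAle eq_sym ne.
by rewrite ltnNge (leq_trans le) ?leq_addr //= leq_add2r leqNgt lt /= addnK inord_val.
Qed.

Lemma labP w : (exists a, w = inner_lab i a) \/
               (exists2 j, j != i & w = outer_lab n i j).
Proof.
have := ltn_ord w; rewrite ltnS => lw; case: (ltnP w i) => [lt|le].
  have lm: (w < m.+1)%N by apply: ltn_trans lt (ltn_ord i).
  right; exists (inord w); first by rewrite -val_eqE /= inordK // neq_ltn lt.
  by apply: val_inj; rewrite /= val_outer inordK // lt.
case: (leqP w (i + n)) => [le2|lt].
  left; have la: (w - i < n.+1)%N by rewrite ltnS leq_subLR.
  by exists (Ordinal la); apply: val_inj; rewrite /= val_inner /= subnKC.
have ln: (n <= w)%N by apply: leq_trans (ltnW lt); rewrite leq_addl.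
have lm: (w - n < m.+1)%N by rewrite ltnS leq_subLR [(n + m)%N]addnC.
have li: (i < w - n)%N by rewrite ltn_subRL addnC.
right; exists (Ordinal lm); first by rewrite -val_eqE /= neq_ltn li orbT.
by apply: val_inj; rewrite /= val_outer /= ltnNge ltnW //= subnK.
Qed.

Lemma inner_outer a j : j != i -> (inner_lab i a == outer_lab n i j) = false.
Proof.
move=> ne; apply/eqP => /(congr1 collapse).
by rewrite collapse_inner collapse_outer // => ij; rewrite ij eqxx in ne.
Qed.

Lemma outer_inj j j' : j != i -> j' != i ->
  outer_lab n i j = outer_lab n i j' -> j = j'.
Proof. by move=> nj nj' /(congr1 collapse); rewrite !collapse_outer. Qed.

Variables (G1 : dsgraph m.+1) (G2 : dsgraph n.+1).
Variable S : {ffun 'I_m.+1 -> {set 'I_n.+1}}.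
Let ES := insertion_edges G1 i G2 S.

Lemma insertion_oo j j' : j != i -> j' != i ->
  ((outer_lab n i j, outer_lab n i j') \in ES) = ((j, j') \in edges G1).
Proof.
move=> nj nj'; apply/idP/idP => [|Gj]; last first.
  rewrite !in_setU; apply/orP; left; apply/orP; left; apply/orP; left.
  by apply/imsetP; exists (j, j') => //; rewrite inE Gj /= nj nj'.
rewrite !in_setU => /orP[/orP[/orP[]|]|] /imsetP[[u v]].
- rewrite inE /= => /and3P[Guv nu nv] [] /outer_inj -> // /outer_inj -> //.
- by move=> _ [/esym/eqP]; rewrite inner_outer.
- by move=> _ [_ /esym/eqP]; rewrite inner_outer.
- by move=> _ [/esym/eqP]; rewrite inner_outer.
Qed.

Lemma insertion_ii a b :
  ((inner_lab i a, inner_lab i b) \in ES) = ((a, b) \in edges G2).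
Proof.
apply/idP/idP => [|Gj]; last first.
  rewrite !in_setU; apply/orP; left; apply/orP; left; apply/orP; right.
  by apply/imsetP; exists (a, b).
rewrite !in_setU => /orP[/orP[/orP[]|]|] /imsetP[[u v]].
- by rewrite inE /= => /and3P[Guv nu nv] [] /eqP; rewrite inner_outer.
- by move=> Guv [] /inner_inj -> /inner_inj ->.
- rewrite inE /= => /andP[Gu _] [] /eqP; rewrite inner_outer //.
  by apply/eqP=> ui; rewrite ui dsgraph_irr in Gu.
- rewrite inE /= => /andP[Gu _] [] _ /eqP; rewrite inner_outer //.
  by apply/eqP=> ui; rewrite ui dsgraph_irr in Gu.
Qed.

Lemma insertion_oi j a : j != i ->
  ((outer_lab n i j, inner_lab i a) \in ES) = ((j, i) \in edges G1) && (a \in S j).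
Proof.
move=> nj; apply/idP/idP => [|Gj]; last first.
  rewrite !in_setU; apply/orP; left; apply/orP; right.
  by apply/imsetP; exists (j, a) => //; rewrite inE.
rewrite !in_setU => /orP[/orP[/orP[]|]|] /imsetP[[u v]].
- by rewrite inE /= => /and3P[Guv nu nv] [] _ /eqP; rewrite inner_outer.
- by move=> Guv [] /esym/eqP; rewrite inner_outer.
- rewrite inE /= => /andP[Gu Sv] [] /outer_inj -> //; last first.
    by apply/eqP=> ui; rewrite ui dsgraph_irr in Gu.
  by move=> /inner_inj ->; rewrite Gu Sv.
- by rewrite inE /= => /andP[Gu _] [] /esym/eqP; rewrite inner_outer.
Qed.

Lemma insertion_io j a : j != i ->
  ((inner_lab i a, outer_lab n i j) \in ES) = ((i, j) \in edges G1) && (a \in S j).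
Proof.
move=> nj; apply/idP/idP => [|Gj]; last first.
  rewrite !in_setU; apply/orP; right.
  by apply/imsetP; exists (j, a) => //; rewrite inE.
rewrite !in_setU => /orP[/orP[/orP[]|]|] /imsetP[[u v]].
- by rewrite inE /= => /and3P[Guv nu nv] [] /eqP; rewrite inner_outer.
- by move=> Guv [] _ /esym/eqP; rewrite inner_outer.
- rewrite inE /= => /andP[Gu Sv] [] /eqP; rewrite inner_outer //.
  by apply/eqP=> ui; rewrite ui dsgraph_irr in Gu.
- rewrite inE /= => /andP[Gu Sv] [] /inner_inj -> /outer_inj -> //.
  by apply/eqP=> ui; rewrite ui dsgraph_irr in Gu.
Qed.

End InsertionLabels.

(** The choices made at an insertion are recorded by the resulting graph: it is
    any graph that restricts to [G2] on the inserted vertices and from which one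
    recovers [G1] by collapsing these vertices.  *)
Lemma dg_op_insert (k : fieldType) (g : dgLieGraph k) m n (G1 : dsgraph m.+1)
    (i : 'I_m.+1) (G2 : dsgraph n.+1) (x : {ffun 'I_(m + n).+1 -> g}) :
  dg_op G1 [ffun j => if j == i then dg_op G2 [ffun a => x (inner_lab i a)]
                      else x (outer_lab n i j)]
  = \sum_(H | (pullback (inner_lab i) H == edges G2)
               && (contract (@collapse m n i) H == edges G1)) opE H x.
Proof.
rewrite dg_op_comp.
pose choice_of (H : {set 'I_(m + n).+1 * 'I_(m + n).+1}) :=
  [ffun j => if j == i then set0 else
     [set a | ((outer_lab n i j, inner_lab i a) \in H)
              || ((inner_lab i a, outer_lab n i j) \in H)]].
have irr_bad (H : {set 'I_(m + n).+1 * 'I_(m + n).+1}) :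
    ~~ [forall a, (a, a) \notin H] -> opE H x = 0.
  move=> nH; apply: opE_bad; apply/negP=> dH; case/negP: nH.
  by apply/forallP=> a; apply/negP; rewrite -/(edges (DSGraph dH)) dsgraph_irr.
rewrite [RHS](bigID (fun H : {set _} => [forall a, (a, a) \notin H])) /=.
rewrite [X in _ + X]big1 ?addr0; last by move=> H /andP[_ /irr_bad].
rewrite [RHS](reindex_onto (insertion_edges G1 i G2) choice_of) /=; last first.
  move=> H /andP[/andP[/eqP HG2 /eqP HG1] /forallP irrH].
  have G1P u v : (u, v) \in H -> collapse i u <> collapse i v ->
      (collapse i u, collapse i v) \in edges G1.
    by move=> Huv ne; rewrite -HG1; apply/contractP; split=> //; exists u, v.
  apply/setP=> -[u v].
  case: (labP i u) => [[a ->]|[j nj ->]]; case: (labP i v) => [[b ->]|[j' nj' ->]].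
  - by rewrite insertion_ii -HG2 pullbackE.
  - rewrite insertion_io // ffunE (negPf nj') inE.
    apply/andP/idP => [[Gij' /orP[] //]|Hab].
      move/G1P; rewrite collapse_inner collapse_outer // => H'.
      have /H' : j' <> i by apply/eqP.
      by rewrite (dsgraph_asym Gij').
    split; last by rewrite Hab orbT.
    move: (G1P _ _ Hab); rewrite collapse_inner collapse_outer //; apply.
    by apply/eqP; rewrite eq_sym.
  - rewrite insertion_oi // ffunE (negPf nj) inE.
    apply/andP/idP => [[Gij' /orP[] //]|Hab].
      move/G1P; rewrite collapse_inner collapse_outer // => H'.
      have /H' : i <> j by apply/eqP; rewrite eq_sym.
      by rewrite (dsgraph_asym Gij').
    split; last by rewrite Hab.
    move: (G1P _ _ Hab); rewrite collapse_inner collapse_outer //; apply.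
    exact/eqP.
  - rewrite insertion_oo //; apply/idP/idP => [|Hjj'].
      rewrite -HG1 => /contractP[_ [u1 [v1 [H1 Eu Ev]]]].
      case: (labP i u1) Eu H1 => [[a ->]|[j1 nj1 ->]]; rewrite ?collapse_inner.
        by move=> ij; rewrite -ij eqxx in nj.
      case: (labP i v1) Ev => [[a ->]|[j2 nj2 ->]]; rewrite ?collapse_inner.
        by move=> ij; rewrite -ij eqxx in nj'.
      by rewrite !collapse_outer // => -> ->.
    case: (eqVneq j j') => [jj'|ne].
      by rewrite jj' (negPf (irrH _)) in Hjj'.
    move: (G1P _ _ Hjj'); rewrite !collapse_outer //; apply; exact/eqP.
apply: eq_big => [S|S _]; last first.
  rewrite (eq_bigl (fun H : dsgraph _ => edges H \in [set insertion_edges G1 i G2 S])).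
    by rewrite (sum_opE (mem [set insertion_edges G1 i G2 S])) big_set1.
  by move=> H; rewrite inE.
apply/idP/idP => [/forallP cS|]; last first.
  case/andP=> /andP[/andP[_ /eqP HG1] _] /eqP <-; apply/forallP=> j; apply/eqP.
  rewrite ffunE; case: (eqVneq j i) => [->|nj]; first by rewrite eqxx !dsgraph_irr.
  apply/set0Pn/orP => [[a]|].
    rewrite inE insertion_oi // insertion_io //.
    by case/orP=> /andP[]; [left|right].
  rewrite -HG1 => -[] /contractP[_ [u [v [Huv Eu Ev]]]].
    case: (labP i u) Eu Huv => [[a ->]|[j1 nj1 ->]]; rewrite ?collapse_inner.
      by move=> ij; rewrite -ij eqxx in nj.
    case: (labP i v) Ev => [[a ->]|[j2 nj2 ->]]; rewrite ?collapse_inner; last first.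
      by rewrite collapse_outer // => ji; rewrite ji eqxx in nj2.
    by rewrite collapse_outer // => _ -> H; exists a; rewrite inE H.
  case: (labP i v) Ev Huv => [[a ->]|[j1 nj1 ->]]; rewrite ?collapse_inner.
    by move=> ij; rewrite -ij eqxx in nj.
  case: (labP i u) Eu => [[a ->]|[j2 nj2 ->]]; rewrite ?collapse_inner; last first.
    by rewrite collapse_outer // => ji; rewrite ji eqxx in nj2.
  by rewrite collapse_outer // => _ -> H; exists a; rewrite inE H orbT.
have Si : S i = set0.
  by apply/eqP; move: (cS i); rewrite dsgraph_irr; case: (S i == set0).
have Sj j a : a \in S j -> ((j, i) \in edges G1) || ((i, j) \in edges G1).
  by move=> Sa; move: (cS j) => /eqP <-; apply/set0Pn; exists a.
apply/andP; split; [apply/andP; split; [apply/andP; split|]|].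
- by apply/eqP/setP=> -[a b]; rewrite pullbackE insertion_ii.
- apply/eqP/setP=> -[j j']; apply/contractP/idP => [[ne [u [v [Huv Eu Ev]]]]|Gjj'].
    case: (labP i u) Eu Huv => [[a ->]|[j1 nj1 ->]];
      case: (labP i v) Ev => [[b ->]|[j2 nj2 ->]];
      rewrite ?collapse_inner ?collapse_outer // => E2 E1; subst.
    + by [].
    + by rewrite insertion_io // => /andP[].
    + by rewrite insertion_oi // => /andP[].
    + by rewrite insertion_oo.
  split=> [jj'|]; first by rewrite jj' dsgraph_irr in Gjj'.
  case: (eqVneq j i) => [ji|nj].
    rewrite ji in Gjj' *; have nj' : j' != i.
      by apply/eqP=> ji'; rewrite ji' dsgraph_irr in Gjj'.
    have /set0Pn[a Sa] : S j' != set0 by move: (cS j') => /eqP ->; rewrite Gjj' orbT.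
    exists (inner_lab i a), (outer_lab n i j').
    by rewrite collapse_inner collapse_outer // insertion_io // Gjj' Sa.
  case: (eqVneq j' i) => [ji|nj'].
    rewrite ji in Gjj' *.
    have /set0Pn[a Sa] : S j != set0 by move: (cS j) => /eqP ->; rewrite Gjj'.
    exists (outer_lab n i j), (inner_lab i a).
    by rewrite collapse_inner collapse_outer // insertion_oi // Gjj' Sa.
  exists (outer_lab n i j), (outer_lab n i j').
  by rewrite !collapse_outer // insertion_oo.
- apply/forallP=> u; apply/negP; case: (labP i u) => [[a ->]|[j nj ->]].
    by rewrite insertion_ii dsgraph_irr.
  by rewrite insertion_oo // dsgraph_irr.
- apply/eqP/ffunP=> j; rewrite ffunE; case: eqVneq => [->|nj]; first by rewrite Si.
  apply/setP=> a; rewrite inE insertion_oi // insertion_io // -andb_orl.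
  by case: (boolP (a \in S j)) => [/Sj ->|_]; rewrite ?andbF.
Qed.

Definition upd (W : eqType) (V : Type) (x : W -> V) (w : W) (y : V) : W -> V :=
  fun u => if u == w then y else x u.

Definition gopg (k : fieldType) (g : dgLieGraph k) (W : finType) (A : {set W})
    (E : {set W * W}) (x : W -> g) : g :=
  if E \subset setX A A
  then opE (pullback (@enum_val W (mem A)) E) [ffun i => x (enum_val i)]
  else 0.

(** Families with at most one element of nonzero degree: permuting them creates
    no Koszul sign. *)
Definition signless (k : fieldType) (g : dgLieGraph k) (W : Type) (x : W -> g) :=
  exists e : W -> int, (forall w, dg_gr (e w) (x w)) /\
                       (forall w w', w <> w' -> e w * e w' = 0).

Section Gopg.
Variables (k : fieldType) (g : dgLieGraph k).

Lemma koszul_signless n (s : 'S_n) (e : 'I_n -> int) :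
  (forall w w', w <> w' -> e w * e w' = 0) -> koszul_sign k s e = 1.
Proof.
move=> e0; rewrite /koszul_sign big1 // => -[p q] /= /andP[lpq lsq].
by rewrite e0 ?expr0z // => /perm_inj pq; rewrite pq ltnn in lpq.
Qed.

Lemma opE_relabel (W : finType) n n' (f : 'I_n -> W) (f' : 'I_n' -> W)
    (E : {set W * W}) (x : W -> g) :
    injective f -> injective f' -> f @: setT = f' @: setT -> signless x ->
  opE (pullback f E) [ffun i => x (f i)] = opE (pullback f' E) [ffun i => x (f' i)].
Proof.
move=> inj_f inj_f' imf [e [xe e0]].
have nn' : n = n'.
  by have := congr1 (fun A => #|pred_of_set A|) imf;
     rewrite !card_imset // !cardsT !card_ord.
subst n'.
have f'P i : exists j, f' j == f i.
  have: f i \in f' @: setT by rewrite -imf imset_f.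
  by case/imsetP=> j _ ->; exists j.
pose s0 i := xchoose (f'P i).
have s0E i : f' (s0 i) = f i by apply/eqP; apply: (xchooseP (f'P i)).
have inj_s0 : injective s0.
  by move=> i j /(congr1 f'); rewrite !s0E => /inj_f.
pose s := perm inj_s0; have sE i : f' (s i) = f i by rewrite permE s0E.
have iso_good (n1 : nat) (f1 f2 : 'I_n1 -> W) (t : 'S_n1) :
    (forall i, f2 (t i) = f1 i) -> is_dsgraph (pullback f1 E) -> is_dsgraph (pullback f2 E).
  move=> tE; rewrite -!good_graph_setT => H.
  have Ef1 : pullback f1 E = pullback t (pullback f2 E).
    by apply/setP=> -[a b]; rewrite !pullbackE !tE.
  have tT : t @: setT = setT.
    apply/setP=> a; rewrite inE; apply/imsetP; exists (t^-1%g a) => //.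
    by rewrite permKV.
  rewrite Ef1 good_pullback in H; first by rewrite tT in H.
    exact: perm_inj.
  by rewrite tT; apply/subsetP=> u; rewrite !inE.
case: (boolP (is_dsgraph (pullback f E))) => dE; last first.
  rewrite opE_bad // opE_bad //; apply: contra dE; apply: (iso_good _ _ _ s^-1%g).
  by move=> i; rewrite -[in LHS]sE permKV.
have dE' := iso_good _ _ _ _ sE dE.
rewrite -[pullback f E]/(edges (DSGraph dE)) -[pullback f' E]/(edges (DSGraph dE')).
rewrite !opE_edges.
rewrite (@dg_op_equivariant k g n s (DSGraph dE) (DSGraph dE') (fun i => e (f' i))).
- rewrite koszul_signless ?scale1r.
    by congr dg_op; apply/ffunP=> i; rewrite !ffunE sE.
  by move=> w w' ne; apply: e0 => /inj_f'.
- apply/forallP=> a; apply/forallP=> b; apply/eqP => /=.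
  by rewrite !pullbackE !sE.
- by move=> i; rewrite ffunE.
Qed.

Lemma imset_enum_val (W : finType) (A : {set W}) :
  (@enum_val W (mem A)) @: setT = A.
Proof.
apply/setP=> a; apply/imsetP/idP => [[i _ ->]|Aa]; first exact: enum_valP.
by exists (enum_rank_in Aa a); rewrite ?enum_rankK_in.
Qed.

Lemma gopgE (W : finType) n (f : 'I_n -> W) (E : {set W * W}) (x : W -> g) :
    injective f -> E \subset setX (f @: setT) (f @: setT) -> signless x ->
  gopg (f @: setT) E x = opE (pullback f E) [ffun i => x (f i)].
Proof.
move=> inj_f sE sx; rewrite /gopg sE; apply: opE_relabel => //.
  exact: enum_val_inj.
exact: imset_enum_val.
Qed.

Variables (W : finType).
Implicit Types (A B : {set W}) (E : {set W * W}) (x y : W -> g).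

Lemma gopg_ext A E x y : {in A, x =1 y} -> gopg A E x = gopg A E y.
Proof.
move=> xy; rewrite /gopg; case: ifP => // _; congr opE.
by apply/ffunP=> i; rewrite !ffunE xy ?enum_valP.
Qed.

Lemma gopg_bad A E x : ~~ good_graph A E -> gopg A E x = 0.
Proof.
move=> nE; rewrite /gopg; case: ifP => // sE; apply: opE_bad; apply: contra nE.
rewrite -good_graph_setT good_pullback ?imset_enum_val //; exact: enum_val_inj.
Qed.

Lemma gopg_lin A E x w (c : k) u v : w \in A ->
  gopg A E (upd x w (c *: u + v)) = c *: gopg A E (upd x w u) + gopg A E (upd x w v).
Proof.
move=> Aw; rewrite /gopg; case: ifP => _; last by rewrite scaler0 addr0.
have xE (z : g) : [ffun i => upd x w z (enum_val i)]
            = subst_at [ffun i => x (enum_val i)] (enum_rank_in Aw w) z.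
  apply/ffunP=> i; rewrite !ffunE /upd -(inj_eq enum_val_inj).
  by rewrite enum_rankK_in.
rewrite !xE /opE; case: insub => [G|]; last by rewrite scaler0 addr0.
exact: dg_op_multilinear.
Qed.

Lemma signless_comp (W' : finType) (f : W' -> W) x :
  injective f -> signless x -> signless (x \o f).
Proof.
move=> inj_f [e [xe e0]]; exists (e \o f); split=> [w|w w' ne] /=; first exact: xe.
by apply: e0 => /inj_f.
Qed.

Lemma pushforward_sub (W' : finType) (f : W' -> W) (A : {set W'}) (E : {set W' * W'}) :
  injective f ->
  (pushforward f E \subset setX (f @: A) (f @: A)) = (E \subset setX A A).
Proof.
move=> inj_f; apply/subsetP/subsetP => sE [a b].
  move=> Eab; have /sE : (f a, f b) \in pushforward f E by apply/imsetP; exists (a, b).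
  by rewrite !in_setX !mem_imset.
by case/imsetP=> -[u v] /sE; rewrite !in_setX => /andP[Au Av] [-> ->]; rewrite !mem_imset ?Au.
Qed.

Lemma pullback_push (W' : finType) (f : W' -> W) (E : {set W' * W'}) :
  injective f -> pullback f (pushforward f E) = E.
Proof.
move=> inj_f; apply/setP=> -[a b]; rewrite pullbackE; apply/imsetP/idP.
  by case=> -[u v] Euv [/inj_f -> /inj_f ->].
by exists (a, b).
Qed.

Lemma gopg_inj (W' : finType) (f : W' -> W) (A : {set W'}) (E : {set W' * W'}) x :
  injective f -> signless x ->
  gopg (f @: A) (pushforward f E) x = gopg A E (x \o f).
Proof.
move=> inj_f sx; rewrite {2}/gopg; case: ifP => sE; last first.
  by rewrite /gopg pushforward_sub // sE.
pose h i := f (@enum_val W' (mem A) i).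
have inj_h : injective h by move=> i j /inj_f/enum_val_inj.
have imh : h @: setT = f @: A by rewrite imset_comp imset_enum_val.
rewrite -imh gopgE ?imh ?pushforward_sub //; congr opE.
by apply/setP=> -[a b]; rewrite !pullbackE /h -pullbackE pullback_push.
Qed.

Lemma gopg1 x w : gopg [set w] set0 x = x w.
Proof.
rewrite /gopg sub0set.
have c1 : #|[set w]| = 1%N by rewrite cards1.
have xE (i : 'I_#|[set w]|) : x (enum_val i) = x w.
  by congr x; apply/set1P; apply: enum_valP.
have d0 : is_dsgraph (pullback (@enum_val W (mem [set w])) set0).
  rewrite -good_graph_setT good_pullback ?sub0set //; last exact: enum_val_inj.
  rewrite imset_enum_val.
  apply/good_graphP; split.
  - by exists w; rewrite set11.
  - by move=> a b; rewrite in_set0.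
  - by move=> c _ a b; rewrite !inE => /eqP-> /eqP->.
  - by exists (fun _ => 0%N) => a b; rewrite in_set0.
rewrite -[pullback _ _]/(edges (DSGraph d0)) opE_edges.
move: (DSGraph d0) => {d0} G.
have ->: [ffun i => x (enum_val i)] = [ffun=> x w] :> {ffun 'I_#|[set w]| -> g}.
  by apply/ffunP=> i; rewrite !ffunE xE.
move: #|[set w]| c1 G {xE} => n -> G.
by rewrite dg_op_unit ffunE.
Qed.

End Gopg.

Lemma pushforward_pullback (W W' : finType) (f : W -> W') (A : {set W})
    (E : {set W' * W'}) :
  E \subset setX (f @: A) (f @: A) -> pushforward f (pullback f E) = E.
Proof.
move=> /subsetP sE; apply/setP=> -[a b]; apply/imsetP/idP.
  by case=> -[u v]; rewrite pullbackE => Euv [-> ->].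
move=> Eab; have := sE _ Eab; rewrite in_setX => /andP[].
case/imsetP=> u _ Ea /imsetP[v _ Eb].
by exists (u, v); rewrite ?pullbackE /= -?Ea -?Eb.
Qed.

Lemma pushforward_inj (W W' : finType) (f : W -> W') :
  injective f -> injective (pushforward f).
Proof. by move=> inj_f; apply: can_inj (fun E => pullback_push E inj_f). Qed.

Lemma contract_push (W1 W2 W1' W2' : finType) (f : W1 -> W2) (f' : W1' -> W2')
    (p : W1 -> W1') (p' : W2 -> W2') (E : {set W1 * W1}) :
  injective f' -> (forall w, p' (f w) = f' (p w)) ->
  contract p' (pushforward f E) = pushforward f' (contract p E).
Proof.
move=> inj_f' pf; apply/setP=> -[a b]; apply/contractP/imsetP.
  case=> ne [_ [_ [/imsetP[[u v] Euv [-> ->]] Ea Eb]]].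
  rewrite !pf in Ea Eb; exists (p u, p v); last by rewrite Ea Eb.
  by apply/contractP; split=> [Ep|]; [apply: ne; rewrite -Ea -Eb Ep | exists u, v].
case=> -[u' v'] /contractP[ne [u [v [Euv Eu Ev]]]] [-> ->].
split=> [/inj_f' //|]; exists (f u), (f v); rewrite !pf Eu Ev; split=> //.
by apply/imsetP; exists (u, v).
Qed.

(** The map that collapses [B] onto its element [v]. *)
Definition shrink (W : finType) (B : {set W}) (v w : W) : W :=
  if w \in B then v else w.

Section GopgInsertion.
Variables (k : fieldType) (g : dgLieGraph k) (W : finType).
Implicit Types (A B : {set W}) (E : {set W * W}) (x y : W -> g).

Lemma gopg_gr A E x (e : W -> int) :
  (forall w, dg_gr (e w) (x w)) -> dg_gr (\sum_(w in A) e w) (gopg A E x).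
Proof.
move=> xe; rewrite /gopg; case: ifP => _; last exact: dg_gr0.
rewrite /opE; case: insub => [G|]; last exact: dg_gr0.
rewrite big_enum_val /=; apply: dg_op_gr => i; rewrite ffunE; exact: xe.
Qed.

Lemma gopg_insert A B v G E x :
    signless x -> A :&: B = [set v] -> good_graph A G -> good_graph B E ->
  gopg A G (upd x v (gopg B E x))
  = \sum_(H | (restrict B H == E) && (contract (shrink B v) H == G))
      gopg (A :|: B) H x.
Proof.
move=> [e [xe e0]] AB gG gE.
have sx : signless x by exists e.
have /setIP[Av Bv] : v \in A :&: B by rewrite AB set11.
have nAB w : w \in A -> w != v -> w \notin B.
  by move=> Aw; apply: contra => Bw; rewrite -in_set1 -AB inE Aw.
pose z := gopg B E x.
pose y w := if w == v then z else if w \in B then 0 else x w.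
have -> : gopg A G (upd x v (gopg B E x)) = gopg A G y.
  apply: gopg_ext => w Aw; rewrite /upd /y; case: eqVneq => // /(nAB _ Aw).
  by move/negPf->.
have sy : signless y.
  exists (fun w => if w == v then \sum_(b in B) e b else if w \in B then 0 else e w).
  have evB w : w \notin B -> (\sum_(b in B) e b) * e w = 0.
    move=> nBw; rewrite mulr_suml big1 // => b Bb; apply: e0 => bw.
    by rewrite -bw Bb in nBw.
  split=> [w|w w' ne]; rewrite ?/y; do ?case: eqVneq => [?|nv]; subst;
    rewrite ?Bv //; do ?case: ifPn => ?; rewrite ?mulr0 ?mul0r //.
  - exact: gopg_gr.
  - exact: dg_gr0.
  - by rewrite evB.
  - by rewrite mulrC evB.
  - exact: e0.
pose t := enum (A :\ v); pose sB := enum B.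
have [m tm] : {m | size t = m} by exists (size t).
have [n sn] : {n | size sB = n.+1}.
  by exists (size sB).-1; rewrite prednK // -cardE card_gt0; apply/set0Pn; exists v.
have uB : uniq sB by exact: enum_uniq.
have memB w : (w \in sB) = (w \in B) by exact: mem_enum.
have memt w : (w \in t) = (w \in A :\ v) by exact: mem_enum.
have u1 : uniq (v :: t) by rewrite /= memt !inE eqxx /= enum_uniq.
have u2 : uniq (sB ++ t).
  rewrite cat_uniq uB enum_uniq andbT /=; apply/hasPn=> w.
  by rewrite memt memB !inE => /andP[nv Aw]; apply: nAB.
pose f1 (j : 'I_m.+1) := nth v (v :: t) j.
pose f2 (j : 'I_n.+1) := nth v sB j.
pose f (j : 'I_(m + n).+1) := nth v (sB ++ t) j.
have size_f : size (sB ++ t) = (m + n).+1 by rewrite size_cat sn tm addSn addnC.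
have inj1 : injective f1.
  by move=> a b /eqP; rewrite nth_uniq //= ?tm // => /eqP/val_inj.
have inj2 : injective f2.
  by move=> a b /eqP; rewrite nth_uniq ?sn // => /eqP/val_inj.
have injf : injective f.
  by move=> a b /eqP; rewrite nth_uniq ?size_f // => /eqP/val_inj.
have im1 : f1 @: setT = A.
  apply/setP=> a; apply/imsetP/idP => [[j _ ->]|Aa].
    have : f1 j \in v :: t by apply: mem_nth; rewrite /= tm.
    by rewrite inE => /orP[/eqP ->//|]; rewrite memt => /setD1P[].
  have at1 : a \in v :: t by rewrite inE memt !inE Aa andbT orbN.
  have lt : (index a (v :: t) < m.+1)%N by rewrite -tm -/(size (v :: t)) index_mem.
  by exists (Ordinal lt); rewrite // /f1 nth_index.
have im2 : f2 @: setT = B.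
  apply/setP=> a; apply/imsetP/idP => [[j _ ->]|Ba].
    by rewrite -memB; apply: mem_nth; rewrite sn.
  have lt : (index a sB < n.+1)%N by rewrite -sn index_mem memB.
  by exists (Ordinal lt); rewrite // /f2 nth_index ?memB.
have imf : f @: setT = A :|: B.
  apply/setP=> a; apply/imsetP/idP => [[j _ ->]|].
    have : f j \in sB ++ t by apply: mem_nth; rewrite size_f.
    by rewrite mem_cat memB memt !inE => /orP[->|/andP[_ ->] //]; rewrite orbT.
  move=> ABa; have ain : a \in sB ++ t.
    rewrite mem_cat memB memt; move: ABa; rewrite !inE.
    by case: eqVneq => [->|_]; rewrite ?Bv //= orbC.
  have lt : (index a (sB ++ t) < (m + n).+1)%N by rewrite -size_f index_mem.
  by exists (Ordinal lt); rewrite // /f nth_index.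
have f_inner a : f (inner_lab ord0 a) = f2 a.
  by rewrite /f val_inner nth_cat sn add0n ltn_ord.
have f_outer j : j != ord0 -> f (outer_lab n ord0 j) = f1 j.
  move=> nj; rewrite /f val_outer nth_cat sn /=.
  have: (0 < j)%N by rewrite lt0n.
  case: j nj => [[|j] lj] //= _ _.
  by rewrite addSn !ltnS ltnNge leq_addl subSS addnK.
have shrink_f w : shrink B v (f w) = f1 (collapse (m:=m) (n:=n) ord0 w).
  case: (labP ord0 w) => [[a ->]|[j nj ->]].
    by rewrite collapse_inner f_inner /shrink -{1}im2 imset_f.
  rewrite collapse_outer // f_outer // /shrink ifN //; apply: nAB.
    by rewrite -im1 imset_f.
  by rewrite -[v]/(f1 ord0) (inj_eq inj1).
have [d1 d2] : is_dsgraph (pullback f1 G) /\ is_dsgraph (pullback f2 E).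
  split; rewrite -good_graph_setT good_pullback ?im1 ?im2 //.
    by case/and4P: gG.
  by case/and4P: gE.
have sG : G \subset setX A A by case/and4P: gG.
have sE : E \subset setX B B by case/and4P: gE.
rewrite -im1 gopgE ?im1 // -[pullback f1 G]/(edges (DSGraph d1)) opE_edges.
pose X := [ffun u => x (f u)].
have ->: [ffun i => y (f1 i)] =
   [ffun j => if j == ord0 then dg_op (DSGraph d2) [ffun a => X (inner_lab ord0 a)]
              else X (outer_lab n ord0 j)].
  apply/ffunP=> j; rewrite !ffunE; case: (eqVneq j ord0) => [->|nj].
    rewrite /y -[f1 ord0]/v eqxx /z -im2 gopgE ?im2 //.
    rewrite -[pullback f2 E]/(edges (DSGraph d2)) opE_edges; congr dg_op.
    by apply/ffunP=> a; rewrite !ffunE f_inner.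
  have nv : f1 j != v by rewrite -[v]/(f1 ord0) (inj_eq inj1).
  rewrite f_outer // /y (negPf nv) ifN //; apply: nAB => //.
  by rewrite -im1 imset_f.
rewrite dg_op_insert /=.
rewrite [RHS](bigID (fun H : {set W * W} => H \subset setX (A :|: B) (A :|: B))) /=.
rewrite [X in _ = _ + X]big1 ?addr0; last first.
  by move=> H /andP[_ nH]; rewrite /gopg (negPf nH).
rewrite (reindex_onto (pushforward f) (pullback f)) /=; last first.
  by move=> H /andP[_ sH]; rewrite (@pushforward_pullback _ _ f setT) ?imf.
have push_sub H' : pushforward f H' \subset setX (A :|: B) (A :|: B).
  by rewrite -imf pushforward_sub //; apply/subsetP=> u; rewrite !inE.
apply: eq_big => [H'|H' _]; last by rewrite -imf gopgE ?pullback_push ?imf.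
rewrite push_sub pullback_push // eqxx !andbT; congr (_ && _).
  have -> : restrict B (pushforward f H') = pushforward f2 (pullback (inner_lab ord0) H').
    apply/setP=> -[a b]; rewrite restrictE; apply/and3P/imsetP.
      case=> /imsetP[[u w] Huw [-> ->]].
      rewrite -im2 => /imsetP[u' _ Eu] /imsetP[w' _ Ew].
      exists (u', w'); last by rewrite Eu Ew.
      rewrite -f_inner in Eu; rewrite -f_inner in Ew.
      by rewrite pullbackE -(injf _ _ Eu) -(injf _ _ Ew).
    case=> -[u w]; rewrite pullbackE => Huw [-> ->].
    rewrite -im2 !imset_f //; split=> //; apply/imsetP.
    by exists (inner_lab ord0 u, inner_lab ord0 w); rewrite //= !f_inner.
  rewrite -{2}(@pushforward_pullback _ _ f2 setT E) ?im2 //.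
  by rewrite (inj_eq (pushforward_inj inj2)).
rewrite (contract_push _ inj1 shrink_f) -{2}(@pushforward_pullback _ _ f1 setT G) ?im1 //.
by rewrite (inj_eq (pushforward_inj inj1)).
Qed.

Lemma gopg_d A E x : (forall w, dg_gr 0 (x w)) ->
  dg_d g (gopg A E x) = \sum_(w in A) gopg A E (upd x w (dg_d g (x w))).
Proof.
move=> x0; rewrite /gopg; case: ifP => _; last by rewrite big1 // linear0.
rewrite /opE; case: insub => [G|]; last by rewrite big1 // linear0.
rewrite (@dg_op_derivation k g _ G (fun _ => 0)); last by move=> i; rewrite ffunE.
rewrite [RHS]big_enum_val /=; apply: eq_bigr => i _.
rewrite big1 // expr0z scale1r; congr dg_op; apply/ffunP=> j; rewrite !ffunE /upd.
by rewrite (inj_eq enum_val_inj).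
Qed.

End GopgInsertion.

Lemma gopg_fil (k : fieldType) (g : completeLieGraph k) (W : finType)
    (A : {set W}) (E : {set W * W}) (x : W -> g) (r : W -> nat) (e : W -> int) :
  (forall w, w \in A -> fil (r w) (e w) (x w)) ->
  fil (\sum_(w in A) r w)%N (\sum_(w in A) e w) (gopg A E x).
Proof.
move=> xe; rewrite /gopg; case: ifP => _; last exact: fil_zero.
rewrite /opE; case: insub => [G|]; last exact: fil_zero.
rewrite [in X in fil X]big_enum_val [in X in fil _ X]big_enum_val /=; apply: fil_op => i; rewrite ffunE; apply: xe.
exact: enum_valP.
Qed.

(** * Even Lie-graph algebras *)

Record evenLieGraph (k : fieldType) := EvenLieGraph {
  ev_sort :> lmodType k;
  ev_fil : nat -> ev_sort -> Prop;
  gop : forall W : finType, {set W} -> {set W * W} -> (W -> ev_sort) -> ev_sort;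
  ev_fil_zero : forall i, ev_fil i 0;
  ev_filP : forall i (c : k) x y, ev_fil i x -> ev_fil i y -> ev_fil i (c *: x + y);
  ev_fil_decr : forall i x, ev_fil i.+1 x -> ev_fil i x;
  ev_separated : forall x, (forall i, ev_fil i x) -> x = 0;
  ev_complete : forall u : nat -> ev_sort, (forall i, ev_fil 0 (u i)) ->
    (forall i, ev_fil i (u i.+1 - u i)) ->
    exists2 x, ev_fil 0 x & forall i, ev_fil i (x - u i);
  gop_ext : forall (W : finType) (A : {set W}) E (x y : W -> ev_sort),
    {in A, x =1 y} -> gop A E x = gop A E y;
  gop_bad : forall (W : finType) (A : {set W}) E (x : W -> ev_sort),
    ~~ good_graph A E -> gop A E x = 0;
  gop_lin : forall (W : finType) (A : {set W}) E (x : W -> ev_sort) w (c : k) u v,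
    w \in A ->
    gop A E (upd x w (c *: u + v)) = c *: gop A E (upd x w u) + gop A E (upd x w v);
  gop_fil : forall (W : finType) (A : {set W}) E (x : W -> ev_sort) (r : W -> nat),
    (forall w, w \in A -> (0 < r w)%N /\ ev_fil (r w) (x w)) ->
    ev_fil (\sum_(w in A) r w)%N (gop A E x);
  gop_inj : forall (W W' : finType) (f : W' -> W) (A : {set W'}) E
      (x : W -> ev_sort), injective f -> (forall w, ev_fil 1 (x w)) ->
    gop (f @: A) (pushforward f E) x = gop A E (x \o f);
  gop_unit : forall (W : finType) (x : W -> ev_sort) w, gop [set w] set0 x = x w;
  gop_insert : forall (W : finType) (A B : {set W}) v G E (x : W -> ev_sort),
    (forall w, ev_fil 1 (x w)) -> A :&: B = [set v] ->
    good_graph A G -> good_graph B E ->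
    gop A G (upd x v (gop B E x))
    = \sum_(H | (restrict B H == E) && (contract (shrink B v) H == G))
        gop (A :|: B) H x }.

Section EvenExtension.
Variables (k : fieldType) (g : completeLieGraph k).
Let V : lmodType k := (g * g)%type.

Definition ext_fil (i : nat) (x : V) : Prop := fil i 0 x.1 /\ fil i.-1 (-1) x.2.

Definition ext_gop (W : finType) (A : {set W}) (E : {set W * W}) (x : W -> V) : V :=
  (gopg A E (fun w => (x w).1),
   \sum_(u in A) gopg A E (upd (fun w => (x w).1) u (x u).2)).

Lemma fil_le i j e (x : g) : (i <= j)%N -> fil j e x -> fil i e x.
Proof.
move=> le_ij; rewrite -(subnK le_ij); elim: (j - i)%N => [|d IH] //.
by rewrite addSn => /fil_decr/IH.
Qed.

Lemma fil_gr i e (x : g) : fil i e x -> dg_gr e x.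
Proof. by move/(fil_le (leq0n i))/fil_0. Qed.

Lemma fil_add i e (x y : g) : fil i e x -> fil i e y -> fil i e (x + y).
Proof. by move=> /(filP 1)/[apply]; rewrite scale1r. Qed.

Lemma fil_scale i e (c : k) (x : g) : fil i e x -> fil i e (c *: x).
Proof. by move=> /(filP c)/(_ (fil_zero g i e)); rewrite addr0. Qed.

Lemma fil_opp i e (x : g) : fil i e x -> fil i e (- x).
Proof. by rewrite -scaleN1r; apply: fil_scale. Qed.

Lemma fil_sub i e (x y : g) : fil i e x -> fil i e y -> fil i e (x - y).
Proof. by move=> Fx /fil_opp; apply: fil_add. Qed.

Lemma fil_sum i e (I : Type) (s : seq I) (P : pred I) (F : I -> g) :
  (forall j, P j -> fil i e (F j)) -> fil i e (\sum_(j <- s | P j) F j).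
Proof.
move=> FF; elim/big_rec: _ => [|j x Pj Fx]; first exact: fil_zero.
by apply: fil_add => //; apply: FF.
Qed.

Lemma gopg0 (W : finType) (A : {set W}) E (x : W -> g) w :
  w \in A -> x w = 0 -> gopg A E x = 0.
Proof.
move=> Aw xw; have := @gopg_lin k g W A E x w (-1) 0 0 Aw.
rewrite scaler0 addr0 scaleN1r addNr => <-; apply: gopg_ext => u _; rewrite /upd.
by case: eqVneq => // ->.
Qed.

Lemma upd_upd (W : eqType) (U : Type) (x : W -> U) w w' y y' : w != w' ->
  upd (upd x w y) w' y' =1 upd (upd x w' y') w y.
Proof.
move=> ne u; rewrite /upd; case: (eqVneq u w) => [->|//].
by rewrite (negPf ne).
Qed.

Lemma signless_upd (W : finType) (x : W -> g) u (a : g) e :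
  (forall w, dg_gr 0 (x w)) -> dg_gr e a -> signless (upd x u a).
Proof.
move=> x0 ae; exists (fun w => if w == u then e else 0); split=> [w|w w' ne].
  by rewrite /upd; case: ifP.
by do 2 case: eqVneq => [?|?]; subst; rewrite ?mulr0 ?mul0r //; case: ne.
Qed.

Lemma signless0 (W : finType) (x : W -> g) : (forall w, dg_gr 0 (x w)) -> signless x.
Proof. by move=> x0; exists (fun _ => 0); split=> // w w' _; rewrite mulr0. Qed.

Fact ext_fil_zero i : ext_fil i 0.
Proof. by split; apply: fil_zero. Qed.

Fact ext_filP i (c : k) x y : ext_fil i x -> ext_fil i y -> ext_fil i (c *: x + y).
Proof. by case=> x1 x2 [y1 y2]; split; apply: filP. Qed.

Fact ext_fil_decr i x : ext_fil i.+1 x -> ext_fil i x.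
Proof.
by case=> x1 x2; split; [apply: fil_decr | apply: fil_le x2; apply: leq_pred].
Qed.

Fact ext_separated x : (forall i, ext_fil i x) -> x = 0.
Proof.
case: x => x a Fx; congr (_, _); first by apply: (@fil_separated _ g 0) => i; case: (Fx i).
by apply: (@fil_separated _ g (-1)) => i; case: (Fx i.+1).
Qed.

Fact ext_complete (u : nat -> V) : (forall i, ext_fil 0 (u i)) ->
    (forall i, ext_fil i (u i.+1 - u i)) ->
    exists2 x, ext_fil 0 x & forall i, ext_fil i (x - u i).
Proof.
move=> u0 uS.
have [x x0 xP] : exists2 x, dg_gr 0 x & forall i, fil i 0 (x - (u i).1).
  by apply: fil_complete => i; [apply/fil_0; case: (u0 i) | case: (uS i)].
have [a a0 aP] : exists2 a, dg_gr (-1) a & forall i, fil i (-1) (a - (u i.+1).2).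
  by apply: fil_complete => i; [apply/fil_0; case: (u0 i.+1) | case: (uS i.+1)].
exists (x, a); first by split; apply/fil_0.
move=> i; split; first exact: xP.
case: i => [|i] /=; last exact: aP.
by apply: fil_sub; [apply/fil_0 | case: (u0 0%N)].
Qed.

Fact ext_gop_ext (W : finType) (A : {set W}) E (x y : W -> V) :
  {in A, x =1 y} -> ext_gop A E x = ext_gop A E y.
Proof.
move=> xy; congr (_, _); first by apply: gopg_ext => w /xy ->.
by apply: eq_bigr => u Au; apply: gopg_ext => w /xy Aw; rewrite /upd Aw xy.
Qed.

Fact ext_gop_bad (W : finType) (A : {set W}) E (x : W -> V) :
  ~~ good_graph A E -> ext_gop A E x = 0.
Proof.
by move=> nE; congr (_, _); rewrite ?gopg_bad // big1 // => u _; rewrite gopg_bad.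
Qed.

Fact ext_gop_lin (W : finType) (A : {set W}) E (x : W -> V) w (c : k) u v :
  w \in A ->
  ext_gop A E (upd x w (c *: u + v)) =
  c *: ext_gop A E (upd x w u) + ext_gop A E (upd x w v).
Proof.
move=> Aw; pose x1 w := (x w).1.
have fstE z : (fun s => (upd x w z s).1) =1 upd x1 w z.1.
  by move=> s; rewrite /upd; case: ifP.
congr (_, _) => /=.
  under gopg_ext => s _ do rewrite fstE.
  rewrite gopg_lin //; congr (_ *: _ + _); apply: gopg_ext => s _; by rewrite -fstE.
rewrite scaler_sumr -big_split /=; apply: eq_bigr => t At.
case: (eqVneq t w) => [->|nt].
  have uE z : {in A, upd (fun s => (upd x w z s).1) w (upd x w z w).2 =1 upd x1 w z.2}.
    by move=> s _; rewrite /upd !eqxx; case: (s == w).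
  by rewrite !(gopg_ext _ (uE _)) gopg_lin.
have uE z : {in A, upd (fun s => (upd x w z s).1) t (upd x w z t).2
                   =1 upd (upd x1 t (x t).2) w z.1}.
  move=> s _; rewrite -upd_upd 1?eq_sym // /upd (negPf nt).
  by case: (s == t) => //; case: (s == w).
by rewrite !(gopg_ext _ (uE _)) gopg_lin.
Qed.

Fact ext_gop_fil (W : finType) (A : {set W}) E (x : W -> V) (r : W -> nat) :
  (forall w, w \in A -> (0 < r w)%N /\ ext_fil (r w) (x w)) ->
  ext_fil (\sum_(w in A) r w)%N (ext_gop A E x).
Proof.
move=> xr; split=> /=.
  have -> : (0 : int) = \sum_(w in A) 0 by rewrite big1.
  by apply: gopg_fil => w /xr[_ []].
apply: fil_sum => u Au.
have -> : (\sum_(w in A) r w).-1 = (\sum_(w in A) if w == u then (r u).-1 else r w)%N.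
  rewrite (bigD1 u) //= [RHS](bigD1 u) //= eqxx.
  rewrite [in RHS](eq_bigr r); last by move=> w /andP[_ /negPf ->].
  by case: (xr u Au) => + _; case: (r u).
have -> : (-1 : int) = \sum_(w in A) if w == u then -1 else 0.
  by rewrite (bigD1 u) //= eqxx big1 ?addr0 // => w /andP[_ /negPf ->].
apply: gopg_fil => w /xr[rw [x1 x2]]; rewrite /upd; case: ifP => // /eqP <- //.
Qed.

Lemma ext_fil1_gr (x : V) : ext_fil 1 x -> dg_gr 0 x.1 /\ dg_gr (-1) x.2.
Proof. by case=> /fil_gr x1 /fil_gr. Qed.

Fact ext_gop_inj (W W' : finType) (f : W' -> W) (A : {set W'}) E (x : W -> V) :
  injective f -> (forall w, ext_fil 1 (x w)) ->
  ext_gop (f @: A) (pushforward f E) x = ext_gop A E (x \o f).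
Proof.
move=> inj_f x1; congr (_, _).
  apply: gopg_inj => //; apply: signless0 => w; by have [] := ext_fil1_gr (x1 w).
rewrite big_imset /=; last by move=> ? ? _ _ /inj_f.
apply: eq_bigr => u Au; rewrite gopg_inj //; last first.
  apply: (@signless_upd _ _ _ _ (-1)) => [w|]; last by have [] := ext_fil1_gr (x1 (f u)).
  by have [] := ext_fil1_gr (x1 w).
by apply: gopg_ext => w _; rewrite /= /upd (inj_eq inj_f).
Qed.

Fact ext_gop_unit (W : finType) (x : W -> V) w : ext_gop [set w] set0 x = x w.
Proof.
rewrite /ext_gop gopg1 big_set1 gopg1 /upd eqxx; by case: (x w).
Qed.

Fact ext_gop_insert (W : finType) (A B : {set W}) v G E (x : W -> V) :
    (forall w, ext_fil 1 (x w)) -> A :&: B = [set v] ->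
    good_graph A G -> good_graph B E ->
    ext_gop A G (upd x v (ext_gop B E x))
    = \sum_(H | (restrict B H == E) && (contract (shrink B v) H == G))
        ext_gop (A :|: B) H x.
Proof.
move=> xF AB gG gE.
have x0 w : dg_gr 0 (x w).1 by have [] := ext_fil1_gr (xF w).
have xm w : dg_gr (-1) (x w).2 by have [] := ext_fil1_gr (xF w).
pose x1 w := (x w).1.
have /setIP[Av Bv] : v \in A :&: B by rewrite AB set11.
have nAB w : w \in A -> w != v -> w \notin B.
  by move=> Aw; apply: contra => Bw; rewrite -in_set1 -AB inE Aw.
have sumE (F : {set W * W} -> V) (P : pred {set W * W}) :
  \sum_(H | P H) F H = (\sum_(H | P H) (F H).1, \sum_(H | P H) (F H).2).
  elim/big_rec3: _ => [|H a b c _ ->] //; by case: (F H).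
rewrite sumE; congr (_, _) => /=.
  rewrite -(gopg_insert _ AB) //; last exact: signless0.
  by apply: gopg_ext => w _; rewrite /upd; case: ifP.
have insE u : \sum_(H | (restrict B H == E) && (contract (shrink B v) H == G))
     gopg (A :|: B) H (upd x1 u (x u).2)
   = gopg A G (upd (upd x1 u (x u).2) v (gopg B E (upd x1 u (x u).2))).
  rewrite -(gopg_insert _ AB) //.
  by apply: (@signless_upd _ _ _ _ (-1)).
rewrite exchange_big /=.
rewrite [RHS](eq_bigr _ (fun u _ => insE u)).
rewrite (bigID (fun u => u \in B)) /= [RHS](bigID (fun u => u \in B)) /=; congr (_ + _).
  rewrite (eq_bigl (pred1 v)); last first.
    move=> u /=; rewrite -in_set1 -AB inE //.
  rewrite big_pred1_eq.
  have sumlin (I : Type) (s : seq I) (P : pred I) (F : I -> g) :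
     gopg A G (upd x1 v (\sum_(i <- s | P i) F i)) =
     \sum_(i <- s | P i) gopg A G (upd x1 v (F i)).
    elim/big_rec2: _ => [|i y1 y2 _ <-]; first by rewrite (@gopg0 _ _ _ _ v) // /upd eqxx.
    by rewrite -[F i]scale1r gopg_lin // !scale1r.
  rewrite (@gopg_ext _ _ _ _ _ _ (upd x1 v (\sum_(u in B) gopg B E (upd x1 u (x u).2)))).
    rewrite sumlin [RHS](eq_bigl (mem B)); last first.
      by move=> u; rewrite !inE; case: (u \in B); rewrite ?orbT ?andbF.
    apply: eq_bigr => b Bb; apply: gopg_ext => w Aw; rewrite /upd.
    case: eqVneq => // nw; case: eqVneq => // wb.
    by rewrite wb in Aw nw; rewrite (negPf (nAB _ Aw nw)) in Bb.
  by move=> w _; rewrite /upd eqxx; case: (w == v).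
apply: eq_big => [u|u /andP[Au nBu]].
  by rewrite !inE; case: (u \in B); rewrite ?orbF ?andbF.
have nuv : u != v by apply: contraNneq nBu => ->.
apply: gopg_ext => w Aw; rewrite /upd (negPf nuv).
case: (eqVneq w u) => [->|nwu]; first by rewrite (negPf nuv).
case: (eqVneq w v) => [wv|//] /=.
by apply: gopg_ext => b Bb; case: eqVneq => // bu; rewrite bu (negPf nBu) in Bb.
Qed.

(** The even algebra [g_0 + eps g_(-1)], with [eps] odd of square zero: an
    identity in it holds in degree 0 and, linearised, for one argument of degree
    [-1]; no Koszul sign remains.  As [eps] lies in the first step of the
    filtration, every element [eps a] is a legitimate argument of the gauge
    operations. *)
Definition extension : evenLieGraph k :=
  @EvenLieGraph k V ext_fil ext_gop ext_fil_zero ext_filP ext_fil_decr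
    ext_separated ext_complete ext_gop_ext ext_gop_bad ext_gop_lin ext_gop_fil
    ext_gop_inj ext_gop_unit ext_gop_insert.

End EvenExtension.

(** * Multilinearity and total substitution *)

Section EvenBasics.
Variables (k : fieldType) (h : evenLieGraph k).
Implicit Types (x y : h).

Lemma ev_le (i j : nat) x : (i <= j)%N -> ev_fil j x -> ev_fil i x.
Proof.
move=> le_ij; rewrite -(subnK le_ij); elim: (j - i)%N => [|d IH] //.
by rewrite addSn => /ev_fil_decr/IH.
Qed.

Lemma ev_add i x y : ev_fil i x -> ev_fil i y -> ev_fil i (x + y).
Proof. by move=> /(ev_filP 1)/[apply]; rewrite scale1r. Qed.

Lemma ev_scale i (c : k) x : ev_fil i x -> ev_fil i (c *: x).
Proof. by move=> /(ev_filP c)/(_ (ev_fil_zero h i)); rewrite addr0. Qed.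

Lemma ev_opp i x : ev_fil i x -> ev_fil i (- x).
Proof. by rewrite -scaleN1r; apply: ev_scale. Qed.

Lemma ev_sub i x y : ev_fil i x -> ev_fil i y -> ev_fil i (x - y).
Proof. by move=> Fx /ev_opp; apply: ev_add. Qed.

Lemma ev_sum i (I : Type) (s : seq I) (P : pred I) (F : I -> h) :
  (forall a, P a -> ev_fil i (F a)) -> ev_fil i (\sum_(j <- s | P j) F j).
Proof.
move=> FF; elim/big_rec: _ => [|j x Pj Fx]; first exact: ev_fil_zero.
by apply: ev_add => //; apply: FF.
Qed.

Lemma ev_trans i x y z : ev_fil i (x - y) -> ev_fil i (y - z) -> ev_fil i (x - z).
Proof. by move=> /ev_add/[apply]; rewrite addrA subrK. Qed.

Lemma ev_sym i x y : ev_fil i (x - y) -> ev_fil i (y - x).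
Proof. by move/ev_opp; rewrite opprB. Qed.

Lemma ev_eq x y : (forall i, ev_fil i (x - y)) -> x = y.
Proof. by move/ev_separated/eqP; rewrite subr_eq0 => /eqP. Qed.

Section Multilinear.
Variables (W : finType) (A : {set W}) (E : {set W * W}).
Implicit Types (X Y : W -> h).

Lemma gop_zero X w : w \in A -> X w = 0 -> gop A E X = 0.
Proof.
move=> Aw xw; have := @gop_lin k h W A E X w (-1) 0 0 Aw.
rewrite scaler0 addr0 scaleN1r addNr => <-; apply: gop_ext => u _; rewrite /upd.
by case: eqVneq => // ->.
Qed.

Lemma gop_upd_id X w : gop A E (upd X w (X w)) = gop A E X.
Proof. by apply: gop_ext => u _; rewrite /upd; case: eqP => // ->. Qed.

Lemma gop_upd0 X w : w \in A -> gop A E (upd X w 0) = 0.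
Proof. by move=> Aw; apply: (gop_zero Aw); rewrite /upd eqxx. Qed.

Lemma gop_add X w x y : w \in A ->
  gop A E (upd X w (x + y)) = gop A E (upd X w x) + gop A E (upd X w y).
Proof. by move=> Aw; rewrite -[x in LHS]scale1r gop_lin // scale1r. Qed.

Lemma gop_scale X w (c : k) x : w \in A ->
  gop A E (upd X w (c *: x)) = c *: gop A E (upd X w x).
Proof. by move=> Aw; rewrite -[c *: x]addr0 gop_lin // gop_upd0 // addr0. Qed.

Lemma gop_sum X w (I : Type) (s : seq I) (P : pred I) (F : I -> h) : w \in A ->
  gop A E (upd X w (\sum_(i <- s | P i) F i))
  = \sum_(i <- s | P i) gop A E (upd X w (F i)).
Proof.
move=> Aw; elim/big_rec2: _ => [|i y1 y2 _ <-]; first exact: gop_upd0.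
exact: gop_add.
Qed.

Lemma gop_scale_all (c : W -> k) X :
  gop A E (fun w => c w *: X w) = (\prod_(w in A) c w) *: gop A E X.
Proof.
suff H s : uniq s -> {subset s <= A} ->
    gop A E (fun w => if w \in s then c w *: X w else X w)
    = (\prod_(w <- s) c w) *: gop A E X.
  rewrite -big_enum /= -H ?enum_uniq //; last by move=> w; rewrite mem_enum.
  by apply: gop_ext => w Aw; rewrite mem_enum Aw.
elim: s => [|a s IH] /=.
  by rewrite big_nil scale1r => _ _; apply: gop_ext.
case/andP=> nas us sA; have Aa : a \in A by apply: sA; rewrite mem_head.
rewrite big_cons -scalerA -IH //; last by move=> w sw; apply: sA; rewrite inE sw orbT.
set X' := (fun w => if w \in s then _ else _).
have X'a : X' a = X a by rewrite /X' (negPf nas).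
rewrite -[in RHS](gop_upd_id X' a) X'a -gop_scale //.
apply: gop_ext => w _; rewrite /upd /X' inE.
by case: eqVneq => [->|] //=.
Qed.

Lemma gop_fil_card X : (forall w, ev_fil 1 (X w)) -> ev_fil #|A| (gop A E X).
Proof.
by move=> X1; rewrite -sum1_card; apply: gop_fil.
Qed.

Lemma gop_fil1 X : (forall w, ev_fil 1 (X w)) -> ev_fil 1 (gop A E X).
Proof.
move=> X1; case: (posnP #|A|) => [/eqP|A0]; last exact: ev_le A0 (gop_fil_card X1).
rewrite cards_eq0 => /eqP A0; rewrite gop_bad; first exact: ev_fil_zero.
by rewrite /good_graph A0 eqxx.
Qed.

Lemma gop_congr X Y i : (0 < i)%N ->
    (forall w, ev_fil 1 (X w)) -> (forall w, ev_fil 1 (Y w)) ->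
    (forall w, ev_fil i (X w - Y w)) ->
  ev_fil (#|A| + i).-1 (gop A E X - gop A E Y).
Proof.
move=> i0 X1 Y1 XY.
pose mix (s : seq W) w := if w \in s then X w else Y w.
suff H s : uniq s -> {subset s <= A} ->
    ev_fil (#|A| + i).-1 (gop A E (mix s) - gop A E Y).
  have -> : gop A E X = gop A E (mix (enum A)).
    by apply: gop_ext => w Aw; rewrite /mix mem_enum Aw.
  by apply: H; [apply: enum_uniq | move=> w; rewrite mem_enum].
elim: s => [|a s IH] /=.
  move=> _ _; rewrite (@gop_ext _ _ _ _ _ _ Y) // subrr; exact: ev_fil_zero.
case/andP=> nas us sA; have Aa : a \in A by apply: sA; rewrite mem_head.
apply: (@ev_trans _ _ (gop A E (mix s))); last first.
  by apply: IH => // w sw; apply: sA; rewrite inE sw orbT.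
have -> : gop A E (mix (a :: s)) - gop A E (mix s)
          = gop A E (upd (mix s) a (X a - Y a)).
  rewrite gop_add // -[- Y a]scaleN1r gop_scale // scaleN1r; congr (_ - _).
    apply: gop_ext => w _; rewrite /upd /mix inE; by case: eqVneq => [->|].
  by apply: gop_ext => w _; rewrite /upd /mix; case: eqVneq => [->|] //; rewrite (negPf nas).
have -> : (#|A| + i).-1 = (\sum_(w in A) if w == a then i else 1)%N.
  rewrite (bigD1 a) //= eqxx (eq_bigr (fun _ => 1%N)); last first.
    by move=> w /andP[_ /negPf ->].
  have := cardD1 a A; rewrite Aa -sum1_card add1n => Ec.
  rewrite Ec addSn /= addnC; congr (_ + _)%N; rewrite -sum1_card.
  by apply: eq_bigl => w; rewrite !inE andbC.
apply: gop_fil => w _; rewrite /upd; case: ifP => [_|_]; split=> //.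
by rewrite /mix; case: ifP.
Qed.

End Multilinear.

Lemma gop_expand (V J : finType) (j0 : J) (E : {set V * V}) (P : V -> pred J)
    (F : V -> J -> h) :
  gop setT E (fun v => \sum_(j | P v j) F v j)
  = \sum_(f in family P) gop setT E (fun v => F v ((f : {ffun V -> J}) v)).
Proof.
suff H (s : seq V) : uniq s ->
    gop setT E (fun v => \sum_(j | P v j) F v j)
    = \sum_(f in pfamily j0 (mem s) P)
        gop setT E (fun v => if v \in s then F v ((f : {ffun V -> J}) v)
                             else \sum_(j | P v j) F v j).
  rewrite (H (enum V)) ?enum_uniq //; apply: eq_big => [f|f _]; last first.
    by apply: gop_ext => v _; rewrite mem_enum.
  apply/pfamilyP/familyP => [[_ Pf] v|Pf]; first by apply: Pf; rewrite /= mem_enum.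
  by split=> // ; apply/subsetP=> v _; rewrite /= mem_enum.
elim: s => [|a s IH] /=.
  move=> _; rewrite (big_pred1 [ffun=> j0]); first by apply: gop_ext.
  move=> f; apply/pfamilyP/eqP => [[/subsetP sf _]|->].
    apply/ffunP=> v; rewrite ffunE; apply/eqP; apply: contraTT isT => fv.
    by have := sf v fv.
  by split=> //; apply/subsetP=> v; rewrite !inE ffunE eqxx.
case/andP=> nas us; rewrite IH //.
have expand_a f : gop setT E (fun v => if v \in s then F v ((f : {ffun V -> J}) v)
                             else \sum_(j | P v j) F v j)
   = \sum_(j | P a j) gop setT E (upd (fun v => if v \in s then F v (f v)
                             else \sum_(j | P v j) F v j) a (F a j)).
  rewrite -gop_sum ?inE //; apply: gop_ext => v _; rewrite /upd.
  by case: eqVneq => // ->; rewrite (negPf nas).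
rewrite (eq_bigr _ (fun f _ => expand_a f)).
rewrite pair_big_dep /=.
rewrite (reindex_onto (fun f : {ffun V -> J} =>
     ([ffun v => if v == a then j0 else f v] : {ffun V -> J}, f a))
   (fun fj => [ffun v => if v == a then fj.2 else fj.1 v])) /=; last first.
  move=> [f j] /= /andP[/pfamilyP[/subsetP sf _] _]; congr (_, _); last first.
    by rewrite ffunE eqxx.
  apply/ffunP=> v; rewrite !ffunE; case: eqVneq => // ->.
  by apply/eqP; apply: contraNT nas; rewrite eq_sym => /sf.
apply: eq_big => [f|f _]; last first.
  apply: gop_ext => v _; rewrite /upd inE; case: eqVneq => [->|nv] //=.
  by rewrite ffunE (negPf nv).
apply/andP/pfamilyP => [[/andP[/pfamilyP[/subsetP sf Pf] Pa] _]|[/subsetP sf Pf]].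
  split.
    apply/subsetP=> v fv; rewrite inE; case: eqVneq => //= nv.
    by apply: sf; rewrite inE ffunE (negPf nv).
  move=> v; rewrite inE => /orP[/eqP ->//|sv].
  have := Pf v sv; rewrite ffunE ifN //; by apply: contraNneq nas => <-.
split; last first.
  by apply/eqP/ffunP=> v; rewrite !ffunE; case: eqVneq => [->|].
apply/andP; split; last by apply: Pf; rewrite inE eqxx.
apply/pfamilyP; split.
  apply/subsetP=> v; rewrite inE ffunE; case: (eqVneq v a) => [_|nv fv]; rewrite ?eqxx //.
  by have := sf v fv; rewrite inE (negPf nv).
move=> v sv; rewrite ffunE ifN; last by apply: contraNneq nas => <-.
by apply: Pf; rewrite inE sv orbT.
Qed.

End EvenBasics.

Lemma good_contract (W W' : finType) (q : W -> W') (A : {set W}) H (ht : W' -> nat) :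
    good_graph A H ->
    (forall a b, (a, b) \in contract q H -> (ht b < ht a)%N) ->
  good_graph (q @: A) (contract q H).
Proof.
move=> /good_graphP[[a0 Aa0] sH cH _] htH; apply/good_graphP; split.
- by exists (q a0); apply: imset_f.
- by move=> a b /contractP[_ [u [v [/sH[Au Av] <- <-]]]]; rewrite !imset_f.
- move=> c Ec _ _ /imsetP[a Aa ->] /imsetP[b Ab ->].
  apply: (cH (fun w => c (q w))) => // u v Huv.
  case: (eqVneq (q u) (q v)) => [-> //|/eqP ne].
  by apply: Ec; apply/contractP; split=> //; exists u, v.
- by exists ht.
Qed.

Lemma good_loopless (W : finType) (A : {set W}) H a :
  good_graph A H -> ((a, a) \in H) = false.
Proof.
case/good_graphP=> _ _ _ [ht htH]; apply/negP=> /htH; by rewrite ltnn.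
Qed.

Lemma contract_comp (W W' : finType) (q : W -> W) (p : W -> W') H :
  (forall w, p (q w) = p w) -> contract p (contract q H) = contract p H.
Proof.
move=> pq; apply/setP=> -[a b]; apply/contractP/contractP.
  case=> ne [_ [_ [/contractP[_ [u [v [Huv <- <-]]]] Ea Eb]]].
  by split=> //; exists u, v; rewrite -[p u]pq -[p v]pq.
case=> ne [u [v [Huv Ea Eb]]]; split=> //; exists (q u), (q v); rewrite !pq.
split=> //; apply/contractP; split; last by exists u, v.
by move=> quv; apply: ne; rewrite -Ea -Eb -[p u]pq quv pq.
Qed.

Lemma contract_idem (W : finType) (p : W -> W) (V : {set W}) G :
  (forall v, v \in V -> p v = v) -> good_graph V G -> contract p G = G.
Proof.
move=> pV gG; have /good_graphP[_ sG _ _] := gG.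
apply/setP=> -[a b]; apply/contractP/idP.
  case=> _ [u [v [/[dup] Guv /sG[Vu Vv] <- <-]]]; by rewrite !pV.
move=> /[dup] Gab /sG[Va Vb]; split; last by exists a, b; rewrite !pV.
by move=> ab; rewrite ab (good_loopless _ gG) in Gab.
Qed.

Section Substitution.
Variables (k : fieldType) (h : evenLieGraph k).

Section Idempotent.
Variables (W : finType) (p : W -> W) (V : {set W}) (G : {set W * W}).
Variable (Es : W -> {set W * W}).
Hypothesis pV : forall v, v \in V -> p v = v.
Let fib v := [set w | p w == v].
Let part s := V :|: [set w | p w \in (s : seq W)].
Hypothesis gG : good_graph V G.
Hypothesis gE : forall v, v \in V -> good_graph (fib v) (Es v).

Lemma shrinkP u w : u \in V -> p (shrink (fib u) u w) = p w.
Proof. by move=> Vu; rewrite /shrink inE; case: eqP => // ->; rewrite pV. Qed.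

Lemma restrict_shrink u v (H : {set W * W}) : u \in V -> v != u -> (forall a, (a, a) \notin H) ->
  restrict (fib v) (contract (shrink (fib u) u) H) = restrict (fib v) H.
Proof.
move=> Vu nvu irr.
have shE w a : p a = v -> shrink (fib u) u w = a -> w = a.
  rewrite /shrink inE; case: eqP => // _ pa ua; case/eqP: nvu.
  by rewrite -pa -ua pV.
apply/setP=> -[a b]; rewrite !restrictE !inE -/(shrink _ _); apply/and3P/and3P.
  case=> /andP[/imsetP[[u1 v1] H1 [/esym Ea /esym Eb]] _] /[dup] Pa /eqP pa /[dup] Pb /eqP pb.
  by split=> //; rewrite -(shE _ _ pa Ea) -(shE _ _ pb Eb).
case=> Hab /[dup] Pa /eqP pa /[dup] Pb /eqP pb; split=> //; apply/andP; split.
  have sE c : p c = v -> shrink (fib u) u c = c.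
    by move=> pc; rewrite /shrink inE pc (negPf nvu).
  by apply/imsetP; exists (a, b) => //=; rewrite !sE.
by apply/eqP=> /= ab; have := irr b; rewrite -{1}ab Hab.
Qed.

Lemma gop_subst_seq (s : seq W) (x : W -> h) :
    (forall w, ev_fil 1 (x w)) -> uniq s -> {subset s <= V} ->
  gop V G (fun v => if v \in s then gop (fib v) (Es v) x else x v)
  = \sum_(H | all (fun v => restrict (fib v) H == Es v) s && (contract p H == G))
      gop (part s) H x.
Proof.
elim: s x => [|u s IH] x x1 /=.
  move=> _ _; rewrite (@gop_ext _ _ _ _ _ _ x) //.
  have -> : part [::] = V by apply/setP=> w; rewrite !inE orbF.
  rewrite (bigD1 G) /= ?(contract_idem pV gG) ?eqxx // big1 ?addr0 //.
  move=> H /andP[/eqP HG nHG]; apply: gop_bad; apply: contra nHG => gH.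
  by rewrite -HG (contract_idem pV gH).
case/andP=> nus us sV; have Vu : u \in V by apply: sV; rewrite mem_head.
have sV' : {subset s <= V} by move=> v sv; apply: sV; rewrite inE sv orbT.
pose x' := upd x u (gop (fib u) (Es u) x).
have x'1 w : ev_fil 1 (x' w) by rewrite /x' /upd; case: ifP => _; [apply: gop_fil1|].
transitivity (gop V G (fun v => if v \in s then gop (fib v) (Es v) x' else x' v)).
  apply: gop_ext => v Vv; rewrite inE.
  case: (eqVneq v u) => [->|nvu] /=.
    by rewrite (negPf nus) /x' /upd eqxx.
  case: ifP => sv; last by rewrite /x' /upd (negPf nvu).
  apply: gop_ext => w; rewrite inE => /eqP pw; rewrite /x' /upd.
  case: eqVneq => // wu; move: pw nvu; rewrite wu pV // => ->.
  by rewrite eqxx.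
rewrite IH //.
have part_fib : part s :&: fib u = [set u].
  apply/setP=> w; rewrite !inE; apply/idP/eqP => [|->]; last by rewrite Vu pV // eqxx.
  case/andP=> /orP[/pV -> /eqP //|pws /eqP pwu].
  by rewrite pwu (negPf nus) in pws.
have part_cons : part s :|: fib u = part (u :: s).
  by apply/setP=> w; rewrite !inE -orbA; congr (_ || _); rewrite orbC.
rewrite (bigID (good_graph (part s))) /= [X in _ + X]big1 ?addr0; last first.
  by move=> H /andP[_ bH]; apply: gop_bad.
rewrite (eq_bigr (fun H => \sum_(H' | (restrict (fib u) H' == Es u) &&
    (contract (shrink (fib u) u) H' == H)) gop (part (u :: s)) H' x)); last first.
  by move=> H /andP[_ gH]; rewrite -part_cons -(gop_insert _ part_fib) ?gE.
rewrite (exchange_big_dep (fun H' => restrict (fib u) H' == Es u)) /=; last first.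
  by move=> H H' _ /andP[].
rewrite [LHS](bigID (good_graph (part (u :: s)))) /= [X in _ + X]big1 ?addr0; last first.
  by move=> H' /andP[_ bH']; rewrite big1 // => H _; apply: gop_bad.
rewrite [RHS](bigID (good_graph (part (u :: s)))) /= [X in _ = _ + X]big1 ?addr0; last first.
  by move=> H' /andP[_ bH']; rewrite gop_bad.
rewrite big_mkcond [RHS]big_mkcond; apply: eq_bigr => H' _.
case gH': (good_graph _ H'); rewrite ?andbF // !andbT.
case: ifP => //= /eqP resu.
have irr a : (a, a) \notin H' by rewrite (good_loopless _ gH').
pose H := contract (shrink (fib u) u) H'.
have contE : contract p H = contract p H'.
  by apply: contract_comp => w; apply: shrinkP.
have allE : all (fun v => restrict (fib v) H == Es v) s
            = all (fun v => restrict (fib v) H' == Es v) s.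
  apply: eq_in_all => v sv; rewrite restrict_shrink //.
  by apply: contraNneq nus => <-.
rewrite resu eqxx -allE -contE.
case C: (all _ s && _); last first.
  rewrite big_pred0 // => H0; rewrite [H == H0]eq_sym.
  by case: (eqVneq H0 H) => [->|_]; rewrite ?C ?andbF.
have gH : good_graph (part s) H.
  have -> : part s = shrink (fib u) u @: part (u :: s).
    apply/setP=> w; apply/idP/imsetP => [pw|[w' pw' ->]].
      exists w; first by rewrite -part_cons inE pw.
      rewrite /shrink; case: ifP => // fw; apply/eqP.
      by rewrite -in_set1 -part_fib inE pw.
    move: pw'; rewrite -part_cons inE /shrink; case: ifP => // [_ _|_].
      by rewrite inE Vu.
    by rewrite orbF.
  have /good_graphP[_ _ _ [hG hGE]] := gG.
  have /good_graphP[_ _ _ [hH hHE]] := gH'.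
  pose K := (\sum_w hH w).+1.
  have ltK w : (hH w < K)%N by rewrite ltnS (bigD1 w) //= leq_addr.
  apply: (@good_contract _ _ _ _ _ (fun w => (hG (p w) * K + hH w)%N) gH').
  move=> a b Hab; case: (eqVneq (p a) (p b)) => [pab|npab].
    rewrite pab ltn_add2l; apply: hHE.
    have npa : p b != u.
      apply/eqP=> pbu; case/contractP: Hab => ne [u1 [v1 [H1 Eu Ev]]]; apply: ne.
      rewrite -Eu -Ev /shrink !inE -[p u1](shrinkP _ Vu) -[p v1](shrinkP _ Vu) Eu Ev.
      by rewrite pab pbu eqxx.
    have : (a, b) \in restrict (fib (p b)) H by rewrite restrictE Hab !inE pab eqxx.
    by rewrite restrict_shrink // restrictE => /and3P[].
  have : (p a, p b) \in G.
    case/andP: C => _ /eqP <-.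
    by apply/contractP; split; [apply/eqP | exists a, b].
  move/hGE => lt; apply: (@leq_trans ((hG (p b)).+1 * K)%N).
    by rewrite mulSn addnC ltn_add2r ltK.
  by apply: leq_trans (leq_addr _ _); rewrite leq_mul2r lt orbT.
rewrite (big_pred1 H) // => H0; rewrite [H == H0]eq_sym.
by case: (eqVneq H0 H) => [->|]; rewrite /= ?C ?gH ?eqxx ?andbF // => /negPf->.
Qed.

End Idempotent.

(** Total substitution: all the vertices of [G] are replaced at once, [p] being
    the map from the new vertices to the vertices that they replace. *)
Lemma gop_subst (W V : finType) (p : W -> V) (G : {set V * V})
    (Es : V -> {set W * W}) (x : W -> h) :
    (forall w, ev_fil 1 (x w)) -> good_graph setT G ->
    (forall v, good_graph [set w | p w == v] (Es v)) ->
  gop setT G (fun v => gop [set w | p w == v] (Es v) x)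
  = \sum_(H | [forall v, restrict [set w | p w == v] H == Es v]
               && (contract p H == G)) gop setT H x.
Proof.
move=> x1 gG gE.
have sP v : exists w, p w == v.
  by have /good_graphP[[w]] := gE v; rewrite inE => pw; exists w.
pose s v := xchoose (sP v); have psK v : p (s v) = v by apply/eqP/(xchooseP (sP v)).
have inj_s : injective s by apply: can_inj psK.
pose V' := s @: setT; pose q w := s (p w).
have qV v : v \in V' -> q v = v by case/imsetP=> u _ ->; rewrite /q psK.
have fibE v : [set w | q w == s v] = [set w | p w == v].
  by apply/setP=> w; rewrite !inE (inj_eq inj_s).
have gG' : good_graph V' (pushforward s G).
  rewrite -good_pullback ?pullback_push // pushforward_sub //.
  by apply/subsetP=> e; rewrite !inE.
have gE' v : v \in V' -> good_graph [set w | q w == v] (Es (p v)).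
  by case/imsetP=> u _ ->; rewrite fibE psK.
pose y w := gop [set w' | q w' == w] (Es (p w)) x.
have -> : gop setT G (fun v => gop [set w | p w == v] (Es v) x)
          = gop V' (pushforward s G) y.
  rewrite gop_inj // => [|w]; last exact: gop_fil1.
  by apply: gop_ext => v _; rewrite /= /y fibE psK.
have -> : gop V' (pushforward s G) y = gop V' (pushforward s G)
    (fun v => if v \in enum V' then gop [set w | q w == v] (Es (p v)) x else x v).
  by apply: gop_ext => w Vw; rewrite mem_enum Vw.
rewrite (gop_subst_seq qV gG' gE') ?enum_uniq //; last by move=> v; rewrite mem_enum.
have -> : V' :|: [set w | q w \in enum V'] = setT.
  have Vq w : q w \in V' by apply: imset_f.
  by apply/setP=> w; rewrite in_setU [in X in _ || X]inE mem_enum Vq orbT inE.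
apply: eq_bigl => H; congr (_ && _).
  apply/allP/forallP => Hv v.
    by have := Hv (s v); rewrite fibE psK mem_enum; apply; apply: imset_f.
  by rewrite mem_enum => /imsetP[u _ ->]; rewrite fibE psK.
rewrite -(inj_eq (pushforward_inj inj_s)) -(@contract_push W W V W id s p q H) //.
congr (contract q _ == _); apply/setP=> -[a b]; apply/idP/imsetP => [Hab|].
  by exists (a, b).
by case=> -[u v] ? [-> ->].
Qed.

End Substitution.

(** * Characters of coloured directed graphs *)

Record character (k : fieldType) (C : finType) := Character {
  chi :> forall W : finType, (W -> C) -> {set W * W} -> {set W} -> k;
  chi_ext : forall (W : finType) (col col' : W -> C) (E E' : {set W * W}) (A : {set W}),
    {in A, col =1 col'} -> {in A &, forall a b, ((a, b) \in E) = ((a, b) \in E')} ->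
    chi col E A = chi col' E' A;
  chi_inj : forall (W W' : finType) (f : W' -> W) (col : W -> C) (E : {set W * W}) (A : {set W'}),
    injective f -> chi col E (f @: A) = chi (fun w => col (f w)) (pullback f E) A;
  chi_0 : forall (W : finType) (col : W -> C) E, chi col E set0 = 1;
  chi_U : forall (W : finType) (col : W -> C) (E : {set W * W}) (A B : {set W}),
    [disjoint A & B] ->
    (forall a b, a \in A -> b \in B -> ((a, b) \notin E) && ((b, a) \notin E)) ->
    chi col E (A :|: B) = chi col E A * chi col E B }.

Section Characters.
Variables (k : fieldType) (C : finType).
Hypothesis chark : [pchar k] =i pred0.

Lemma natf_neq0 n : (0 < n)%N -> n%:R != 0 :> k.
Proof. by move=> n0; rewrite (pcharf0P k).1 // -lt0n. Qed.

Lemma fact_neq0 n : n`!%:R != 0 :> k.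
Proof. exact/natf_neq0/fact_gt0. Qed.

Lemma imset_setD (W W' : finType) (f : W -> W') (A B : {set W}) :
  injective f -> f @: (A :\: B) = f @: A :\: f @: B.
Proof.
move=> inj_f; apply/setP=> w; rewrite inE; apply/imsetP/andP.
  by case=> a /setDP[Aa nBa] ->; rewrite !mem_imset ?nBa.
case=> nB /imsetP[a Aa Ew]; exists a => //; rewrite inE Aa andbT.
by apply: contra nB => Ba; rewrite Ew imset_f.
Qed.

Section Letter.
Variable c : C.

Definition letter_fun (W : finType) (col : W -> C) (E : {set W * W}) (A : {set W}) : k :=
  ([forall a in A, col a == c] && [forall a in A, forall b in A, (a, b) \notin E])%:R.

Lemma letterP (W : finType) (col : W -> C) (E : {set W * W}) (A : {set W}) :
  reflect ((forall a, a \in A -> col a = c) /\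
           (forall a b, a \in A -> b \in A -> (a, b) \notin E))
    ([forall a in A, col a == c] && [forall a in A, forall b in A, (a, b) \notin E]).
Proof.
apply: (iffP andP) => -[H1 H2]; split.
- by move=> a Aa; apply/eqP/(forall_inP H1).
- by move=> a b Aa; apply: (forall_inP (forall_inP H2 a Aa)).
- by apply/forall_inP=> a Aa; apply/eqP/H1.
- by apply/forall_inP=> a Aa; apply/forall_inP=> b; apply: H2.
Qed.

Fact letter_ext (W : finType) (col col' : W -> C) (E E' : {set W * W}) (A : {set W}) :
  {in A, col =1 col'} -> {in A &, forall a b, ((a, b) \in E) = ((a, b) \in E')} ->
  letter_fun col E A = letter_fun col' E' A.
Proof.
move=> Ec EE; congr (_%:R); congr nat_of_bool.
apply/letterP/letterP => -[H1 H2]; split=> [a Aa|a b Aa Ab].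
- by rewrite -Ec ?H1.
- by rewrite -EE ?H2.
- by rewrite Ec ?H1.
- by rewrite EE ?H2.
Qed.

Fact letter_inj (W W' : finType) (f : W' -> W) (col : W -> C) (E : {set W * W}) (A : {set W'}) :
  injective f ->
  letter_fun col E (f @: A) = letter_fun (fun w => col (f w)) (pullback f E) A.
Proof.
move=> inj_f; congr (_%:R); congr nat_of_bool; apply/letterP/letterP => -[H1 H2].
  split=> [a Aa|a b Aa Ab]; first by rewrite H1 ?imset_f.
  by rewrite pullbackE H2 ?imset_f.
split=> [_ /imsetP[a Aa ->]|_ _ /imsetP[a Aa ->] /imsetP[b Ab ->]]; first exact: H1.
by rewrite -pullbackE H2.
Qed.

Fact letter_0 (W : finType) (col : W -> C) (E : {set W * W}) : letter_fun col E set0 = 1.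
Proof.
rewrite /letter_fun (introT (letterP _ _ _)) //; split=> a; by rewrite inE.
Qed.

Fact letter_U (W : finType) (col : W -> C) (E : {set W * W}) (A B : {set W}) :
  [disjoint A & B] ->
  (forall a b, a \in A -> b \in B -> ((a, b) \notin E) && ((b, a) \notin E)) ->
  letter_fun col E (A :|: B) = letter_fun col E A * letter_fun col E B.
Proof.
move=> dAB nE; rewrite /letter_fun -natrM mulnb; congr (_%:R); congr nat_of_bool.
apply/letterP/andP => [[H1 H2]|[/letterP[A1 A2] /letterP[B1 B2]]].
  by split; apply/letterP; split=> [a Aa|a b Aa Ab]; rewrite ?H1 ?H2 // inE ?Aa ?Ab ?orbT.
split=> [a|a b]; rewrite !inE; first by case/orP; [apply: A1 | apply: B1].
case/orP=> Ha /orP[] Hb; [exact: A2 | | | exact: B2].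
  by have /andP[] := nE _ _ Ha Hb.
by have /andP[] := nE _ _ Hb Ha.
Qed.

Definition letter : character k C :=
  Character letter_ext letter_inj letter_0 letter_U.

End Letter.

Section Unit.

Definition unit_fun (W : finType) (col : W -> C) (E : {set W * W}) (A : {set W}) : k :=
  (A == set0)%:R.

Fact unit_ext (W : finType) (col col' : W -> C) (E E' : {set W * W}) (A : {set W}) :
  {in A, col =1 col'} -> {in A &, forall a b, ((a, b) \in E) = ((a, b) \in E')} ->
  unit_fun col E A = unit_fun col' E' A.
Proof. by []. Qed.

Fact unit_inj (W W' : finType) (f : W' -> W) (col : W -> C) (E : {set W * W}) (A : {set W'}) :
  injective f -> unit_fun col E (f @: A) = unit_fun (fun w => col (f w)) (pullback f E) A.
Proof. by move=> inj_f; rewrite /unit_fun imset_eq0. Qed.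

Fact unit_0 (W : finType) (col : W -> C) (E : {set W * W}) : unit_fun col E set0 = 1.
Proof. by rewrite /unit_fun eqxx. Qed.

Fact unit_U (W : finType) (col : W -> C) (E : {set W * W}) (A B : {set W}) :
  [disjoint A & B] ->
  (forall a b, a \in A -> b \in B -> ((a, b) \notin E) && ((b, a) \notin E)) ->
  unit_fun col E (A :|: B) = unit_fun col E A * unit_fun col E B.
Proof. by move=> _ _; rewrite /unit_fun -natrM mulnb setU_eq0. Qed.

Definition unit_char : character k C := Character unit_ext unit_inj unit_0 unit_U.

End Unit.

Section Convolution.
Variables (X Y : character k C).

(** The subsets [B] of [A] with no edge of [A] going down from [B] to its
    complement: [B] may be put below the rest of [A]. *)
Definition lower (W : finType) (E : {set W * W}) (A B : {set W}) : bool :=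
  (B \subset A) && [forall a in B, forall b in A :\: B, (a, b) \notin E].

Lemma lowerP (W : finType) (E : {set W * W}) (A B : {set W}) :
  reflect (B \subset A /\ forall a b, a \in B -> b \in A -> b \notin B -> (a, b) \notin E)
          (lower E A B).
Proof.
apply: (iffP andP) => -[sBA H]; split=> //.
  by move=> a b Ba Ab nBb; apply: (forall_inP (forall_inP H a Ba)); rewrite inE nBb.
by apply/forall_inP=> a Ba; apply/forall_inP=> b /setDP[Ab nBb]; apply: H.
Qed.

Definition conv_fun (W : finType) (col : W -> C) (E : {set W * W}) (A : {set W}) : k :=
  \sum_(B | lower E A B) X W col E B * Y W col E (A :\: B).

Fact conv_ext (W : finType) (col col' : W -> C) (E E' : {set W * W}) (A : {set W}) :
  {in A, col =1 col'} -> {in A &, forall a b, ((a, b) \in E) = ((a, b) \in E')} ->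
  conv_fun col E A = conv_fun col' E' A.
Proof.
move=> Ec EE; apply: eq_big => B.
  apply/lowerP/lowerP => -[sBA H]; split=> // a b Ba Ab nB.
    by rewrite -EE ?H // (subsetP sBA).
  by rewrite EE ?H // (subsetP sBA).
case/lowerP=> /subsetP sBA _; congr (_ * _).
  apply: chi_ext => [a Ba|a b Ba Bb]; first exact/Ec/sBA.
  by apply: EE; apply: sBA.
apply: chi_ext => [a /setDP[Aa _]|a b /setDP[Aa _] /setDP[Ab _]]; first exact: Ec.
exact: EE.
Qed.

Fact conv_inj (W W' : finType) (f : W' -> W) (col : W -> C) (E : {set W * W}) (A : {set W'}) :
  injective f ->
  conv_fun col E (f @: A) = conv_fun (fun w => col (f w)) (pullback f E) A.
Proof.
move=> inj_f; rewrite /conv_fun.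
rewrite (reindex_onto (fun B : {set W'} => f @: B) (fun B => f @^-1: B)) /=; last first.
  move=> B /lowerP[/subsetP sB _]; apply/setP=> w; apply/imsetP/idP.
    by case=> a; rewrite inE => Ba ->.
  by move=> /[dup] Bw /sB /imsetP[a Aa Ew]; exists a; rewrite // inE -Ew.
apply: eq_big => [B|B _]; last by rewrite -imset_setD // !chi_inj.
have -> : f @^-1: (f @: B) == B by apply/eqP/setP=> a; rewrite inE mem_imset.
rewrite andbT; apply/lowerP/lowerP => -[sBA H]; split.
- by apply/subsetP=> a Ba; rewrite -(mem_imset _ _ inj_f) (subsetP sBA) ?imset_f.
- by move=> a b Ba Ab nB; rewrite pullbackE H ?mem_imset.
- exact: imsetS.
- move=> _ _ /imsetP[a Ba ->] /imsetP[b Ab ->]; rewrite mem_imset // => nB.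
  by rewrite -pullbackE H.
Qed.

Fact conv_0 (W : finType) (col : W -> C) (E : {set W * W}) : conv_fun col E set0 = 1.
Proof.
rewrite /conv_fun (big_pred1 set0) ?setDv ?chi_0 ?mulr1 // => B.
apply/lowerP/eqP => [[]|->]; first by rewrite subset0 => /eqP.
by split=> // a b; rewrite inE.
Qed.

Fact conv_U (W : finType) (col : W -> C) (E : {set W * W}) (A1 A2 : {set W}) :
  [disjoint A1 & A2] ->
  (forall a b, a \in A1 -> b \in A2 -> ((a, b) \notin E) && ((b, a) \notin E)) ->
  conv_fun col E (A1 :|: A2) = conv_fun col E A1 * conv_fun col E A2.
Proof.
move=> dA nE; rewrite /conv_fun big_distrlr /=.
have nA w : w \in A1 -> w \in A2 -> False.
  by move=> A1w; rewrite (disjointFr dA A1w).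
rewrite pair_big /=.
rewrite (reindex_onto (fun B : {set W} * {set W} => B.1 :|: B.2)
           (fun B => (B :&: A1, B :&: A2))) /=; last first.
  by move=> B /lowerP[sB _]; rewrite -setIUr; apply/setIidPl.
have capE (B1 B2 D1 D2 : {set W}) : B1 \subset D1 -> [disjoint D1 & D2] -> B2 \subset D2 ->
    (B1 :|: B2) :&: D1 = B1.
  move=> /subsetP s1 dD /subsetP s2; apply/setP=> w; rewrite !inE.
  apply/andP/idP => [[/orP[//|/s2 D2w] D1w]|B1w]; last by rewrite B1w s1.
  by rewrite (disjointFr dD D1w) in D2w.
apply: eq_big => [[B1 B2] /=|[B1 B2] /= /andP[/lowerP[sB _] /eqP[E1 E2]]].
  apply/andP/andP => [[/lowerP[sB H] /eqP[E1 E2]]|[/lowerP[s1 H1] /lowerP[s2 H2]]].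
    have s1 : B1 \subset A1 by rewrite -E1 subsetIr.
    have s2 : B2 \subset A2 by rewrite -E2 subsetIr.
    split; apply/lowerP; split=> // a b Ba Ab nB; apply: H; rewrite ?inE ?Ba ?Ab ?orbT //.
      by rewrite negb_or nB; apply/negP=> /(subsetP s2) /(nA _ Ab).
    by rewrite negb_or nB andbT; apply/negP=> /(subsetP s1) /nA; apply.
  have dA' : [disjoint A2 & A1] by rewrite disjoint_sym.
  split; last by rewrite (capE _ _ _ A2) // [B1 :|: _]setUC (capE _ _ _ A1).
  apply/lowerP; split; first exact: setUSS.
  move=> a b; rewrite !inE negb_or => Ba Ab /andP[n1 n2].
  case/orP: Ba => Ba; case/orP: Ab => Ab.
  - exact: H1.
  - by have /andP[] := nE _ _ (subsetP s1 _ Ba) Ab.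
  - by have /andP[] := nE _ _ Ab (subsetP s2 _ Ba).
  - exact: H2.
have s1 : B1 \subset A1 by rewrite -E1 subsetIr.
have s2 : B2 \subset A2 by rewrite -E2 subsetIr.
have -> : (A1 :|: A2) :\: (B1 :|: B2) = (A1 :\: B1) :|: (A2 :\: B2).
  apply/setP=> w; rewrite !inE negb_or.
  case A1w: (w \in A1) => /=.
    have nA2 : w \in A2 = false by apply/negP=> /(nA _ A1w).
    have nB2 : w \in B2 = false by apply/negP=> /(subsetP s2); rewrite nA2.
    by rewrite nA2 nB2 !andbT orbF.
  have nB1 : w \in B1 = false by apply/negP=> /(subsetP s1); rewrite A1w.
  by rewrite nB1 /=.
rewrite (@chi_U _ _ X) ?(@chi_U _ _ Y); first by rewrite mulrACA.
- by apply: disjointWl (disjointWr _ dA); exact: subsetDl.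
- by move=> a b /setDP[Aa _] /setDP[Ab _]; apply: nE.
- exact: disjointWl s1 (disjointWr s2 dA).
- by move=> a b /(subsetP s1) Aa /(subsetP s2); apply: nE.
Qed.

Definition conv : character k C := Character conv_ext conv_inj conv_0 conv_U.

End Convolution.

End Characters.

Section Quotients.
Variables (k : fieldType) (C : finType) (W : finType) (col : W -> C).
Variable (E : {set W * W}).
Hypothesis chark : [pchar k] =i pred0.

Lemma chi_fibers (X : character k C) (V : finType) (p : W -> V) (Q : {set V}) :
    {in Q &, forall v v', v != v' -> forall a b, p a = v -> p b = v' -> (a, b) \notin E} ->
  \prod_(v in Q) X W col E [set w | p w == v] = X W col E [set w | p w \in Q].
Proof.
move=> nE.
suff H s : uniq s -> {subset s <= Q} ->
    \prod_(v <- s) X W col E [set w | p w == v] = X W col E [set w | p w \in s].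
  rewrite -big_enum /= H ?enum_uniq //; last by move=> v; rewrite mem_enum.
  by congr (chi X col E _); apply/setP=> w; rewrite !inE mem_enum.
elim: s => [|v s IH] /=.
  move=> _ _; rewrite big_nil -(chi_0 X col E); congr (chi X col E _).
case/andP=> nvs us sQ; have sQ' : {subset s <= Q}.
  by move=> u su; apply: sQ; rewrite inE su orbT.
have Qv : v \in Q by apply: sQ; rewrite mem_head.
rewrite big_cons IH // -chi_U.
- by congr (chi X col E _); apply/setP=> w; rewrite !inE.
- rewrite -setI_eq0; apply/eqP/setP=> w; rewrite !inE; apply/negP=> /andP[/eqP ->].
  by rewrite (negPf nvs).
- move=> a b; rewrite !inE => /eqP pa pb.
  have npb : v != p b by apply: contraNneq nvs => ->.
  apply/andP; split; first exact: (nE v (p b) Qv (sQ' _ pb) npb a b pa erefl).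
  by rewrite eq_sym in npb; apply: (nE (p b) v (sQ' _ pb) Qv npb b a erefl pa).
Qed.

(** Surjections onto ['I_m] with a prescribed kernel: there are none, except
    for one value of [m], for which any two of them differ by a permutation. *)
Lemma card_quotient_maps (e : rel W) (N : nat) :
    equivalence_rel e -> (#|W| < N)%N ->
  \sum_(m < N) (m`!%:R)^-1 *
    #|[set p : {ffun W -> 'I_m} | [forall v, exists w, p w == v]
         && [forall u, forall w, (p u == p w) == e u w]]|%:R = 1 :> k.
Proof.
move=> eqe ltN.
pose isq m (p : W -> 'I_m) := (forall v, exists w, p w = v) /\
                                     (forall u w, (p u == p w) = e u w).
have isqP m (p : {ffun W -> 'I_m}) : reflect (isq m p) ([forall v, exists w, p w == v]
         && [forall u, forall w, (p u == p w) == e u w]).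
  apply: (iffP andP) => -[H1 H2]; split.
  - by move=> v; have /existsP[w /eqP <-] := forallP H1 v; exists w.
  - by move=> u w; have /forallP/(_ w)/eqP := forallP H2 u.
  - by apply/forallP=> v; have [w <-] := H1 v; apply/existsP; exists w.
  - by apply/forallP=> u; apply/forallP=> w; apply/eqP.
have isq_le m m' (p : W -> 'I_m) (p' : W -> 'I_m') : isq m p -> isq m' p' -> (m <= m')%N.
  case=> sp kp [sp' kp'].
  have sP v : exists w, p w == v by have [w <-] := sp v; exists w.
  have inj_t : injective (fun v => p' (xchoose (sP v))).
    move=> u v /eqP; rewrite kp' -kp (eqP (xchooseP (sP u))) (eqP (xchooseP (sP v))).
    by move/eqP.
  by have := leq_card _ inj_t; rewrite !card_ord.
have e_refl u : e u u by have [] := eqe u u u.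
have e_trans u v w : e u v -> e v w = e u w.
  by move=> euv; have [_ ->] := eqe u v w.
have e_sym u v : e u v = e v u.
  by apply/idP/idP => euv; [rewrite (e_trans _ _ _ euv) | rewrite (e_trans _ _ _ euv)].
pose P := equivalence_partition e [set: W].
have partP : partition P [set: W] by apply: equivalence_partitionP => x y z _ _ _.
pose M := #|P|.
have leM : (M <= #|W|)%N.
  rewrite -cardsT (card_partition partP) -[M]sum1_card; apply: leq_sum => B PB.
  by rewrite card_gt0; case/and3P: partP => _ _; apply: contraNneq => <-.
have [p0 qp0] : exists p0 : W -> 'I_M, isq M p0.
  have Pb w : pblock P w \in P by apply: pblock_mem; rewrite (cover_partition partP) inE.
  exists (fun w => enum_rank_in (Pb w) (pblock P w)); split.
    move=> v; have vP := enum_valP v.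
    have /set0Pn[w vw] : enum_val v != set0.
      by case/and3P: partP => _ _; apply: contraNneq => <-.
    exists w; apply: enum_val_inj; rewrite enum_rankK_in //.
    by apply: def_pblock vw; [case/and3P: partP | ].
  move=> u w; rewrite -(inj_eq enum_val_inj) !enum_rankK_in //.
  rewrite eq_pblock ?(cover_partition partP) ?inE //; last by case/and3P: partP.
  by rewrite pblock_equivalence_partition ?inE.
have ltM : (M < N)%N by apply: leq_ltn_trans ltN.
rewrite (bigD1 (Ordinal ltM)) //= [X in _ + X]big1 ?addr0; last first.
  move=> m nm; rewrite [#|_|]eq_card0 ?mulr0 // => p; rewrite inE.
  apply/negP=> /isqP qp; case/negP: nm; apply/eqP/val_inj/eqP => /=.
  by rewrite eqn_leq (isq_le _ _ _ _ qp qp0) (isq_le _ _ _ _ qp0 qp).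
have -> : #|[set p : {ffun W -> 'I_M} | [forall v, exists w, p w == v]
         && [forall u, forall w, (p u == p w) == e u w]]| = M`!; last first.
  by rewrite mulVf // fact_neq0.
rewrite -[in RHS](card_Sn M) -cardsT.
rewrite -(card_imset (f := fun s : 'S_M => [ffun w => s (p0 w)]) setT); last first.
  move=> s t /ffunP st; apply/permP=> v; have [w <-] := qp0.1 v.
  by have := st w; rewrite !ffunE.
apply: eq_card => p; rewrite inE; apply/isqP/imsetP => [qp|[s _ ->]]; last first.
  split=> [v|u w]; last by rewrite !ffunE (inj_eq perm_inj) qp0.2.
  by have [w pw] := qp0.1 (s^-1%g v); exists w; rewrite ffunE pw permKV.
have sP v : exists w, p0 w == v by have [w <-] := qp0.1 v; exists w.
pose t v := p (xchoose (sP v)).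
have tE w : t (p0 w) = p w.
  by apply/eqP; rewrite /t qp.2 -qp0.2; apply: (xchooseP (sP (p0 w))).
have inj_t : injective t.
  move=> u v; have [a <-] := qp0.1 u; have [b <-] := qp0.1 v.
  by rewrite !tE => /eqP; rewrite qp.2 -qp0.2 => /eqP.
exists (perm inj_t) => //; apply/ffunP=> w; by rewrite ffunE permE tE.
Qed.

Variables (X Y : character k C).
Let XY (b : bool) := if b then Y else X.

Definition level_compatible (V : finType) (lev : V -> bool) (G : {set V * V}) :=
  [forall e in G, lev e.1 && ~~ lev e.2].

Definition admissible m (p : W -> 'I_m) (lev : 'I_m -> bool) :=
  level_compatible lev (contract p E)
  && [forall v, good_graph [set w | p w == v] (restrict [set w | p w == v] E)].

Lemma level_compatibleP (V : finType) (lev : V -> bool) (G : {set V * V}) :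
  reflect (forall a b, (a, b) \in G -> lev a && ~~ lev b) (level_compatible lev G).
Proof.
by apply: (iffP forall_inP) => [H a b /H|H [a b] /H].
Qed.

Section Fixed.
Variable B : {set W}.
Let r u v := (((u, v) \in E) || ((v, u) \in E)) && ((u \in B) == (v \in B)).

Lemma side_sym u v : connect r u v = connect r v u.
Proof.
apply: sym_connect_sym => {}u {}v.
by rewrite /r orbC [(u \in B) == _]eq_sym.
Qed.

Lemma side_equiv : equivalence_rel (connect r).
Proof.
move=> u v w; split; first exact: connect0.
by move=> uv; apply: (same_connect side_sym uv).
Qed.

Hypothesis gE : good_graph setT E.

Lemma admissible_kernel m (p : W -> 'I_m) (lev : 'I_m -> bool) :
    B = [set w | ~~ lev (p w)] -> admissible p lev ->
  [/\ lower E setT B, forall v, exists w, p w = v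
    & forall u w, (p u == p w) = connect r u w].
Proof.
move=> BE /andP[/level_compatibleP cE /forallP fE].
have lev_edge u v : (u, v) \in E -> p u <> p v -> lev (p u) && ~~ lev (p v).
  by move=> Euv ne; apply: cE; apply/contractP; split=> //; exists u, v.
have rp u v : r u v -> p u = p v.
  case/andP=> Euv; rewrite BE !inE => /eqP/negb_inj Bl.
  apply/eqP/negPn/negP=> /eqP ne.
  by case/orP: Euv => [/lev_edge/(_ ne)|/lev_edge/(_ (nesym ne))];
     rewrite Bl; case: (lev _).
split.
- apply/lowerP; split; first exact: subsetT.
  move=> a b; rewrite BE !inE => na _ /negPn lb; apply/negP=> Eab.
  have /(lev_edge _ _ Eab)/andP[la _] : p a <> p b by move=> pab; rewrite pab lb in na.
  by rewrite la in na.
- by move=> v; have /good_graphP[[w]] := fE v; rewrite inE => /eqP pw; exists w.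
move=> u w; apply/eqP/idP => [puw|/connect_const]; last by apply.
have /good_graphP[_ _ cF _] := fE (p u).
rewrite -(cF (connect r u) _ u w) ?connect0 ?inE ?puw ?eqxx //.
move=> a b; rewrite restrictE !inE => /and3P[Eab /eqP pa /eqP pb].
have rab : connect r a b by apply: connect1; rewrite /r Eab BE !inE pa pb eqxx.
by apply/idP/idP => /connect_trans; apply; rewrite // side_sym.
Qed.

Lemma kernel_admissible m (p : {ffun W -> 'I_m}) :
    lower E setT B -> (forall v, exists w, p w = v) ->
    (forall u w, (p u == p w) = connect r u w) ->
  exists2 lev : {ffun 'I_m -> bool}, B = [set w | ~~ lev (p w)] & admissible p lev.
Proof.
move=> /lowerP[_ dB] sp kp.
have sP v : exists w, p w == v by have [w <-] := sp v; exists w.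
have rB u w : p u = p w -> (u \in B) = (w \in B).
  move/eqP; rewrite kp; apply: connect_const => a b; by case/andP=> _ /eqP.
pose lev := [ffun v => xchoose (sP v) \notin B].
have levE w : lev (p w) = (w \notin B).
  by rewrite ffunE (rB _ w) //; apply/eqP/(xchooseP (sP (p w))).
exists lev; first by apply/setP=> w; rewrite inE levE negbK.
apply/andP; split.
  apply/level_compatibleP=> a b /contractP[ne [u [v [Euv Eu Ev]]]].
  rewrite -Eu -Ev !levE negbK.
  have : ~~ r u v.
    apply/negP=> ruv; apply: ne; rewrite -Eu -Ev; apply/eqP; rewrite kp.
    exact: connect1.
  rewrite /r Euv /=; have := dB u v; rewrite inE Euv.
  by case: (u \in B); case: (v \in B) => // /(_ isT isT isT).
apply/forallP=> v; have /good_graphP[_ _ _ [ht htE]] := gE.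
apply/good_graphP; split.
- by have [w pw] := sp v; exists w; rewrite inE pw.
- by move=> a b; rewrite restrictE => /and3P[].
- move=> c Ec a b; rewrite !inE => /eqP pa /eqP pb.
  suff : (p a == v) && c a = (p b == v) && c b by rewrite pa pb eqxx.
  have rab : connect r a b by rewrite -kp pa pb.
  apply: (@connect_const _ r _ (fun z => (p z == v) && c z) _ a b rab) => x y rxy.
  have pxy : p x = p y by apply/eqP; rewrite kp connect1.
  rewrite -pxy; case: eqVneq => //= pxv.
  case/andP: rxy => /orP[] Exy _; last apply/esym; apply: Ec;
    by rewrite restrictE Exy !inE -?pxy pxv eqxx.
- by exists ht => a b; rewrite restrictE => /and3P[/htE].
Qed.

Lemma admissible_weight m (p : W -> 'I_m) (lev : 'I_m -> bool) :
    B = [set w | ~~ lev (p w)] -> admissible p lev ->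
  \prod_v XY (lev v) W col E [set w | p w == v]
  = X W col E B * Y W col E (~: B).
Proof.
move=> BE /andP[/level_compatibleP cE _].
have sameE v v' : lev v = lev v' -> v != v' ->
    forall a b, p a = v -> p b = v' -> (a, b) \notin E.
  move=> lvv' ne a b pa pb; apply/negP=> Eab.
  have : (v, v') \in contract p E by apply/contractP; split; [apply/eqP|exists a, b].
  by move/cE; rewrite lvv'; case: (lev v').
rewrite (bigID lev) /= mulrC; congr (_ * _).
  rewrite (eq_bigr (fun v => X W col E [set w | p w == v])); last first.
    by move=> v /negPf lv; rewrite /XY lv.
  rewrite (eq_bigl (fun v => v \in [set v | ~~ lev v])); last by move=> v; rewrite inE.
  rewrite chi_fibers; first by congr (chi X col E _); apply/setP=> w; rewrite BE !inE.
  move=> v v'; rewrite !inE => /negPf lv /negPf lv'; apply: sameE.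
  by rewrite lv lv'.
rewrite (eq_bigr (fun v => Y W col E [set w | p w == v])); last first.
  by move=> v lv; rewrite /XY lv.
rewrite (eq_bigl (fun v => v \in [set v | lev v])); last by move=> v; rewrite inE.
rewrite chi_fibers.
  by congr (chi Y col E _); apply/setP=> w; rewrite BE !inE negbK.
move=> v v'; rewrite !inE => lv lv'; apply: sameE.
by rewrite lv lv'.
Qed.

End Fixed.

(** Contracting onto the components of the lower and of the upper part is the
    only way to obtain a two-level graph with connected fibers; it is realised
    by [m!] maps to ['I_m]. *)
Lemma conv_quotients N : good_graph setT E -> (#|W| < N)%N ->
  \sum_(m < N) (m`!%:R)^-1 *
     (\sum_(p : {ffun W -> 'I_m}) \sum_(lev : {ffun 'I_m -> bool} | admissible p lev)
        \prod_v XY (lev v) W col E [set w | p w == v])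
  = conv X Y W col E setT.
Proof.
move=> gE ltN.
pose bot m (p : {ffun W -> 'I_m}) (lev : {ffun 'I_m -> bool}) := [set w | ~~ lev (p w)].
pose ker (B : {set W}) m := [set p : {ffun W -> 'I_m} | [forall v, exists w, p w == v]
   && [forall u, forall w, (p u == p w) ==
       connect (fun u v => (((u, v) \in E) || ((v, u) \in E))
                           && ((u \in B) == (v \in B))) u w]].
transitivity (\sum_(m < N) (m`!%:R)^-1 *
    \sum_(B | lower E setT B) #|ker B m|%:R * (X W col E B * Y W col E (~: B))); last first.
  under eq_bigr => m _ do rewrite mulr_sumr.
  rewrite exchange_big /=; apply: eq_bigr => B lB.
  rewrite setTD -[RHS]mul1r -[X in _ = X * _](card_quotient_maps (side_equiv B) ltN) mulr_suml.
  by apply: eq_bigr => m _; rewrite -[RHS]mulrA.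
apply: eq_bigr => m _; congr (_ * _).
rewrite pair_big_dep /=.
rewrite (partition_big (fun pl : {ffun W -> 'I_m} * {ffun 'I_m -> bool} => bot m pl.1 pl.2)
    (lower E setT)) /=; last first.
  by case=> p lev /= adm; have [] := admissible_kernel (erefl _) adm.
apply: eq_bigr => B lB.
rewrite (eq_bigr (fun=> X W col E B * Y W col E (~: B))); last first.
  case=> p lev /= /andP[adm /eqP BE].
  by rewrite -(admissible_weight (esym BE) adm).
rewrite sumr_const -[LHS]mulr_natl; congr (_%:R * _).
have kerP (p : {ffun W -> 'I_m}) : reflect ((forall v, exists w, p w = v) /\
    forall u w, (p u == p w) = connect (fun u v => (((u, v) \in E) || ((v, u) \in E))
                           && ((u \in B) == (v \in B))) u w) (p \in ker B m).
  rewrite inE; apply: (iffP andP) => -[H1 H2]; split.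
  - by move=> v; have /existsP[w /eqP <-] := forallP H1 v; exists w.
  - by move=> u w; have /forallP/(_ w)/eqP := forallP H2 u.
  - by apply/forallP=> v; have [w <-] := H1 v; apply/existsP; exists w.
  - by apply/forallP=> u; apply/forallP=> w; apply/eqP.
rewrite -[LHS](card_in_imset (f := fun pl : {ffun W -> 'I_m} * {ffun 'I_m -> bool} => pl.1)).
  apply: eq_card => p; apply/imsetP/kerP => [[[q lev] /andP[/= adm /eqP BE] ->]|[sp kp]].
    by have [_ ? ?] := admissible_kernel (esym BE) adm.
  have [lev BE adm] := kernel_admissible gE lB sp kp.
  by exists (p, lev) => //; rewrite unfold_in /= adm -[bot _ _ _]BE eqxx.
case=> p lev [q lev'] /andP[/= adm /eqP BE] /andP[/= adm' /eqP BE'] pq; subst q.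
congr (_, _); apply/ffunP=> v.
have [_ /(_ v)[w <-] _] := admissible_kernel (esym BE) adm.
by apply: negb_inj; move/setP/(_ w): (etrans BE (esym BE')); rewrite !inE.
Qed.

End Quotients.

(** * Graph sums weighted by a character *)

Section GraphSums.
Variables (k : fieldType) (h : evenLieGraph k).
Hypothesis chark : [pchar k] =i pred0.

Lemma card_fiber_sizes m n (s : 'I_m -> nat) :
  (#|[set p : {ffun 'I_n -> 'I_m} | [forall v, #|[set w | p w == v]| == s v]]|
     * \prod_v (s v)`!)%N
  = (if n == \sum_v s v then n`! else 0)%N.
Proof.
elim: n s => [|n IH] s.
  have s0 : (0 == \sum_v s v)%N = [forall v, s v == 0]%N.
    rewrite eq_sym sum_nat_eq0; apply/forall_inP/forallP => H v; first exact: H.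
    by move=> _; apply: H.
  have -> : #|[set p : {ffun 'I_0 -> 'I_m} | [forall v, #|[set w | p w == v]| == s v]]|
            = [forall v, s v == 0%N].
    have fib0 (p : {ffun 'I_0 -> 'I_m}) v : #|[set w | p w == v]| = 0%N.
      by apply: eq_card0 => -[].
    case: forallP => [s0'|ns0]; last first.
      rewrite eq_card0 // => p; rewrite inE; apply/forallP=> H; apply: ns0 => v.
      by rewrite eq_sym -(fib0 p v).
    rewrite (eq_card (B := predT)) ?card_ffun ?card_ord // => p; rewrite !inE.
    by apply/forallP=> v; rewrite fib0 eq_sym.
  rewrite s0; case: forallP => [s0'|] //.
  by rewrite big1 // => v _; rewrite (eqP (s0' v)).
have fibS (v0 : 'I_m) (p : {ffun 'I_n -> 'I_m}) v :
  #|[set w | [ffun w => oapp p v0 (unlift ord0 w)] w == v]|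
  = ((v0 == v) + #|[set w | p w == v]|)%N.
  rewrite (cardsD1 ord0) inE ffunE unlift_none /=; congr (_ + _)%N.
  rewrite -[RHS](card_imset _ (@lift_inj n.+1 ord0)); apply: eq_card => w.
  rewrite !inE ffunE; apply/andP/imsetP => [[nw]|[j + ->]].
    case: unliftP nw => [j ->|->]; last by rewrite eqxx.
    by move=> _ /= pj; exists j; rewrite ?inE.
  by rewrite inE liftK => pj; split=> //; rewrite eq_sym neq_lift.
pose cnt n s := #|[set p : {ffun 'I_n -> 'I_m} | [forall v, #|[set w | p w == v]| == s v]]|.
have -> : #|[set p : {ffun 'I_n.+1 -> 'I_m} | [forall v, #|[set w | p w == v]| == s v]]|
     = (\sum_(v0 | 0 < s v0) cnt n (fun v => s v - (v0 == v)))%N.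
  pose F (q : 'I_m * {ffun 'I_n -> 'I_m}) : {ffun 'I_n.+1 -> 'I_m} :=
    [ffun w => oapp q.2 q.1 (unlift ord0 w)].
  have injF : injective F.
    move=> [a p] [b q] /ffunP Fpq; congr (_, _).
      by have := Fpq ord0; rewrite !ffunE unlift_none.
    by apply/ffunP=> j; have := Fpq (lift ord0 j); rewrite !ffunE liftK.
  transitivity #|F @: [set q : 'I_m * {ffun 'I_n -> 'I_m} | [forall v, ((q.1 == v) + #|[set w | q.2 w == v]| == s v)%N]]|.
    apply: eq_card => p; rewrite inE; apply/forallP/imsetP => [H|[q + ->] v]; last first.
      by rewrite inE => /forallP/(_ v); rewrite -fibS.
    have Fp : F (p ord0, [ffun j => p (lift ord0 j)]) = p.
      by apply/ffunP=> w; rewrite ffunE; case: unliftP => [j ->|->] //=; rewrite ffunE.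
    exists (p ord0, [ffun j => p (lift ord0 j)]); last by rewrite Fp.
    rewrite inE; apply/forallP=> v; rewrite -fibS -/(F (_, _)) Fp; exact: H.
  rewrite card_imset // -sum1_card big_mkcond /=.
  set D := [set q | _].
  transitivity (\sum_v0 \sum_p if (v0, p) \in D then 1 else 0)%N.
    by rewrite pair_bigA; apply: eq_bigr => -[].
  rewrite [RHS]big_mkcond.
  apply: eq_bigr => v0 _; rewrite -big_mkcond sum1_card.
  case: ifPn => [s0|]; last first.
    rewrite -eqn0Ngt => /eqP s0; rewrite eq_card0 // => p.
    rewrite -[LHS]/((v0, p) \in D) inE; apply/forallP=> /(_ v0); by rewrite eqxx s0.
  apply: eq_card => p; rewrite -[LHS]/((v0, p) \in D) !inE; apply: eq_forallb => v /=.
  case: (eqVneq v0 v) => [<-|_] /=; last by rewrite subn0 add0n.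
  by rewrite -[in LHS](subnK s0) addnC eqn_add2r.
have stepE v0 : (0 < s v0)%N ->
    (cnt n (fun v => s v - (v0 == v)) * \prod_v (s v)`!
     = s v0 * if n.+1 == \sum_v s v then n`! else 0)%N.
  move=> s0; have := IH (fun v => s v - (v0 == v))%N; rewrite -/(cnt n _).
  have -> : (\prod_v (s v)`! = s v0 * \prod_v (s v - (v0 == v))`!)%N.
    rewrite (bigD1 v0) //= [in RHS](bigD1 v0) //= eqxx subn1 mulnA.
    rewrite -{1 3}(prednK s0) factS prednK //; congr (_ * _)%N.
    by apply: eq_bigr => v nv; rewrite eq_sym (negPf nv) subn0.
  have -> : (\sum_v (s v - (v0 == v)) = (\sum_v s v).-1)%N.
    rewrite (bigD1 v0) //= [in RHS](bigD1 v0) //= eqxx subn1.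
    rewrite (eq_bigr s); last by move=> v nv; rewrite eq_sym (negPf nv) subn0.
    by rewrite -[in RHS](prednK s0).
  have -> : (n == (\sum_v s v).-1) = (n.+1 == \sum_v s v)%N.
    by rewrite -[in RHS](@prednK (\sum_v s v)) ?eqSS // (bigD1 v0) //= addn_gt0 s0.
  by move=> <-; rewrite mulnCA.
rewrite big_distrl /= (eq_bigr _ stepE) -big_distrl /=.
have -> : (\sum_(v | 0 < s v) s v = \sum_v s v)%N.
  by rewrite big_mkcond; apply: eq_bigr => v _; case: (posnP (s v)).
by case: eqP => [<-|_]; rewrite ?factS ?muln0.
Qed.

(** Expansion of a multilinear operation at exponential generating series: the
    terms of total size [n] are indexed by the maps from ['I_n] to the vertices,
    since there are [n! / prod_v (s v)!] maps with fibers of sizes [s v]. *)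
Lemma gop_series m (G : {set 'I_m * 'I_m}) (Y : 'I_m -> nat -> h) (N : nat) :
    (forall v, Y v 0%N = 0) -> (forall v n, ev_fil n (Y v n)) ->
  ev_fil N
    (gop setT G (fun v => \sum_(n < N) (n`!%:R)^-1 *: Y v n)
     - \sum_(n < N) (n`!%:R)^-1 *:
         \sum_(p : {ffun 'I_n -> 'I_m}) gop setT G (fun v => Y v #|[set w | p w == v]|)).
Proof.
case: N => [|N] Y0 YF.
  rewrite [X in _ - X]big_ord0 subr0.
  case: (boolP (good_graph setT G)) => [/good_graphP[[v _] _ _ _]|bG].
    rewrite (@gop_zero _ _ _ _ _ _ v) ?inE ?big_ord0 //; exact: ev_fil_zero.
  rewrite gop_bad //; exact: ev_fil_zero.
rewrite (gop_expand (ord0 : 'I_N.+1) G (fun _ => xpredT)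
   (fun v (n : 'I_N.+1) => (n`!%:R)^-1 *: Y v n)).
rewrite (eq_bigl xpredT); last by move=> f; apply/familyP.
rewrite (eq_bigr (fun s : {ffun 'I_m -> 'I_N.+1} => (\prod_v ((s v)`!%:R)^-1)
    *: gop setT G (fun v => Y v (s v)))); last first.
  move=> s _; rewrite gop_scale_all; congr (_ *: _).
  by apply: eq_bigl => v; rewrite inE.
rewrite (bigID (fun s : {ffun 'I_m -> 'I_N.+1} => (\sum_v s v < N.+1)%N)) /= addrAC.
set R := \sum_(i < N.+1) _.
suff -> : R = \sum_(s : {ffun 'I_m -> 'I_N.+1} | (\sum_v s v < N.+1)%N)
     (\prod_v ((s v)`!%:R)^-1) *: gop setT G (fun v => Y v (s v)).
  rewrite subrr add0r; apply: ev_sum => s; rewrite -leqNgt => le_s.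
  apply: ev_scale; case: (pickP (fun v => s v == ord0)) => [v /eqP sv|s0].
    by rewrite (@gop_zero _ _ _ _ _ _ v) ?inE ?sv //; apply: ev_fil_zero.
  apply: ev_le le_s _; rewrite (eq_bigl (fun v => v \in [set: 'I_m])); last by move=> v; rewrite inE.
  by apply: gop_fil => v _; split; rewrite // lt0n; apply/negbT; apply: s0.
pose sz n (p : {ffun 'I_n -> 'I_m}) : {ffun 'I_m -> 'I_N.+1} :=
  [ffun v => inord #|[set w | p w == v]|].
have szE n (p : {ffun 'I_n -> 'I_m}) v : (n < N.+1)%N -> sz n p v = #|[set w | p w == v]| :> nat.
  move=> lt; rewrite ffunE inordK // (leq_ltn_trans _ lt) //.
  by apply: leq_trans (max_card _) _; rewrite card_ord.
transitivity (\sum_(n < N.+1) \sum_(s : {ffun 'I_m -> 'I_N.+1} | n == (\sum_v s v)%N :> nat)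
     (\prod_v ((s v)`!%:R)^-1) *: gop setT G (fun v => Y v (s v))); last first.
  rewrite (exchange_big_dep (fun s : {ffun 'I_m -> 'I_N.+1} => (\sum_v s v < N.+1)%N)) /=.
    apply: eq_bigr => s lt_s; rewrite (big_pred1 (Ordinal lt_s)) //.
  by move=> n s _ /eqP <-.
apply: eq_bigr => n _; rewrite (partition_big (sz n) xpredT) //= scaler_sumr [RHS]big_mkcond.
apply: eq_bigr => s _.
rewrite (eq_bigr (fun _ => gop setT G (fun v => Y v (s v)))); last first.
  by move=> p /eqP <-; apply: gop_ext => v _; rewrite szE.
rewrite sumr_const -scaler_nat scalerA.
have -> : #|[pred p | sz n p == s]|
   = #|[set p : {ffun 'I_n -> 'I_m} | [forall v, #|[set w | p w == v]| == s v :> nat]]|.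
  apply: eq_card => p; rewrite !inE; apply/eqP/forallP => [<- v|H].
    by rewrite szE.
  by apply/ffunP=> v; apply/val_inj; rewrite /= szE // (eqP (H v)).
have := card_fiber_sizes n (fun v => s v); set c := #|_| => Ec.
have nzP : \prod_v ((s v)`!%:R : k) != 0 by apply/prodf_neq0 => v _; apply: fact_neq0.
have Ec' : c%:R * \prod_v ((s v)`!%:R : k) = if n == (\sum_v s v)%N :> nat then n`!%:R else 0.
  by rewrite -natr_prod -natrM Ec; case: ifP.
case: ifP Ec' => _ Ec'; last first.
  by move/eqP: Ec'; rewrite mulf_eq0 (negPf nzP) orbF => /eqP ->; rewrite mulr0 scale0r.
congr (_ *: _); rewrite prodfV -[c%:R](mulfK nzP) Ec' mulrA mulVf ?mul1r //.
exact: fact_neq0.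
Qed.

End GraphSums.

Section Composition.
Variables (k : fieldType) (h : evenLieGraph k).
Hypothesis chark : [pchar k] =i pred0.
Variables (C : finType) (c0 : C) (x : C -> h).
Hypothesis x1 : forall c, ev_fil 1 (x c).

(** Colourings are made default outside of [A] so as to be counted once. *)
Definition coloring_on (W : finType) (A : {set W}) (col : {ffun W -> C}) : bool :=
  [forall w, (w \notin A) ==> (col w == c0)].

Definition block_sum (X : character k C) (W : finType) (A : {set W}) : h :=
  \sum_(col : {ffun W -> C} | coloring_on A col) \sum_(E : {set W * W})
    X W col E A *: gop A E (fun w => x (col w)).

Lemma block_sum_inj (X : character k C) (W' W : finType) (f : W' -> W) :
  injective f -> block_sum X (f @: setT) = block_sum X [set: W'].
Proof.
move=> inj_f; rewrite /block_sum.
rewrite (reindex_onto (fun col' : {ffun W' -> C} =>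
     [ffun w => if [pick w' | f w' == w] is Some w' then col' w' else c0])
   (fun col : {ffun W -> C} => [ffun w' => col (f w')])) /=; last first.
  move=> col /forallP onA; apply/ffunP=> w; rewrite ffunE.
  case: pickP => [w' /eqP <-|nw]; first by rewrite ffunE.
  apply/esym/eqP/(implyP (onA w)); apply/imsetP=> -[w' _ Ew].
  by have := nw w'; rewrite Ew eqxx.
have pickE w' : [pick w'' | f w'' == f w'] = Some w'.
  by case: pickP => [w'' /eqP/inj_f -> //|/(_ w')]; rewrite eqxx.
apply: eq_big => [col'|col' _].
  have -> : coloring_on setT col' by apply/forallP=> w; rewrite inE.
  apply/andP; split; last by apply/eqP/ffunP=> w; rewrite !ffunE pickE.
  apply/forallP=> w; apply/implyP=> nw; rewrite ffunE; case: pickP => // w' /eqP Ew.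
  by rewrite -Ew imset_f in nw.
rewrite (bigID (fun E : {set W * W} => E \subset setX (f @: setT) (f @: setT))) /=.
rewrite [X in _ + X]big1 ?addr0; last first.
  move=> E nE; rewrite gop_bad ?scaler0 //; apply: contra nE.
  by case/and4P.
rewrite (reindex_onto (pushforward f) (pullback f)) /=; last first.
  by move=> E; apply: pushforward_pullback.
apply: eq_big => [E|E _].
  rewrite pullback_push // eqxx andbT pushforward_sub //.
  by apply/subsetP=> e; rewrite !inE.
rewrite chi_inj // pullback_push // gop_inj //; congr (_ *: _).
  by apply: chi_ext => // w _; rewrite ffunE pickE.
by apply: gop_ext => w _ /=; rewrite ffunE pickE.
Qed.

Lemma block_sum_card (X : character k C) (W : finType) (A : {set W}) :
  block_sum X A = block_sum X [set: 'I_#|A|].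
Proof. by rewrite -(block_sum_inj X (@enum_val_inj W (mem A))) imset_enum_val. Qed.

Lemma block_sum_fil (X : character k C) (W : finType) (A : {set W}) :
  ev_fil #|A| (block_sum X A).
Proof.
by apply: ev_sum => col _; apply: ev_sum => E _; apply: ev_scale; apply: gop_fil_card.
Qed.

Lemma block_sum0 (X : character k C) (W : finType) : block_sum X (set0 : {set W}) = 0.
Proof.
rewrite /block_sum big1 // => col _; rewrite big1 // => E _.
by rewrite gop_bad ?scaler0 // /good_graph eqxx.
Qed.

Lemma gop_block_sums (V W : finType) (p : W -> V) (G : {set V * V})
    (Z : V -> character k C) :
    good_graph setT G ->
  gop setT G (fun v => block_sum (Z v) [set w | p w == v])
  = \sum_(col : {ffun W -> C}) \sum_(H : {set W * W} |
        [forall v, good_graph [set w | p w == v] (restrict [set w | p w == v] H)]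
        && (contract p H == G))
      (\prod_v Z v W col H [set w | p w == v]) *: gop setT H (fun w => x (col w)).
Proof.
move=> gG; pose fib v := [set w | p w == v].
pose J := ({ffun W -> C} * {set W * W})%type.
pose P v (j : J) := coloring_on (fib v) j.1 && good_graph (fib v) j.2.
pose F v (j : J) := Z v W j.1 j.2 (fib v) *: gop (fib v) j.2 (fun w => x (j.1 w)).
have -> : gop setT G (fun v => block_sum (Z v) (fib v))
          = gop setT G (fun v => \sum_(j | P v j) F v j).
  apply: gop_ext => v _.
  rewrite /block_sum -(pair_big_dep (coloring_on (fib v)) (fun _ => good_graph (fib v))
     (fun col E => F v (col, E))) /=.
  apply: eq_bigr => col _; rewrite [RHS]big_mkcond; apply: eq_bigr => E _.
  by case: ifPn => // bE; rewrite gop_bad ?scaler0.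
rewrite (gop_expand ([ffun=> c0], set0) G P F).
pose restr v (col : {ffun W -> C}) : {ffun W -> C} :=
  [ffun w => if p w == v then col w else c0].
have restr_on v col : coloring_on (fib v) (restr v col).
  by apply/forallP=> w; rewrite inE ffunE; case: (p w == v); rewrite /= ?eqxx.
rewrite (reindex_onto (fun q : {ffun W -> C} * {ffun V -> {set W * W}} =>
     [ffun v => (restr v q.1, q.2 v)] : {ffun V -> J})
  (fun f : {ffun V -> J} => ([ffun w => (f (p w)).1 w], [ffun v => (f v).2]))) /=; last first.
  move=> f /familyP Pf; apply/ffunP=> v; rewrite !ffunE.
  rewrite [RHS]surjective_pairing; congr (_, _); apply/ffunP=> w; rewrite !ffunE.
  case: eqVneq => [-> //|nw]; apply/esym/eqP.
  have /andP[/forallP/(_ w) + _] := Pf v.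
  by rewrite inE nw => /implyP; apply.
transitivity (\sum_(q : {ffun W -> C} * {ffun V -> {set W * W}} |
    [forall v, good_graph (fib v) (q.2 v)])
    \sum_(H | [forall v, restrict (fib v) H == q.2 v] && (contract p H == G))
      (\prod_v Z v W q.1 H (fib v)) *: gop setT H (fun w => x (q.1 w))).
  apply: eq_big => [[col Es]|[col Es]] /=.
    apply/andP/forallP => [[/familyP Pf _] v|gE].
      by have /andP[_] := Pf v; rewrite ffunE.
    split; first by apply/familyP=> v; rewrite ffunE; apply/andP; split; [apply: restr_on | apply: gE].
    by apply/eqP; congr (_, _); apply/ffunP=> w; rewrite !ffunE /= ?ffunE ?eqxx.
  case/andP=> /familyP Pf _.
  have gE v : good_graph (fib v) (Es v) by have /andP[_] := Pf v; rewrite ffunE.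
  rewrite /F gop_scale_all.
  have -> : gop setT G (fun v => gop (fib v) ([ffun v0 => (restr v0 col, Es v0)] v).2
        (fun w => x (([ffun v0 => (restr v0 col, Es v0)] v).1 w)))
     = gop setT G (fun v => gop (fib v) (Es v) (fun w => x (col w))).
    apply: gop_ext => v _; rewrite ffunE /=; apply: gop_ext => w.
    by rewrite inE => pw; rewrite ffunE pw.
  rewrite gop_subst // scaler_sumr; apply: eq_bigr => H /andP[/forallP resH _].
  congr (_ *: _); apply: eq_big => [v|v _]; first by rewrite inE.
  rewrite ffunE /=; apply: chi_ext => [w|a b pa pb].
    by rewrite inE => pw; rewrite ffunE pw.
  by rewrite -(eqP (resH v)) restrictE pa pb !andbT.
transitivity (\sum_(col : {ffun W -> C}) \sum_(Es : {ffun V -> {set W * W}} | [forall v, good_graph (fib v) (Es v)])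
    \sum_(H | [forall v, restrict (fib v) H == Es v] && (contract p H == G))
      (\prod_v Z v W col H (fib v)) *: gop setT H (fun w => x (col w))).
  by rewrite [RHS]pair_big_dep.
apply: eq_bigr => col _.
rewrite (exchange_big_dep (fun H => [forall v, good_graph (fib v) (restrict (fib v) H)]
   && (contract p H == G))) /=; last first.
  move=> Es H /forallP gE /andP[/forallP resH ->]; rewrite andbT.
  by apply/forallP=> v; rewrite (eqP (resH v)).
apply: eq_bigr => H /andP[/forallP gH cH].
rewrite (big_pred1 [ffun v => restrict (fib v) H]) // => Es /=.
rewrite cH andbT; apply/andP/eqP => [[_ /forallP resH]|->].
  by apply/ffunP=> v; rewrite ffunE (eqP (resH v)).
by split; apply/forallP=> v; rewrite ffunE.
Qed.

End Composition.

Section PhiTerm.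
Variables (k : fieldType) (h : evenLieGraph k).
Variables (C : finType) (x : C -> h).

(** The part with [n] vertices of the sum of all graphs with vertices coloured
    by [C], weighted by [X], and evaluated at [x]. *)
Definition phi_term (X : character k C) (n : nat) : h :=
  (n`!%:R)^-1 *: \sum_(col : {ffun 'I_n -> C}) \sum_(E : {set 'I_n * 'I_n})
    X _ col E setT *: gop setT E (fun w => x (col w)).

Lemma phi_term_block (c0 : C) (X : character k C) n :
  phi_term X n = (n`!%:R)^-1 *: block_sum c0 x X [set: 'I_n].
Proof.
congr (_ *: _); apply: eq_bigl => col; apply/esym/forallP=> w; by rewrite inE.
Qed.

Lemma phi_term_fil X n : (forall c, ev_fil 1 (x c)) -> ev_fil n (phi_term X n).
Proof.
move=> x1; apply: ev_scale; apply: ev_sum => col _; apply: ev_sum => E _; apply: ev_scale.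
have := @gop_fil_card k h _ [set: 'I_n] E (fun w => x (col w)).
by rewrite cardsT card_ord; apply.
Qed.

Lemma phi_term0 X : phi_term X 0 = 0.
Proof.
rewrite /phi_term big1 ?scaler0 // => col _; rewrite big1 // => E _.
rewrite gop_bad ?scaler0 //; apply/negP => /good_graphP[[[]]] //.
Qed.

End PhiTerm.

Section Multiplicativity.
Variables (k : fieldType) (h : evenLieGraph k).
Hypothesis chark : [pchar k] =i pred0.

Lemma conv_letters (W : finType) (col : W -> bool) (E : {set W * W}) :
  conv (letter k false) (letter k true) W col E setT = (level_compatible col E)%:R.
Proof.
pose B := [set w | ~~ col w].
rewrite /conv /= /conv_fun (bigID (pred1 B)) /= [X in _ + X]big1 ?addr0; last first.
  move=> D /andP[_ /eqP neD]; rewrite /letter_fun -natrM mulnb.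
  case: andP => // -[/letterP[D1 _] /letterP[D2 _]]; case: neD.
  apply/setP=> w; rewrite inE; apply/idP/idP => [/D1 -> //|]; apply: contraR => nD.
  by apply: D2; rewrite !inE nD.
have bool1 (b c d : bool) : (b -> c && d) -> (if b then c%:R * d%:R else 0) = b%:R :> k.
  by case: b => // /(_ isT)/andP[-> ->]; rewrite mulr1.
rewrite big_andbC big_mkcondr big_pred1_eq.
have -> : level_compatible col E = [&& lower E setT B,
    [forall a in B, forall b in B, (a, b) \notin E]
    & [forall a in setT :\: B, forall b in setT :\: B, (a, b) \notin E]].
  apply/level_compatibleP/and3P => [H|[/lowerP[_ H1] /forall_inP H2 /forall_inP H3] a b Eab].
    split; first (apply/lowerP; split; first exact: subsetT).
    - by move=> a b; rewrite !inE => na _ _; apply/negP => /H; rewrite (negPf na).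
    - apply/forall_inP=> a; rewrite inE => na; apply/forall_inP=> b _.
      by apply/negP=> /H; rewrite (negPf na).
    apply/forall_inP=> a _; apply/forall_inP=> b; rewrite !inE andbT negbK => cb.
    by apply/negP=> /H; rewrite cb andbF.
  have := H1 a b; rewrite !inE Eab.
  have := H2 a; rewrite inE => H2a; have := H3 a; rewrite !inE andbT negbK => H3a.
  case ca: (col a) H2a H3a => /=.
    move=> _ /(_ isT)/forall_inP/(_ b); rewrite !inE andbT negbK Eab.
    by case: (col b) => // /(_ isT).
  move=> /(_ isT)/forall_inP/(_ b); rewrite inE Eab.
  by case: (col b) => //= [_ _ /(_ isT isT isT)|/(_ isT)].
rewrite /letter_fun.
have -> : [forall a in B, col a == false].
  by apply/forall_inP=> a; rewrite inE => /negPf ->.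
have -> : [forall a in setT :\: B, col a == true].
  by apply/forall_inP=> a; rewrite !inE andbT negbK => ->.
by case: (lower _ _ _); rewrite //= -natrM mulnb.
Qed.

Definition mul_term (y : bool -> h) (m : nat) : h :=
  phi_term y (conv (letter k false) (letter k true)) m.

Lemma mul_termE (y : bool -> h) m :
  mul_term y m = (m`!%:R)^-1 *: \sum_(lev : {ffun 'I_m -> bool})
    \sum_(G | good_graph setT G && level_compatible lev G)
      gop setT G (fun v => y (lev v)).
Proof.
rewrite /mul_term /phi_term; congr (_ *: _); apply: eq_bigr => lev _.
rewrite [RHS]big_mkcond; apply: eq_bigr => G _; rewrite conv_letters.
case: ifPn => [/andP[_ ->]|]; first by rewrite scale1r.
rewrite negb_and => /orP[bG|/negPf ->]; last by rewrite scale0r.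
by rewrite gop_bad ?scaler0.
Qed.

Variables (C : finType) (x : C -> h).
Hypothesis x1 : forall c, ev_fil 1 (x c).
Variables (X Y : character k C).
Let XY (b : bool) := if b then Y else X.

Lemma good_admissible (W : finType) m (p : W -> 'I_m) (lev : 'I_m -> bool) H :
  good_graph setT H -> admissible H p lev -> good_graph setT (contract p H).
Proof.
move=> gH /andP[/level_compatibleP cH /forallP fH].
have -> : [set: 'I_m] = p @: setT.
  apply/setP=> v; rewrite inE; apply/esym/imsetP.
  by have /good_graphP[[w]] := fH v; rewrite inE => /eqP <-; exists w.
apply: (@good_contract _ _ _ _ _ (fun v => lev v : nat)) => // a b /cH.
by case: (lev a); case: (lev b).
Qed.

Lemma mul_phi_terms (N : nat) (y : bool -> h) :
    (0 < N)%N -> C -> (forall b, ev_fil 1 (y b)) ->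
    (forall b, ev_fil N (y b - \sum_(n < N) phi_term x (XY b) n)) ->
  ev_fil N (\sum_(m < N) mul_term y m - \sum_(n < N) phi_term x (conv X Y) n).
Proof.
move=> N0 c0 y1 yN.
pose Yb b n := block_sum c0 x (XY b) [set: 'I_n].
pose yb b := \sum_(n < N) phi_term x (XY b) n.
have yb1 b : ev_fil 1 (yb b).
  apply: ev_sum => n _; case: n => [[|n] ltn] /=; first by rewrite phi_term0; apply: ev_fil_zero.
  by apply: ev_le (phi_term_fil _ _ x1).
pose T m (lev : {ffun 'I_m -> bool}) G n := (n`!%:R)^-1 *: \sum_(p : {ffun 'I_n -> 'I_m})
    gop setT G (fun v => block_sum c0 x (XY (lev v)) [set w | p w == v]).
pose S := \sum_(m < N) (m`!%:R)^-1 *: \sum_(lev : {ffun 'I_m -> bool})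
    \sum_(G | good_graph setT G && level_compatible lev G) \sum_(n < N) T m lev G n.
apply: (@ev_trans _ _ _ _ S).
  rewrite /S -sumrB; apply: ev_sum => m _; rewrite mul_termE -scalerBr; apply: ev_scale.
  rewrite -sumrB; apply: ev_sum => lev _; rewrite -sumrB; apply: ev_sum => G /andP[gG _].
  apply: (@ev_trans _ _ _ _ (gop setT G (fun v => yb (lev v)))).
    have m0 : (0 < m)%N.
      by have /good_graphP[[v _] _ _ _] := gG; apply: leq_ltn_trans (ltn_ord v).
    apply: (@ev_le _ _ _ (#|[set: 'I_m]| + N).-1).
      by rewrite cardsT card_ord -(prednK m0) addSn /= leq_addl.
    by apply: gop_congr.
  have := @gop_series k h chark m G (fun v n => Yb (lev v) n) N.
  have Yb0 b : Yb b 0%N = 0.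
    by rewrite /Yb; have -> : [set: 'I_0] = set0 by [apply/setP=> -[]]; rewrite block_sum0.
  have YbF b n : ev_fil n (Yb b n).
    by have := block_sum_fil c0 x1 (XY b) [set: 'I_n]; rewrite cardsT card_ord.
  move=> /(_ (fun v => Yb0 _) (fun v n => YbF _ n)).
  congr (ev_fil _ (_ - _)).
    by apply: gop_ext => v _; apply: eq_bigr => n _; rewrite (phi_term_block _ c0).
  apply: eq_bigr => n _; congr (_ *: _); apply: eq_bigr => p _.
  by apply: gop_ext => v _; rewrite /Yb -block_sum_card.
suff -> : S = \sum_(n < N) phi_term x (conv X Y) n.
  by rewrite subrr; apply: ev_fil_zero.
transitivity (\sum_(m < N) \sum_(n < N) (n`!%:R)^-1 *: \sum_(col : {ffun 'I_n -> C})
  \sum_(H | good_graph setT H) ((m`!%:R)^-1 *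
     (\sum_(p : {ffun 'I_n -> 'I_m}) \sum_(lev : {ffun 'I_m -> bool} | admissible H p lev)
        \prod_v XY (lev v) _ col H [set w | p w == v]))
    *: gop setT H (fun w => x (col w))); last first.
  rewrite exchange_big /=; apply: eq_bigr => n _.
  rewrite -scaler_sumr; congr (_ *: _).
  rewrite exchange_big /=; apply: eq_bigr => col _.
  rewrite exchange_big /= [RHS](bigID (fun H : {set _ * _} => good_graph setT H)) /=.
  rewrite [X in _ = _ + X]big1 ?addr0; last by move=> H bH; rewrite gop_bad ?scaler0.
  apply: eq_bigr => H gH; rewrite -scaler_suml; congr (_ *: _).
  by apply: (conv_quotients col chark X Y gH); rewrite card_ord.
apply: eq_bigr => m _.
transitivity (\sum_(lev : {ffun 'I_m -> bool})
    \sum_(G | good_graph setT G && level_compatible lev G) \sum_(n < N)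
     (n`!%:R)^-1 *: \sum_(p : {ffun 'I_n -> 'I_m}) \sum_(col : {ffun 'I_n -> C})
      \sum_(H | good_graph setT H && ([forall v, good_graph [set w | p w == v] (restrict [set w | p w == v] H)]
        && (contract p H == G)))
      ((m`!%:R)^-1 * \prod_v XY (lev v) _ col H [set w | p w == v])
         *: gop setT H (fun w => x (col w))).
  rewrite scaler_sumr; apply: eq_bigr => lev _; rewrite scaler_sumr.
  apply: eq_bigr => G /andP[gG _]; rewrite scaler_sumr; apply: eq_bigr => n _.
  rewrite /T scalerA mulrC -scalerA; congr (_ *: _); rewrite scaler_sumr.
  apply: eq_bigr => p _; rewrite gop_block_sums // scaler_sumr.
  apply: eq_bigr => col _; rewrite scaler_sumr (bigID (fun H : {set _ * _} => good_graph setT H)) /=.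
  rewrite [X in _ + X]big1 ?addr0; last by move=> H /andP[_ bH]; rewrite gop_bad ?scaler0.
  by apply: eq_big => [H|H _]; rewrite ?scalerA // andbC.
under eq_bigr => lev _ do rewrite exchange_big /=.
rewrite exchange_big /=; apply: eq_bigr => n _.
under eq_bigr => lev _ do rewrite -scaler_sumr.
rewrite -scaler_sumr; congr (_ *: _).
transitivity (\sum_(col : {ffun 'I_n -> C}) \sum_(lev : {ffun 'I_m -> bool})
   \sum_(p : {ffun 'I_n -> 'I_m}) \sum_(H | good_graph setT H && admissible H p lev)
      ((m`!%:R)^-1 * \prod_v XY (lev v) _ col H [set w | p w == v])
         *: gop setT H (fun w => x (col w))).
  rewrite [RHS]exchange_big /=; apply: eq_bigr => lev _.
  rewrite exchange_big /= [RHS]exchange_big /=; apply: eq_bigr => p _.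
  rewrite exchange_big /=; apply: eq_bigr => col _.
  rewrite (exchange_big_dep (fun H => good_graph setT H && admissible H p lev)) /=; last first.
    move=> G H /andP[gG cG] /and3P[gH fH /eqP cH].
    by rewrite gH /admissible fH cH cG.
  apply: eq_bigr => H /andP[gH aH]; rewrite (big_pred1 (contract p H)) // => G /=.
  apply/idP/eqP => [/andP[_ /and3P[_ _ /eqP -> //]]|->].
  by rewrite (good_admissible gH aH) gH eqxx; case/andP: aH => -> ->.
apply: eq_bigr => col _; rewrite exchange_big /=.
rewrite [RHS](eq_bigr (fun H => \sum_(p : {ffun 'I_n -> 'I_m})
   \sum_(lev : {ffun 'I_m -> bool} | admissible H p lev)
      ((m`!%:R)^-1 * \prod_v XY (lev v) _ col H [set w | p w == v])
         *: gop setT H (fun w => x (col w)))); last first.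
  move=> H _; rewrite mulr_sumr scaler_suml; apply: eq_bigr => p _.
  by rewrite mulr_sumr scaler_suml.
rewrite [RHS]exchange_big /=; apply: eq_bigr => p _.
by rewrite [RHS](exchange_big_dep xpredT).
Qed.

End Multiplicativity.

(** * The exponential character *)

Section Exponential.
Variables (k : fieldType).
Hypothesis chark : [pchar k] =i pred0.

Section Lex.
Variable W : finType.
Implicit Types (E : {set W * W}) (A B : {set W}).

Definition bottom E A v := [forall b in A, (v, b) \notin E].

Lemma bottomP E A v : reflect (forall b, b \in A -> (v, b) \notin E) (bottom E A v).
Proof. exact: forall_inP. Qed.

Fixpoint lex_rec (n : nat) E A : k :=
  if n is n'.+1 then (n%:R)^-1 * \sum_(v in A | bottom E A v) lex_rec n' E (A :\ v)
  else 1.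

(** The proportion of the total orders on [A] that are compatible with [E]. *)
Definition lex E A : k := lex_rec #|A| E A.

Lemma lexE E A :
  #|A|%:R * lex E A = \sum_(v in A | bottom E A v) lex E (A :\ v).
Proof.
case: (posnP #|A|) => [A0|A0].
  rewrite A0 mul0r; move/eqP: A0; rewrite cards_eq0 => /eqP ->.
  by rewrite big1 // => v; rewrite inE.
rewrite {1}/lex -(prednK A0) /= prednK // mulrA mulfV ?mul1r ?natf_neq0 //.
by apply: eq_bigr => v /andP[Av _]; rewrite /lex (cardsD1 v A) Av.
Qed.

Lemma lex0 E : lex E set0 = 1.
Proof. by rewrite /lex cards0. Qed.

Lemma lex_ind (P : {set W} -> Prop) :
  (forall A, (forall v, v \in A -> P (A :\ v)) -> P A) -> forall A, P A.
Proof.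
move=> IH A; move: {2}#|A| (leqnn #|A|) => n; elim: n A => [|n IHn] A leA.
  apply: IH => v Av; move: leA; rewrite leqn0 cards_eq0 => /eqP A0.
  by rewrite A0 inE in Av.
by apply: IH => v Av; apply: IHn; rewrite (cardsD1 v A) Av in leA.
Qed.

Lemma lex_cancel E A (c : k) : (0 < #|A|)%N ->
  \sum_(v in A | bottom E A v) lex E (A :\ v) = #|A|%:R * c -> lex E A = c.
Proof. by move=> A0; rewrite -lexE => /(mulfI (natf_neq0 chark A0)). Qed.

Lemma lex_ext E E' A : {in A &, forall a b, ((a, b) \in E) = ((a, b) \in E')} ->
  lex E A = lex E' A.
Proof.
elim/lex_ind: A => A IH EE'.
case: (posnP #|A|) => [/eqP|A0]; first by rewrite cards_eq0 => /eqP ->; rewrite !lex0.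
apply: lex_cancel => //; rewrite lexE; apply: eq_big => [v|v /andP[Av _]].
  case Av: (v \in A) => //=; apply/bottomP/bottomP => H b Ab; first by rewrite -EE' // H.
  by rewrite EE' // H.
by apply: IH => // a b /setD1P[_ Aa] /setD1P[_ Ab]; apply: EE'.
Qed.

Lemma lex_U E A B : [disjoint A & B] ->
  (forall a b, a \in A -> b \in B -> ((a, b) \notin E) && ((b, a) \notin E)) ->
  lex E (A :|: B) = lex E A * lex E B.
Proof.
move: {2}(A :|: B) (erefl (A :|: B)) => D; elim/lex_ind: D A B => D IH A B ABD dAB nE.
case: (posnP #|A :|: B|) => [/eqP|AB0].
  rewrite cards_eq0 setU_eq0 => /andP[/eqP -> /eqP ->].
  by rewrite setU0 lex0 mulr1.
apply: lex_cancel => //.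
have nA w : w \in A -> (w \in B) = false by move=> Aw; rewrite (disjointFr dAB Aw).
have nB w : w \in B -> (w \in A) = false by move=> Bw; rewrite (disjointFl dAB Bw).
have cU : #|A :|: B| = (#|A| + #|B|)%N.
  by rewrite cardsU disjoint_setI0 // cards0 subn0.
rewrite cU natrD mulrDl [_ * (_ * lex E B)]mulrA lexE [#|B|%:R * _]mulrCA lexE.
rewrite mulr_suml mulr_sumr (bigID (fun v => v \in A)) /=; congr (_ + _).
  apply: eq_big => [v|v /andP[/andP[ABv _] Av]].
    case Av: (v \in A); rewrite ?andbF // inE Av andbT /=.
    apply/bottomP/bottomP => H b; first by move=> Ab; apply: H; rewrite inE Ab.
    by rewrite inE => /orP[/H //|Bb]; have /andP[] := nE _ _ Av Bb.
  have -> : (A :|: B) :\ v = (A :\ v) :|: B.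
    by apply/setP=> w; rewrite !inE; case: (eqVneq w v) => [->|] //=; rewrite nA.
  apply: (IH v); rewrite -?ABD //.
  - by apply/setP=> w; rewrite !inE; case: (eqVneq w v) => [->|] //=; rewrite nA.
  - by apply: disjointWl dAB; apply: subD1set.
  - by move=> a b /setD1P[_]; apply: nE.
apply: eq_big => [v|v /andP[/andP[ABv _] nAv]].
  case Bv: (v \in B); last by rewrite inE Bv orbF; case: (v \in A); rewrite ?andbF.
  rewrite nB // inE Bv orbT andbT /=.
  apply/bottomP/bottomP => H b; first by move=> Bb; apply: H; rewrite inE Bb orbT.
  by rewrite inE => /orP[Ab|/H //]; have /andP[] := nE _ _ Ab Bv.
have Bv : v \in B by move: ABv; rewrite inE (negPf nAv).
have -> : (A :|: B) :\ v = A :|: (B :\ v).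
  by apply/setP=> w; rewrite !inE; case: (eqVneq w v) => [->|] //=; rewrite (negPf nAv).
apply: (IH v); rewrite -?ABD //.
- by apply/setP=> w; rewrite !inE; case: (eqVneq w v) => [->|] //=; rewrite (negPf nAv).
- by apply: disjointWr dAB; apply: subD1set.
- by move=> a b Aa /setD1P[_]; apply: nE.
Qed.

(** Cutting the compatible total orders on [A] after their first [j] elements
    counts the pairs of compatible orders on a lower part and on its complement. *)
Lemma lex_cut E A j :
  \sum_(B | lower E A B && (#|B| == j)) lex E B * lex E (A :\: B)
  = 'C(#|A|, j)%:R * lex E A.
Proof.
elim: j A => [|j IH] A.
  rewrite (big_pred1 set0) ?setD0 ?lex0 ?mul1r ?bin0 ?mul1r // => B.
  rewrite cards_eq0 andb_idl // => /eqP ->; apply/lowerP; split; first exact: sub0set.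
  by move=> a b; rewrite inE.
apply: (mulfI (natf_neq0 chark (ltn0Sn j))).
transitivity (\sum_(B | lower E A B && (#|B| == j.+1))
   \sum_(v in B | bottom E B v) lex E (B :\ v) * lex E (A :\: B)).
  rewrite mulr_sumr; apply: eq_bigr => B /andP[_ /eqP <-].
  by rewrite mulrA lexE mulr_suml.
rewrite (exchange_big_dep (fun v => (v \in A) && bottom E A v)) /=; last first.
  move=> B v /andP[/lowerP[/subsetP sBA dB] _] /andP[Bv /bottomP bv].
  rewrite sBA //=; apply/bottomP=> b Ab; case Bb: (b \in B); first exact: bv.
  by apply: dB; rewrite ?Bb.
transitivity (\sum_(v in A | bottom E A v) 'C(#|A|.-1, j)%:R * lex E (A :\ v)); last first.
  by rewrite -mulr_sumr -lexE !mulrA -!natrM mulnC mul_bin_diag.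
apply: eq_bigr => v /andP[Av /bottomP bv].
have cA : #|A|.-1 = #|A :\ v| by rewrite (cardsD1 v A) Av.
rewrite cA -IH.
rewrite (reindex_onto (fun B => v |: B) (fun B => B :\ v)) /=; last first.
  by move=> B /andP[_ /andP[Bv _]]; rewrite setD1K.
apply: eq_big => [B|B].
  apply/idP/idP.
    case/andP=> /andP[/andP[/lowerP[/subsetP sB dB] cB] _] /eqP vB.
    have nv : v \notin B by rewrite -vB !inE eqxx.
    apply/andP; split; last by rewrite cardsU1 nv in cB.
    apply/lowerP; split.
      apply/subsetP=> w Bw; rewrite !inE sB ?inE ?Bw ?orbT // andbT.
      by apply: contraNneq nv => <-.
    move=> a b Ba /setD1P[bv' Ab] nBb; apply: dB => //.
      by rewrite inE Ba orbT.
    by rewrite !inE negb_or bv'.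
  case/andP=> /lowerP[/subsetP sB dB] cB.
  have nv : v \notin B by apply/negP=> /sB; rewrite !inE eqxx.
  have vB : (v |: B) :\ v = B.
    apply/setP=> w; rewrite !inE; case: (eqVneq w v) => [->|] //=.
    by rewrite (negPf nv).
  rewrite vB eqxx andbT setU11 cardsU1 nv /= -[(_ == j.+1)]/(#|B| == j) cB andbT.
  apply/andP; split; last first.
    apply/bottomP=> b; rewrite !inE => /orP[/eqP ->|/sB /setD1P[_]]; apply: bv => //.
  apply/lowerP; split.
    apply/subsetP=> w; rewrite !inE => /orP[/eqP -> //|/sB /setD1P[_ //]].
  move=> a b; rewrite !inE negb_or => /orP[/eqP -> Ab _|Ba Ab /andP[nbv nB]].
    exact: bv.
  by apply: dB => //; rewrite !inE nbv.
case/andP=> _ /eqP vB; rewrite vB; congr (_ * lex E _).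
by apply/setP=> w; rewrite !inE negb_or andbCA andbA.
Qed.

End Lex.

Lemma lex_inj (W W' : finType) (f : W' -> W) (E : {set W * W}) (A : {set W'}) :
  injective f -> lex E (f @: A) = lex (pullback f E) A.
Proof.
move=> inj_f; elim/lex_ind: A => A IH.
case: (posnP #|A|) => [/eqP|A0].
  by rewrite cards_eq0 => /eqP ->; rewrite imset0 !lex0.
apply: lex_cancel; first by rewrite card_imset.
rewrite card_imset // lexE big_mkcondr /= big_imset /=; last by move=> ? ? _ _ /inj_f.
rewrite [RHS]big_mkcondr /=; apply: eq_bigr => v Av.
have -> : bottom E (f @: A) (f v) = bottom (pullback f E) A v.
  apply/bottomP/bottomP => H b; first by move=> Ab; rewrite pullbackE H ?imset_f.
  by case/imsetP=> b' Ab' ->; rewrite -pullbackE H.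
case: ifP => // _; rewrite -IH //; congr (lex E _).
by rewrite -imset_set1 -imset_setD // imset_set1.
Qed.

Section ExpChar.
Variables (C : finType) (c : C) (s : k).

Definition exp_fun (W : finType) (col : W -> C) (E : {set W * W}) (A : {set W}) : k :=
  if [forall a in A, col a == c] then s ^+ #|A| * lex E A else 0.

Fact exp_ext (W : finType) (col col' : W -> C) (E E' : {set W * W}) (A : {set W}) :
  {in A, col =1 col'} -> {in A &, forall a b, ((a, b) \in E) = ((a, b) \in E')} ->
  exp_fun col E A = exp_fun col' E' A.
Proof.
move=> Ec EE; rewrite /exp_fun (lex_ext EE); congr (if _ then _ else _).
by apply: eq_forallb_in => a Aa; rewrite Ec.
Qed.

Fact exp_inj (W W' : finType) (f : W' -> W) (col : W -> C) (E : {set W * W})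
    (A : {set W'}) : injective f ->
  exp_fun col E (f @: A) = exp_fun (fun w => col (f w)) (pullback f E) A.
Proof.
move=> inj_f; rewrite /exp_fun lex_inj // card_imset //; congr (if _ then _ else _).
apply/forall_inP/forall_inP => H a; first by move=> Aa; apply: H; rewrite imset_f.
by case/imsetP=> b Ab ->; apply: H.
Qed.

Fact exp_0 (W : finType) (col : W -> C) (E : {set W * W}) : exp_fun col E set0 = 1.
Proof.
rewrite /exp_fun cards0 lex0 mulr1 ifT //; apply/forall_inP=> a; by rewrite inE.
Qed.

Fact exp_U (W : finType) (col : W -> C) (E : {set W * W}) (A B : {set W}) :
  [disjoint A & B] ->
  (forall a b, a \in A -> b \in B -> ((a, b) \notin E) && ((b, a) \notin E)) ->
  exp_fun col E (A :|: B) = exp_fun col E A * exp_fun col E B.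
Proof.
move=> dAB nE; rewrite /exp_fun lex_U // cardsU disjoint_setI0 // cards0 subn0 exprD.
have -> : [forall a in A :|: B, col a == c]
          = [forall a in A, col a == c] && [forall a in B, col a == c].
  apply/forall_inP/andP => [H|[/forall_inP HA /forall_inP HB] a].
    by split; apply/forall_inP=> a Aa; apply: H; rewrite inE Aa ?orbT.
  by rewrite inE => /orP[/HA|/HB].
by do 2 case: [forall a in _, _]; rewrite /= ?mulr0 ?mul0r // mulrACA.
Qed.

Definition exp_char : character k C := Character exp_ext exp_inj exp_0 exp_U.

End ExpChar.

Lemma conv_exp (C : finType) (c : C) (s t : k) (W : finType) (col : W -> C) E A :
  conv (exp_char c s) (exp_char c t) W col E A = exp_char c (s + t) W col E A.
Proof.
rewrite /= /conv_fun /= /exp_fun.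
case: ifPn => [/forall_inP cA|/forall_inPn[a Aa nca]]; last first.
  rewrite big1 // => B _; case: (boolP [forall a in B, col a == c]); last by rewrite mul0r.
  move/forall_inP=> cB; rewrite ifF ?mulr0 //; apply/negP => /forall_inP cAB; case/negP: nca.
  by case Ba: (a \in B); [apply: cB | apply: cAB; rewrite inE Ba].
transitivity (\sum_(j < #|A|.+1) \sum_(B | lower E A B && (#|B| == j))
    s ^+ j * t ^+ (#|A| - j) * (lex E B * lex E (A :\: B))); last first.
  under eq_bigr => j _ do rewrite -mulr_sumr lex_cut mulrA mulr_natr.
  rewrite -mulr_suml addrC exprDn; congr (_ * _); apply: eq_bigr => j _.
  by rewrite mulrC.
rewrite (partition_big (fun B : {set W} => inord #|B| : 'I_#|A|.+1) xpredT) //=.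
apply: eq_bigr => j _.
have ltB B : lower E A B -> (#|B| < #|A|.+1)%N.
  by case/lowerP=> sBA _; rewrite ltnS subset_leq_card.
apply: eq_big => [B|B /andP[lB /eqP <-]].
  by case lB: (lower E A B) => //=; rewrite -val_eqE /= inordK // ltB.
have /lowerP[sBA _] := lB.
rewrite inordK ?ltB // -cardsDS // !ifT; first by rewrite mulrACA.
  by apply/forall_inP=> a /setDP[Aa _]; apply: cA.
by apply/forall_inP=> a Ba; apply: cA; apply: (subsetP sBA).
Qed.

End Exponential.

Section ConvAlgebra.
Variables (k : fieldType) (C : finType).
Implicit Types (X Y Z : character k C).

Lemma conv_unit X (W : finType) (col : W -> C) E A :
  conv X (unit_char k C) W col E A = X W col E A.
Proof.
rewrite /= /conv_fun /= (bigD1 A) /=; last first.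
  by apply/lowerP; split=> // a b _ -> .
rewrite setDv /unit_fun eqxx mulr1 big1 ?addr0 // => B /andP[/lowerP[sBA _] nBA].
rewrite setD_eq0 -[A \subset B]andbT -sBA -eqEsubset eq_sym.
by rewrite (negPf nBA) mulr0.
Qed.

Lemma unit_conv X (W : finType) (col : W -> C) E A :
  conv (unit_char k C) X W col E A = X W col E A.
Proof.
rewrite /= /conv_fun /= (bigD1 set0) /=; last first.
  by apply/lowerP; split=> [|a b]; rewrite ?sub0set // inE.
rewrite setD0 /unit_fun eqxx mul1r big1 ?addr0 // => B /andP[_ nB0].
by rewrite (negPf nB0) mul0r.
Qed.

Lemma conv_assoc X Y Z (W : finType) (col : W -> C) E A :
  conv (conv X Y) Z W col E A = conv X (conv Y Z) W col E A.
Proof.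
rewrite /= /conv_fun.
under eq_bigr => B _ do rewrite mulr_suml.
under [RHS]eq_bigr => D _ do rewrite mulr_sumr.
rewrite (exchange_big_dep (lower E A)) /=; last first.
  move=> B D /lowerP[/subsetP sBA dB] /lowerP[/subsetP sDB dD].
  apply/lowerP; split; first by apply/subsetP=> w /sDB/sBA.
  move=> a b Da Ab nDb; case Bb: (b \in B); first by apply: dD.
  by apply: dB; rewrite ?Bb ?sDB.
apply: eq_bigr => D /lowerP[/subsetP sDA dD].
rewrite (reindex_onto (fun B' => D :|: B') (fun B => B :\: D)) /=; last first.
  move=> B /andP[_ /lowerP[/subsetP sDB _]]; apply/setP=> w; rewrite !inE.
  by case: (boolP (w \in D)) => [/sDB ->|].
apply: eq_big => [B'|B'].
  apply/idP/idP.
    case/andP=> /andP[/lowerP[/subsetP sB dB] /lowerP[_ dD']] /eqP DB.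
    have nD w : w \in B' -> w \notin D by rewrite -DB inE => /andP[].
    apply/lowerP; split; first by apply/subsetP=> w B'w; rewrite inE nD // sB // inE B'w orbT.
    move=> a b B'a /setDP[Ab nDb] nB'; apply: dB => //; first by rewrite inE B'a orbT.
    by rewrite inE negb_or nDb.
  case/lowerP=> /subsetP sB dB.
  have nD w : w \in B' -> w \notin D by move/sB; rewrite inE => /andP[].
  apply/andP; split; [apply/andP; split|].
  - apply/lowerP; split.
      by apply/subsetP=> w; rewrite inE => /orP[/sDA //|/sB/setDP[]].
    move=> a b; rewrite !inE negb_or => Hab Ab /andP[nDb nBb].
    case/orP: Hab => [Da|Ba]; first exact: dD.
    by apply: dB => //; rewrite inE nDb.
  - apply/lowerP; split; first exact: subsetUl.
    move=> a b Da; rewrite inE => /orP[->//|/sB/setDP[Ab nDb] _]; exact: dD.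
  - apply/eqP/setP=> w; rewrite !inE; case B'w: (w \in B'); first by rewrite nD // orbT.
    by rewrite orbF andNb.
case/andP=> _ /eqP DB; rewrite DB mulrA; congr (_ * Z _ _ _ _).
by rewrite setDDl.
Qed.

End ConvAlgebra.

(** * The deformation gauge group of an even algebra *)

Section Limits.
Variables (k : fieldType) (h : evenLieGraph k).
Implicit Types (t : nat -> h) (y z : h).

Definition sums_to t y := forall N, ev_fil N (y - \sum_(n < N) t n).

Definition hsum t : h := epsilon (inhabits 0) (sums_to t).

Lemma sums_to_uniq t y z : sums_to t y -> sums_to t z -> y = z.
Proof. by move=> ty tz; apply: ev_eq => N; apply: ev_trans (ty N) (ev_sym (tz N)). Qed.

Lemma sums_to_ex t : (forall n, ev_fil n (t n)) -> exists y, sums_to t y.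
Proof.
move=> tF; have [|i|y _ yP] := @ev_complete k h (fun i => \sum_(n < i) t n).
- by move=> i; apply: ev_sum => n _; apply: ev_le (tF n).
- by rewrite big_ord_recr /= addrAC subrr add0r.
- by exists y.
Qed.

Lemma hsumP t : (forall n, ev_fil n (t n)) -> sums_to t (hsum t).
Proof. by move=> tF; apply: epsilon_spec; apply: sums_to_ex. Qed.

Lemma hsum_eq t y : (forall n, ev_fil n (t n)) -> sums_to t y -> hsum t = y.
Proof. by move=> tF; apply: sums_to_uniq; apply: hsumP. Qed.

Lemma hsum_ext t t' : (forall n, ev_fil n (t n)) -> t =1 t' -> hsum t = hsum t'.
Proof.
move=> tF tt; apply: hsum_eq => // N; under eq_bigr => n _ do rewrite tt.
by apply: hsumP => n; rewrite -tt.
Qed.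

Lemma hsum_fil1 t : (forall n, ev_fil n (t n)) -> t 0%N = 0 -> ev_fil 1 (hsum t).
Proof.
move=> tF t0; have := hsumP tF 1; rewrite big_ord_recr big_ord0 /= t0 !addr0 subr0.
by [].
Qed.

Lemma hsum_finite t d : (forall n, (d <= n)%N -> t n = 0) -> (forall n, ev_fil n (t n)) ->
  hsum t = \sum_(n < d) t n.
Proof.
move=> t0 tF; apply: hsum_eq => // N.
rewrite -!(big_mkord xpredT t).
have [le_dN|/ltnW le_Nd] := leqP d N.
  rewrite [X in _ - X](big_cat_nat (leq0n d)) //= opprD addrA subrr add0r big_nat big1.
    by rewrite oppr0; apply: ev_fil_zero.
  by move=> i /andP[le_di _]; apply: t0.
rewrite (big_cat_nat (leq0n N)) //= addrAC subrr add0r big_nat.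
by apply: ev_sum => i /andP[le_Ni _]; apply: ev_le (tF _).
Qed.

End Limits.

Section GaugeGroup.
Variables (k : fieldType) (h : evenLieGraph k).
Hypothesis chark : [pchar k] =i pred0.
Implicit Types (u v w : h).

Definition phi (C : finType) (x : C -> h) (X : character k C) : h := hsum (phi_term x X).

Definition pair_fun (T : Type) (u v : T) (b : bool) : T := if b then v else u.

Definition gmul u v : h := phi (pair_fun u v) (conv (letter k false) (letter k true)).

Section Phi.
Variables (C : finType) (x : C -> h).
Hypothesis x1 : forall c, ev_fil 1 (x c).
Implicit Types (X Y : character k C).

Lemma phiP X : sums_to (phi_term x X) (phi x X).
Proof. by apply: hsumP => n; apply: phi_term_fil. Qed.

Lemma phi_fil1 X : ev_fil 1 (phi x X).
Proof. by apply: hsum_fil1 => [n|]; [apply: phi_term_fil | apply: phi_term0]. Qed.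

Lemma phi_eq X Y :
  (forall n (col : 'I_n -> C) E, X _ col E setT = Y _ col E setT) -> phi x X = phi x Y.
Proof.
move=> XY; apply: hsum_ext => [n|n]; first exact: phi_term_fil.
congr (_ *: _); apply: eq_bigr => col _; apply: eq_bigr => E _; by rewrite XY.
Qed.

(** The graphs whose vertices are replaced by graphs weighted by [X] on the lower
    level and by [Y] on the upper one are weighted by the convolution. *)
Lemma gmul_phi (c0 : C) X Y : gmul (phi x X) (phi x Y) = phi x (conv X Y).
Proof.
have y1 b : ev_fil 1 (pair_fun (phi x X) (phi x Y) b).
  by case: b; apply: phi_fil1.
apply/esym/hsum_eq => [n|N]; first exact: phi_term_fil.
case: N => [|N].
  rewrite big_ord0 subr0; apply: (ev_le (leq0n 1)).
  by apply: hsum_fil1 => [n|]; [apply: phi_term_fil | apply: phi_term0].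
apply: (ev_trans (y := \sum_(m < N.+1)
    mul_term (pair_fun (phi x X) (phi x Y)) m)).
  by apply: hsumP => n; apply: phi_term_fil.
apply: (ev_trans (y := \sum_(n < N.+1) phi_term x (conv X Y) n)); last first.
  rewrite subrr; exact: ev_fil_zero.
by apply: mul_phi_terms => // -[]; apply: phiP.
Qed.

Lemma phi_letter c : phi x (letter k c) = x c.
Proof.
have term1 : phi_term x (letter k c) 1 = x c.
  rewrite /phi_term factS fact0 mul1n invr1 scale1r.
  have T1 : [set: 'I_1] = [set ord0] by apply/setP=> i; rewrite !inE !ord1.
  rewrite (bigD1 [ffun=> c]) //= [X in _ + X]big1 ?addr0; last first.
    move=> col ncol; rewrite big1 // => E _; rewrite /letter_fun.
    case: andP => [[/forall_inP colc _]|]; last by rewrite scale0r.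
    by case/negP: ncol; apply/eqP/ffunP=> w; rewrite ffunE; apply/eqP/colc.
  rewrite (bigD1 set0) //= [X in _ + X]big1 ?addr0; last first.
    move=> E /set0Pn[[a b] Eab]; rewrite /letter_fun.
    case: letterP => [[_ /(_ a b)]|_]; last by rewrite scale0r.
    by rewrite Eab !inE => /(_ isT isT).
  rewrite T1 gop_unit ffunE /letter_fun.
  case: letterP => [_|[]]; first by rewrite scale1r.
  by split=> [a _|a b _ _]; rewrite ?ffunE ?inE.
rewrite /phi (@hsum_finite _ _ _ 2).
- by rewrite !big_ord_recr big_ord0 /= phi_term0 !add0r.
- move=> [|[|n]] // _; rewrite /phi_term big1 ?scaler0 // => col _; rewrite big1 // => E _.
  rewrite /= /letter_fun; case: letterP => [[_ H]|_]; last by rewrite scale0r.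
  rewrite gop_bad ?scaler0 //; apply/negP=> /good_graphP[_ _ cE _].
  suff : pred1 ord0 (ord0 : 'I_n.+2) = pred1 ord0 (ord_max : 'I_n.+2) by [].
  apply: cE; rewrite ?inE // => a b Eab.
  by have := H a b; rewrite !inE Eab => /(_ isT isT).
- by move=> n; apply: phi_term_fil.
Qed.

Lemma phi_unit : phi x (unit_char k C) = 0.
Proof.
rewrite /phi (@hsum_finite _ _ _ 0); first by rewrite big_ord0.
- move=> [|n] _; first exact: phi_term0.
  rewrite /phi_term big1 ?scaler0 // => col _; rewrite big1 // => E _.
  rewrite /= /unit_fun; case: eqP => [/setP/(_ ord0)|_]; last by rewrite scale0r.
  by rewrite !inE.
- by move=> n; apply: phi_term_fil.
Qed.

End Phi.

Lemma gmul_fil1 u v : ev_fil 1 u -> ev_fil 1 v -> ev_fil 1 (gmul u v).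
Proof. by move=> u1 v1; apply: phi_fil1 => -[]. Qed.

Definition triple_fun (T : Type) (u v w : T) (c : 'I_3) : T :=
  if c == 0%N :> nat then u else if c == 1%N :> nat then v else w.

Definition letter3 (i : nat) : character k 'I_3 := letter k (inord i : 'I_3).

Lemma gmul3 u v w : ev_fil 1 u -> ev_fil 1 v -> ev_fil 1 w ->
  gmul (gmul u v) w =
  phi (triple_fun u v w) (conv (conv (letter3 0) (letter3 1)) (letter3 2)).
Proof.
move=> u1 v1 w1; set x := triple_fun u v w.
have x1 c : ev_fil 1 (x c) by rewrite /x /triple_fun; do ?case: ifP => _.
rewrite -(gmul_phi x1 ord0) -(gmul_phi x1 ord0) /letter3 !phi_letter //.
by rewrite /x /triple_fun !inordK.
Qed.

Lemma gmulA u v w : ev_fil 1 u -> ev_fil 1 v -> ev_fil 1 w ->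
  gmul (gmul u v) w = gmul u (gmul v w).
Proof.
move=> u1 v1 w1; rewrite gmul3 //; set x := triple_fun u v w.
have x1 c : ev_fil 1 (x c) by rewrite /x /triple_fun; do ?case: ifP => _.
rewrite (phi_eq x1 (fun n col E => conv_assoc _ _ _ col E setT)).
rewrite -(gmul_phi x1 ord0) -(gmul_phi x1 ord0) /letter3 !phi_letter //.
by rewrite /x /triple_fun !inordK.
Qed.

Lemma gmulu0 u : ev_fil 1 u -> gmul u 0 = u.
Proof.
move=> u1; have x1 (c : unit) : ev_fil 1 ((fun=> u) c) by [].
rewrite -{1}(phi_letter x1 tt) -(phi_unit x1) (gmul_phi x1 tt).
rewrite (phi_eq x1 (fun n col E => conv_unit _ col E setT)); exact: phi_letter.
Qed.

Lemma gmul0u u : ev_fil 1 u -> gmul 0 u = u.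
Proof.
move=> u1; have x1 (c : unit) : ev_fil 1 ((fun=> u) c) by [].
rewrite -{1}(phi_letter x1 tt) -(phi_unit x1) (gmul_phi x1 tt).
rewrite (phi_eq x1 (fun n col E => unit_conv _ col E setT)); exact: phi_letter.
Qed.

Definition gexp_term u n : h :=
  (n`!%:R)^-1 *: \sum_(E : {set 'I_n * 'I_n}) lex k E setT *: gop setT E (fun=> u).

Definition gexp u : h := hsum (gexp_term u).

Lemma gexp_term_fil u n : ev_fil 1 u -> ev_fil n (gexp_term u n).
Proof.
move=> u1; apply: ev_scale; apply: ev_sum => E _; apply: ev_scale.
have := @gop_fil_card k h _ [set: 'I_n] E (fun=> u).
by rewrite cardsT card_ord; apply.
Qed.

Lemma gexp_term0 u : gexp_term u 0 = 0.
Proof.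
rewrite /gexp_term big1 ?scaler0 // => E _.
rewrite gop_bad ?scaler0 //; apply/negP => /good_graphP[[[]]] //.
Qed.

Lemma gexp_fil1 u : ev_fil 1 u -> ev_fil 1 (gexp u).
Proof.
by move=> u1; apply: hsum_fil1 => [n|]; [apply: gexp_term_fil | apply: gexp_term0].
Qed.

Lemma gexp_term_phi (C : finType) (x : C -> h) (c : C) (s : k) n :
  gexp_term (s *: x c) n = phi_term x (exp_char chark c s) n.
Proof.
congr (_ *: _); rewrite (bigD1 [ffun=> c]) //= [X in _ + X]big1 ?addr0; last first.
  move=> col ncol; rewrite big1 // => E _; rewrite /exp_fun.
  case: (boolP [forall a in setT, col a == c]) => [/forall_inP colc|]; last by rewrite scale0r.
  by case/negP: ncol; apply/eqP/ffunP=> w; rewrite ffunE; apply/eqP/colc.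
apply: eq_bigr => E _; rewrite /exp_fun ifT; last first.
  by apply/forall_inP=> a _; rewrite ffunE.
rewrite (gop_scale_all _ _ (fun=> s)) prodr_const mulrC -scalerA; congr (_ *: (_ *: _)).
by apply: gop_ext => w _; rewrite ffunE.
Qed.

Lemma gexp_phi (C : finType) (x : C -> h) (c : C) (s : k) :
  (forall c, ev_fil 1 (x c)) -> gexp (s *: x c) = phi x (exp_char chark c s).
Proof.
move=> x1; apply: hsum_ext => n; last exact: gexp_term_phi.
by apply: gexp_term_fil; apply: ev_scale.
Qed.

Lemma gexpD u (s t : k) : ev_fil 1 u ->
  gmul (gexp (s *: u)) (gexp (t *: u)) = gexp ((s + t) *: u).
Proof.
move=> u1; have x1 (c : unit) : ev_fil 1 ((fun=> u) c) by [].
rewrite !(gexp_phi tt _ x1) (gmul_phi x1 tt); apply: phi_eq => // n col E.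
exact: conv_exp.
Qed.

Lemma gexp0 : gexp 0 = 0.
Proof.
rewrite /gexp (@hsum_finite _ _ _ 0); first by rewrite big_ord0.
- move=> n _; rewrite /gexp_term big1 ?scaler0 // => E _.
  case: (boolP (good_graph setT E)) => [/good_graphP[[v vT] _ _ _]|bE].
    by rewrite (@gop_zero _ _ _ _ _ _ v) ?scaler0.
  by rewrite gop_bad ?scaler0.
- by move=> n; apply: gexp_term_fil; apply: ev_fil_zero.
Qed.

Lemma gexpN u : ev_fil 1 u -> gmul (gexp u) (gexp (- u)) = 0.
Proof.
move=> u1; have := @gexpD u 1 (-1) u1.
by rewrite scale1r scaleN1r subrr scale0r gexp0.
Qed.

Lemma gexpVN u : ev_fil 1 u -> gmul (gexp (- u)) (gexp u) = 0.
Proof. by move=> u1; rewrite -{2}[u]opprK gexpN //; apply: ev_opp. Qed.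

Lemma gexp_term1 u : gexp_term u 1 = u.
Proof.
rewrite /gexp_term factS fact0 mul1n invr1 scale1r.
have T1 : [set: 'I_1] = [set ord0] by apply/setP=> i; rewrite !inE !ord1.
rewrite (bigD1 set0) //= [X in _ + X]big1 ?addr0; last first.
  move=> E /set0Pn[[a b] Eab]; rewrite gop_bad ?scaler0 //; apply/negP=> gE.
  by rewrite [a]ord1 [b]ord1 in Eab; rewrite (good_loopless _ gE) in Eab.
rewrite T1 gop_unit.
have -> : lex k (set0 : {set 'I_1 * 'I_1}) [set ord0] = 1; last by rewrite scale1r.
apply: lex_cancel => //; rewrite ?cards1 // mulr1 (big_pred1 ord0).
  by rewrite setDv lex0.
by move=> v; rewrite [v]ord1 /= inE eqxx; apply/bottomP=> b _; rewrite inE.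
Qed.

Lemma gexp_close u v i : (0 < i)%N -> ev_fil 1 u -> ev_fil 1 v -> ev_fil i (u - v) ->
  ev_fil i.+1 (gexp u - gexp v - (u - v)).
Proof.
move=> i0 u1 v1 uv.
have gexpE w : ev_fil 1 w -> exists2 r, ev_fil i.+1 r &
    gexp w = w + \sum_(2 <= n < i.+1) gexp_term w n + r.
  move=> w1; exists (gexp w - \sum_(n < i.+1) gexp_term w n).
    by apply: hsumP => n; apply: gexp_term_fil.
  rewrite -(big_mkord xpredT (gexp_term w)) big_ltn // gexp_term0 add0r.
  rewrite big_ltn ?ltnS // gexp_term1.
  by rewrite addrC subrK.
have [r ri ->] := gexpE u u1; have [s si ->] := gexpE v v1.
set a := \sum_(2 <= n < _) _; set b := \sum_(2 <= n < _) _.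
have -> : u + a + r - (v + b + s) - (u - v) = (a - b) + (r - s).
  rewrite -[u + a + r]addrA -[v + b + s]addrA [- (v + _)]opprD.
  by rewrite [X in X - (u - v)]addrACA [LHS]addrC addKr [- (b + s)]opprD addrACA.
apply: ev_add; last exact: ev_sub.
rewrite /a /b -sumrB big_nat; apply: ev_sum => n /andP[n2 _].
rewrite -scalerBr; apply: ev_scale; rewrite -sumrB; apply: ev_sum => E _.
rewrite -scalerBr; apply: ev_scale.
apply: (@ev_le _ _ _ (#|[set: 'I_n]| + i).-1); last by apply: gop_congr.
rewrite cardsT card_ord; have : (i.+2 <= n + i)%N by rewrite -[i.+2]add2n leq_add2r.
by case: (n + i)%N.
Qed.

Lemma gexp_inj u v : ev_fil 1 u -> ev_fil 1 v -> gexp u = gexp v -> u = v.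
Proof.
move=> u1 v1 uv; apply: ev_eq => i; apply: (@ev_le _ _ _ i.+1) => //.
elim: i => [|i IH]; first exact: ev_sub.
have := gexp_close (ltn0Sn i) u1 v1 IH.
by rewrite uv subrr sub0r => /ev_opp; rewrite opprK.
Qed.

Lemma gexp_surj u : ev_fil 1 u -> exists2 l, ev_fil 1 l & gexp l = u.
Proof.
move=> u1.
pose f l := l + (u - gexp l); pose ls n := iter n f 0.
have ls1 n : ev_fil 1 (ls n).
  elim: n => [|n IH]; first exact: ev_fil_zero.
  by apply: ev_add => //; apply: ev_sub => //; apply: gexp_fil1.
have lsu n : ev_fil n.+1 (u - gexp (ls n)).
  elim: n => [|n IH]; first by apply: ev_sub => //; apply: gexp_fil1.
  have d : ls n.+1 - ls n = u - gexp (ls n) by rewrite /ls /= /f addrAC subrr add0r.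
  have := gexp_close (ltn0Sn n) (ls1 n.+1) (ls1 n); rewrite d => /(_ IH).
  rewrite opprB addrA subrK => /ev_opp.
  by rewrite opprB.
have [|n|l _ lP] := @ev_complete k h ls.
- by move=> n; apply: (@ev_le _ _ _ 1).
- have -> : ls n.+1 - ls n = u - gexp (ls n) by rewrite /ls /= /f addrAC subrr add0r.
  by apply: ev_fil_decr.
have l1 : ev_fil 1 l by rewrite -[l](subrK (ls 1)); apply: ev_add.
exists l => //; apply: ev_eq => n; apply: (@ev_le _ _ _ n.+1) => //.
have ln : ev_fil n.+1 (l - ls n.+1) by apply: lP.
have H := gexp_close (ltn0Sn n) l1 (ls1 n.+1) ln.
apply: (@ev_trans _ _ _ _ (gexp (ls n.+1))); last first.
  by apply: ev_sym; apply: ev_fil_decr.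
by rewrite -[X in ev_fil _ X](subrK (l - ls n.+1)); apply: ev_add => //; apply: ev_fil_decr.
Qed.

Lemma phi_term_linear (C : finType) (x : C -> h) (X Y : character k C) :
  phi_term x (conv X Y) 1 = phi_term x X 1 + phi_term x Y 1.
Proof.
rewrite /phi_term -scalerDr -big_split /=; congr (_ *: _).
apply: eq_bigr => col _; rewrite -big_split /=; apply: eq_bigr => E _.
rewrite -scalerDl.
have T1 : [set: 'I_1] = [set ord0] by apply/setP=> i; rewrite !inE !ord1.
case: (boolP (good_graph setT E)) => gE; last by rewrite gop_bad // !scaler0.
congr (_ *: _); rewrite /conv_fun (bigD1 setT) /=; last first.
  by apply/lowerP; split=> // a b _ _; rewrite inE.
rewrite setDv chi_0 mulr1 (big_pred1 set0); first by rewrite setD0 chi_0 mul1r.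
move=> B; apply/andP/eqP => [[_ nB]|->].
  apply/setP=> i; rewrite [i]ord1 in_set0; apply: contraNF nB => B0.
  by apply/eqP/setP=> j; rewrite [j]ord1 B0 inE.
split; last by rewrite eq_sym T1; apply/set0Pn; exists ord0; rewrite inE.
by apply/lowerP; split=> [|a b]; rewrite ?sub0set // inE.
Qed.

Lemma gmul_nest a b x b' a' : ev_fil 1 a -> ev_fil 1 b -> ev_fil 1 x ->
    ev_fil 1 b' -> ev_fil 1 a' ->
  gmul (gmul a (gmul (gmul b x) b')) a' = gmul (gmul (gmul a b) x) (gmul b' a').
Proof. by move=> a1 b1 x1 b1' a1'; rewrite !gmulA //; do ?apply: gmul_fil1. Qed.

Lemma gmul_insert t1 t2 v2 v1 u1 : ev_fil 1 t1 -> ev_fil 1 t2 -> ev_fil 1 v2 ->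
    ev_fil 1 v1 -> ev_fil 1 u1 -> gmul v1 u1 = 0 ->
  gmul (gmul t1 t2) (gmul v2 v1) = gmul (gmul t1 v1) (gmul (gmul u1 (gmul t2 v2)) v1).
Proof.
move=> t1f t2f v2f v1f u1f vu.
have E : gmul v1 (gmul (gmul u1 (gmul t2 v2)) v1) = gmul t2 (gmul v2 v1).
  have q1 : ev_fil 1 (gmul t2 v2) by apply: gmul_fil1.
  rewrite -(@gmulA v1 (gmul u1 _)) //; last exact: gmul_fil1.
  by rewrite -(@gmulA v1 u1) // vu gmul0u // gmulA.
rewrite (@gmulA t1 v1) // ?E.
  by apply: gmulA => //; apply: gmul_fil1.
by do !apply: gmul_fil1 => //.
Qed.

End GaugeGroup.

(** * Conjugation and its cocycle *)

Section Extension.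
Variables (k : fieldType) (g : completeLieGraph k).
Hypothesis chark : [pchar k] =i pred0.
Notation h := (extension g).

Definition emb (x : g) : h := (x, 0).
Definition eps (a : g) : h := (0, a).
Definition theta (x : g) : h := (x, dg_d g x).

Lemma emb_fil1 x : fil 1 0 x -> ev_fil 1 (emb x).
Proof. by move=> x1; split=> //; apply: fil_zero. Qed.

Lemma eps_fil1 a : dg_gr (-1) a -> ev_fil 1 (eps a).
Proof. by move=> a0; split; [apply: fil_zero | apply/fil_0]. Qed.

Lemma fil_d' i (x : g) : fil i 0 x -> fil i (-1) (dg_d g x).
Proof. by move=> /fil_d; rewrite sub0r. Qed.

Lemma theta_fil1 x : fil 1 0 x -> ev_fil 1 (theta x).
Proof. by move=> x1; split=> //=; apply: fil_le (fil_d' x1). Qed.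

Lemma ev_fil1_gr (X : h) : ev_fil 1 X -> fil 1 0 X.1 /\ dg_gr (-1) X.2.
Proof. by case=> X1 /fil_gr. Qed.

Lemma fst_sum (I : Type) (s : seq I) (P : pred I) (F : I -> h) :
  (\sum_(i <- s | P i) F i).1 = \sum_(i <- s | P i) (F i).1.
Proof. by elim/big_rec2: _ => // i a b _ <-. Qed.

Lemma snd_sum (I : Type) (s : seq I) (P : pred I) (F : I -> h) :
  (\sum_(i <- s | P i) F i).2 = \sum_(i <- s | P i) (F i).2.
Proof. by elim/big_rec2: _ => // i a b _ <-. Qed.

Lemma fil_eq e (x y : g) : (forall N, fil N e (x - y)) -> x = y.
Proof. by move/fil_separated/eqP; rewrite subr_eq0 => /eqP. Qed.

Lemma fil_trans i e (x y z : g) : fil i e (x - y) -> fil i e (y - z) -> fil i e (x - z).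
Proof. by move=> /fil_add/[apply]; rewrite addrA subrK. Qed.

Lemma sums_to_fst t (Y : h) N : sums_to t Y -> fil N 0 (Y.1 - \sum_(n < N) (t n).1).
Proof. by move=> /(_ N)[+ _]; rewrite /= fst_sum. Qed.

Lemma sums_to_snd t (Y : h) N :
  sums_to t Y -> fil N (-1) (Y.2 - \sum_(n < N.+1) (t n).2).
Proof. by move=> /(_ N.+1)[_ +]; rewrite /= snd_sum. Qed.

Section Phi.
Variables (C : finType) (x y : C -> h) (X : character k C).
Hypothesis x1 : forall c, ev_fil 1 (x c).

Lemma phi_term_fst n : (phi_term x X n).1 = (n`!%:R)^-1 *:
  \sum_(col : {ffun 'I_n -> C}) \sum_(E : {set 'I_n * 'I_n})
    X _ col E setT *: gopg setT E (fun w => (x (col w)).1).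
Proof.
rewrite /phi_term /= fst_sum; congr (_ *: _); apply: eq_bigr => col _.
by rewrite fst_sum.
Qed.

Lemma phi_term_snd n : (phi_term x X n).2 = (n`!%:R)^-1 *:
  \sum_(col : {ffun 'I_n -> C}) \sum_(E : {set 'I_n * 'I_n})
    X _ col E setT *: \sum_u gopg setT E (upd (fun w => (x (col w)).1) u (x (col u)).2).
Proof.
rewrite /phi_term /= snd_sum; congr (_ *: _); apply: eq_bigr => col _.
rewrite snd_sum; apply: eq_bigr => E _; congr (_ *: _).
by apply: eq_bigl => u; rewrite inE.
Qed.

Lemma phi_emb : (forall c, (x c).2 = 0) -> (phi x X).2 = 0.
Proof.
move=> x0; apply: (@fil_eq (-1)) => N.
have := sums_to_snd N (phiP x1 X); rewrite big1 // => n _.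
rewrite phi_term_snd big1 ?scaler0 // => col _; rewrite big1 // => E _.
by rewrite big1 ?scaler0 // => u _; rewrite (@gopg0 _ _ _ _ _ _ u) // /upd eqxx.
Qed.

Lemma phi_theta : (forall c, (x c).2 = dg_d g (x c).1) ->
  (phi x X).2 = dg_d g (phi x X).1.
Proof.
move=> xd; apply: (@fil_eq (-1)) => N.
apply: fil_trans (sums_to_snd N (phiP x1 X)) _.
have := fil_d' (sums_to_fst N.+1 (phiP x1 X)); rewrite linearB linear_sum.
move=> /fil_opp; rewrite opprB => /fil_decr; congr (fil _ _ (_ - _)).
apply: eq_bigr => n _; rewrite phi_term_fst phi_term_snd linearZ linear_sum.
congr (_ *: _); apply: eq_bigr => col _; rewrite linear_sum.
apply: eq_bigr => E _; rewrite linearZ; congr (_ *: _).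
rewrite gopg_d => [|w]; last by have [/fil_gr] := ev_fil1_gr (x1 (col w)).
by apply: eq_big => [u|u _]; rewrite ?inE // xd.
Qed.

Lemma phi_fst : (forall c, ev_fil 1 (y c)) -> (forall c, (x c).1 = (y c).1) ->
  (phi x X).1 = (phi y X).1.
Proof.
move=> y1 xy; apply: (@fil_eq 0) => N.
have := fil_opp (sums_to_fst N (phiP y1 X)); rewrite opprB.
apply: fil_trans; have := sums_to_fst N (phiP x1 X); congr (fil _ _ (_ - _)).
apply: eq_bigr => n _; rewrite /phi_term /= !fst_sum; congr (_ *: _).
apply: eq_bigr => col _; rewrite !fst_sum; apply: eq_bigr => E _; congr (_ *: _).
by apply: gopg_ext => w _; rewrite xy.
Qed.

End Phi.

Lemma gexp_phi1 (u : h) : ev_fil 1 u -> gexp u = phi (fun _ : unit => u) (exp_char chark tt 1).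
Proof. by move=> u1; rewrite -(gexp_phi chark (x := fun=> u)) ?scale1r. Qed.

Lemma pair_fil1 (u v : h) b : ev_fil 1 u -> ev_fil 1 v -> ev_fil 1 (pair_fun u v b).
Proof. by case: b. Qed.

Lemma gexp_emb l : fil 1 0 l -> gexp (emb l) = emb (gexp (emb l)).1.
Proof.
move=> l1; rewrite [LHS]surjective_pairing; congr (_, _).
have el := emb_fil1 l1; by rewrite gexp_phi1 // phi_emb.
Qed.

Lemma gexp_theta l : fil 1 0 l -> gexp (theta l) = theta (gexp (emb l)).1.
Proof.
move=> l1; have el := emb_fil1 l1; have tl := theta_fil1 l1.
have E : (phi (fun _ : unit => theta l) (exp_char chark tt 1)).1
  = (phi (fun _ : unit => emb l) (exp_char chark tt 1)).1 by apply: phi_fst.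
have D := @phi_theta unit (fun=> theta l) (exp_char chark tt 1) (fun=> tl) (fun=> erefl).
rewrite (gexp_phi1 el) -E (gexp_phi1 tl) [LHS]surjective_pairing /theta; congr (_, _); exact: D.
Qed.

Lemma gmul_emb u v : fil 1 0 u -> fil 1 0 v ->
  gmul (emb u) (emb v) = emb (gmul (emb u) (emb v)).1.
Proof.
move=> u1 v1; rewrite [LHS]surjective_pairing; congr (_, _).
by apply: phi_emb => -[] //=; apply: emb_fil1.
Qed.

Lemma gmul_fst (u v u' v' : h) : ev_fil 1 u -> ev_fil 1 v -> ev_fil 1 u' -> ev_fil 1 v' ->
  u.1 = u'.1 -> v.1 = v'.1 -> (gmul u v).1 = (gmul u' v').1.
Proof. by move=> u1 v1 u1' v1' uu vv; apply: phi_fst => -[]. Qed.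

Lemma gmul_theta u v : fil 1 0 u -> fil 1 0 v ->
  gmul (theta u) (theta v) = theta (gmul (emb u) (emb v)).1.
Proof.
move=> u1 v1; have tu := theta_fil1 u1; have tv := theta_fil1 v1.
have eu := emb_fil1 u1; have ev := emb_fil1 v1.
have E : (gmul (theta u) (theta v)).1 = (gmul (emb u) (emb v)).1.
  exact: (gmul_fst tu tv eu ev erefl erefl).
rewrite -E [LHS]surjective_pairing /theta; congr (_, _).
by apply: phi_theta => -[].
Qed.

(** Products of at least two elements [eps a] vanish. *)
Lemma phi_term_eps (C : finType) (x : C -> h) (X : character k C) n :
  (forall c, (x c).1 = 0) -> (1 < n)%N -> phi_term x X n = 0.
Proof.
move=> x0 n1; rewrite /phi_term big1 ?scaler0 // => col _; rewrite big1 // => E _.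
have other (u : 'I_n) : exists2 w, w \in [set: 'I_n] & w != u.
  have : (0 < #|[set: 'I_n] :\ u|)%N.
    by have := cardsD1 u [set: 'I_n]; rewrite cardsT card_ord inE; case: #|_| n1 => // + E1; rewrite E1.
  by rewrite card_gt0 => /set0Pn[w /setD1P[nw _]]; exists w.
have [w _ _] := other (Ordinal (ltnW n1)).
rewrite [X in _ *: X](_ : _ = 0) ?scaler0 //; congr (_, _).
  by apply: (@gopg0 _ _ _ _ _ _ w); rewrite ?inE.
apply: big1 => u _; have [v vT nv] := other u.
by apply: (@gopg0 _ _ _ _ _ _ v); rewrite // /upd (negPf nv).
Qed.

Lemma gmul_eps a b : dg_gr (-1) a -> dg_gr (-1) b -> gmul (eps a) (eps b) = eps (a + b).
Proof.
move=> a0 b0; set x := pair_fun (eps a) (eps b).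
have x1 c : ev_fil 1 (x c) by case: c; apply: eps_fil1.
have xE c : (x c).1 = 0 by case: c.
have phi1 X : phi x X = phi_term x X 1.
  rewrite /phi (@hsum_finite _ _ _ 2).
  - by rewrite !big_ord_recr big_ord0 /= phi_term0 !add0r.
  - by move=> n; apply: phi_term_eps.
  - by move=> n; apply: phi_term_fil.
rewrite /gmul -/x phi1 phi_term_linear // -!phi1 !phi_letter //.
by congr (_, _); rewrite /= addr0.
Qed.

End Extension.

Section PolynomialCoefficients.
Variables (k : fieldType) (V : lmodType k) (F : V -> Prop).
Hypothesis chark : [pchar k] =i pred0.
Hypothesis F0 : F 0.
Hypothesis FP : forall (c : k) x y, F x -> F y -> F (c *: x + y).

(** A polynomial function with values in a subspace has its coefficients in it,
    by inverting a Vandermonde matrix. *)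
Lemma coefficients_in (P : nat -> V) N :
  (forall s : k, F (\sum_(i < N) s ^+ i *: P i)) -> forall i, (i < N)%N -> F (P i).
Proof.
move=> FP' i ltiN.
pose a : 'rV[k]_N := \row_j j%:R; pose M := Vandermonde N a.
have uM : M \in unitmx.
  rewrite unitmxE det_Vandermonde unitfE; apply/prodf_neq0 => u _; apply/prodf_neq0 => v ltuv.
  rewrite !mxE -natrB ?(ltnW ltuv) //; apply: natf_neq0 => //; by rewrite subn_gt0.
have -> : P i = \sum_(j < N) invmx M j (Ordinal ltiN) *: \sum_(i' < N) (j%:R : k) ^+ i' *: P i'.
  under eq_bigr => j _ do rewrite scaler_sumr.
  rewrite exchange_big /= (bigD1 (Ordinal ltiN)) //= [X in _ + X]big1 ?addr0.
    have := congr1 (fun A : 'M_N => A (Ordinal ltiN) (Ordinal ltiN)) (mulmxV uM).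
    rewrite !mxE eqxx /= => E; rewrite -{1}[P i]scale1r -[1 in LHS]E scaler_suml.
    by apply: eq_bigr => j _; rewrite scalerA !mxE mulrC.
  move=> i' ni'.
  have := congr1 (fun A : 'M_N => A i' (Ordinal ltiN)) (mulmxV uM).
  rewrite !mxE (negPf ni') /= => E; rewrite -[RHS](scale0r (P i')) -[0 in RHS]E scaler_suml.
  by apply: eq_bigr => j _; rewrite scalerA !mxE mulrC.
elim/big_rec: _ => [|j x _ Fx]; first exact: F0.
exact: FP.
Qed.

End PolynomialCoefficients.

Section Conjugation.
Local Opaque gmul gexp.
Variables (k : fieldType) (g : completeLieGraph k).
Hypothesis chark : [pchar k] =i pred0.
Notation h := (extension g).
Implicit Types (l a b : g) (s t : k).

Definition gauge_exp l : h := gexp (emb l).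
Definition theta_exp l : h := gexp (theta l).
Definition conj_eps l b : h := gmul (gmul (gauge_exp l) (eps b)) (gauge_exp (- l)).
Definition conj l b : g := (conj_eps l b).2.
Definition cocycle l : g := (gmul (theta_exp l) (gauge_exp (- l))).2.

Lemma embN l : emb (- l) = - emb l.
Proof. by congr (_, _); rewrite /= oppr0. Qed.

Lemma embZ s l : emb (s *: l) = s *: emb l.
Proof. by congr (_, _); rewrite /= scaler0. Qed.

Lemma thetaN l : theta (- l) = - theta l.
Proof. by congr (_, _); rewrite /= linearN. Qed.

Lemma thetaZ s l : theta (s *: l) = s *: theta l.
Proof. by congr (_, _); rewrite /= linearZ. Qed.

Lemma gauge_exp1 l : fil 1 0 l -> ev_fil 1 (gauge_exp l).
Proof. by move=> l1; apply: gexp_fil1; apply: emb_fil1. Qed.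

Lemma theta_exp1 l : fil 1 0 l -> ev_fil 1 (theta_exp l).
Proof. by move=> l1; apply: gexp_fil1; apply: theta_fil1. Qed.

Lemma gauge_expN l : fil 1 0 l -> gmul (gauge_exp l) (gauge_exp (- l)) = 0.
Proof. by move=> l1; rewrite /gauge_exp embN gexpN //; apply: emb_fil1. Qed.

Lemma gauge_expVN l : fil 1 0 l -> gmul (gauge_exp (- l)) (gauge_exp l) = 0.
Proof. by move=> l1; rewrite /gauge_exp embN gexpVN //; apply: emb_fil1. Qed.

Lemma theta_expN l : fil 1 0 l -> gmul (theta_exp l) (theta_exp (- l)) = 0.
Proof. by move=> l1; rewrite /theta_exp thetaN gexpN //; apply: theta_fil1. Qed.

Lemma theta_expVN l : fil 1 0 l -> gmul (theta_exp (- l)) (theta_exp l) = 0.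
Proof. by move=> l1; rewrite /theta_exp thetaN gexpVN //; apply: theta_fil1. Qed.

Lemma gauge_expD l s t : fil 1 0 l ->
  gmul (gauge_exp (s *: l)) (gauge_exp (t *: l)) = gauge_exp ((s + t) *: l).
Proof. by move=> l1; rewrite /gauge_exp !embZ gexpD //; apply: emb_fil1. Qed.

Lemma theta_expD l s t : fil 1 0 l ->
  gmul (theta_exp (s *: l)) (theta_exp (t *: l)) = theta_exp ((s + t) *: l).
Proof. by move=> l1; rewrite /theta_exp !thetaZ gexpD //; apply: theta_fil1. Qed.

Lemma theta_expE l : fil 1 0 l -> theta_exp l = theta (gauge_exp l).1.
Proof. exact: gexp_theta. Qed.

Lemma gauge_expE l : fil 1 0 l -> gauge_exp l = emb (gauge_exp l).1.
Proof. exact: gexp_emb. Qed.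

(** Every product with a first component 0 is infinitesimal. *)
Lemma epsE (X : h) : X.1 = 0 -> X = eps X.2.
Proof. by case: X => x a /= ->. Qed.

Lemma conj_gmul_fil1 l b : fil 1 0 l -> dg_gr (-1) b -> ev_fil 1 (conj_eps l b).
Proof.
move=> l1 b0; apply: gmul_fil1; last by apply/gauge_exp1/fil_opp.
by apply: gmul_fil1; [apply: gauge_exp1 | apply: eps_fil1].
Qed.

Lemma conj_gr l b : fil 1 0 l -> dg_gr (-1) b -> dg_gr (-1) (conj l b).
Proof. by move=> l1 b0; have [_] := ev_fil1_gr (conj_gmul_fil1 l1 b0). Qed.

Lemma conjE l b : fil 1 0 l -> dg_gr (-1) b -> conj_eps l b = eps (conj l b).
Proof.
move=> l1 b0; apply: epsE; have U1 := gauge_exp1 l1; have V1 := gauge_exp1 (fil_opp l1).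
have e1 := eps_fil1 b0; have z1 : ev_fil 1 (0 : h) by apply: ev_fil_zero.
have Ue : ev_fil 1 (gmul (gauge_exp l) (eps b)) by apply: gmul_fil1.
have U0 : ev_fil 1 (gmul (gauge_exp l) 0) by apply: gmul_fil1.
have -> : (conj_eps l b).1 = (gmul (gmul (gauge_exp l) 0) (gauge_exp (- l))).1.
  have E1 : (gmul (gauge_exp l) (eps b)).1 = (gmul (gauge_exp l) 0).1.
    exact: (gmul_fst U1 e1 U1 z1 erefl erefl).
  exact: (gmul_fst Ue V1 U0 V1 E1 erefl).
by rewrite gmulu0 // gauge_expN.
Qed.

Lemma cocycle_gmul_fil1 l : fil 1 0 l -> ev_fil 1 (gmul (theta_exp l) (gauge_exp (- l))).
Proof. by move=> l1; apply: gmul_fil1; [apply: theta_exp1 | apply/gauge_exp1/fil_opp]. Qed.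

Lemma cocycle_gr l : fil 1 0 l -> dg_gr (-1) (cocycle l).
Proof. by move=> l1; have [_] := ev_fil1_gr (cocycle_gmul_fil1 l1). Qed.

Lemma cocycleE l : fil 1 0 l -> gmul (theta_exp l) (gauge_exp (- l)) = eps (cocycle l).
Proof.
move=> l1; apply: epsE; have V1 := gauge_exp1 (fil_opp l1).
have T1 := theta_exp1 l1; have U1 := gauge_exp1 l1.
have -> : (gmul (theta_exp l) (gauge_exp (- l))).1 = (gmul (gauge_exp l) (gauge_exp (- l))).1.
  have E1 : (theta_exp l).1 = (gauge_exp l).1 by rewrite theta_expE.
  exact: (gmul_fst T1 V1 U1 V1 E1 erefl).
by rewrite gauge_expN.
Qed.

Lemma conjD l s t b : fil 1 0 l -> dg_gr (-1) b ->
  conj (s *: l) (conj (t *: l) b) = conj ((s + t) *: l) b.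
Proof.
move=> l1 b0; have sl := fil_scale s l1; have tl := fil_scale t l1.
have stl := fil_scale (s + t) l1.
have Us := gauge_exp1 sl; have Ut := gauge_exp1 tl.
have Vs := gauge_exp1 (fil_opp sl); have Vt := gauge_exp1 (fil_opp tl).
have e1 := eps_fil1 b0.
suff E : conj_eps (s *: l) (conj (t *: l) b) = conj_eps ((s + t) *: l) b.
  exact: (congr1 (fun X : h => X.2) E).
rewrite /conj_eps -(conjE tl b0) /conj_eps -(gauge_expD _ _ l1).
have -> : - ((s + t) *: l) = (- t - s) *: l by rewrite -opprD scaleNr addrC.
by rewrite -(gauge_expD (- t) (- s) l1) !scaleNr; apply: gmul_nest.
Qed.

Lemma cocycleD l s t : fil 1 0 l ->
  cocycle ((s + t) *: l) = cocycle (s *: l) + conj (s *: l) (cocycle (t *: l)).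
Proof.
move=> l1; have sl := fil_scale s l1; have tl := fil_scale t l1.
have stl := fil_scale (s + t) l1.
have Us := gauge_exp1 sl; have Ut := gauge_exp1 tl.
have Vs := gauge_exp1 (fil_opp sl); have Vt := gauge_exp1 (fil_opp tl).
have Ts := theta_exp1 sl; have Tt := theta_exp1 tl.
have ct := cocycle_gr tl; have cct := conj_gr sl ct; have cs := cocycle_gr sl.
suff : gmul (theta_exp ((s + t) *: l)) (gauge_exp (- ((s + t) *: l)))
       = eps (cocycle (s *: l) + conj (s *: l) (cocycle (t *: l))).
  exact: (congr1 (fun X : h => X.2)).
have -> : eps (cocycle (s *: l) + conj (s *: l) (cocycle (t *: l)))
   = gmul (gmul (theta_exp (s *: l)) (gauge_exp (- (s *: l))))
          (conj_eps (s *: l) (cocycle (t *: l))).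
  apply: etrans (esym (gmul_eps cs cct)) _.
  exact: (congr2 (fun X Y : h => gmul X Y) (esym (cocycleE sl)) (esym (conjE sl ct))).
rewrite /conj_eps -(cocycleE tl).
have -> : - ((s + t) *: l) = (- t - s) *: l by rewrite -opprD scaleNr addrC.
rewrite -(gauge_expD (- t) (- s) l1) -(theta_expD _ _ l1) !scaleNr.
exact: (gmul_insert chark Ts Tt Vt Vs Us (gauge_expVN sl)).
Qed.

End Conjugation.

Section Expansion.
Variables (k : fieldType) (g : completeLieGraph k).
Hypothesis chark : [pchar k] =i pred0.
Local Opaque gmul gexp.
Notation h := (extension g).
Implicit Types (l a b : g) (s t : k).

Section Homogeneity.
Variables (C : finType) (D : pred C) (t : k).

Definition homogeneous (X X' : character k C) := forall (W : finType) (col : W -> C) E A,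
  X' W col E A = t ^+ #|[set w in A | D (col w)]| * X W col E A.

Lemma homogeneous_conv X X' Y Y' :
  homogeneous X X' -> homogeneous Y Y' -> homogeneous (conv X Y) (conv X' Y').
Proof.
move=> hX hY W col E A; rewrite /= /conv_fun mulr_sumr.
apply: eq_bigr => B /lowerP[sBA _]; rewrite hX hY mulrACA -exprD; congr (_ ^+ _ * _).
rewrite -cardsUI [X in (_ + X)%N]eq_card0 ?addn0.
  apply: eq_card => w; rewrite !inE -andb_orl; congr (_ && _).
  by case: (boolP (w \in B)) => [/(subsetP sBA) ->|].
by move=> w; rewrite !inE; case: (w \in B); rewrite ?andbF.
Qed.

Lemma homogeneous_letter c : ~~ D c -> homogeneous (letter k c) (letter k c).
Proof.
move=> Dc W col E A; rewrite /= /letter_fun; case: letterP => [[cA _]|_]; last by rewrite mulr0.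
rewrite [X in _ ^+ X]eq_card0 ?expr0 ?mul1r // => w; rewrite !inE.
by apply/negP=> /andP[/cA ->]; rewrite (negPf Dc).
Qed.

Lemma homogeneous_exp c s : D c ->
  homogeneous (exp_char chark c s) (exp_char chark c (t * s)).
Proof.
move=> Dc W col E A; rewrite /= /exp_fun; case: ifP => [/forall_inP cA|_]; last by rewrite mulr0.
rewrite exprMn mulrA; congr (_ ^+ _ * _ * _); apply: eq_card => w; rewrite !inE.
by case Aw: (w \in A) => //=; rewrite (eqP (cA _ Aw)) Dc.
Qed.

End Homogeneity.

Definition conj_letters l b : bool -> h := pair_fun (emb l) (eps b).

Definition conj_char t : character k bool :=
  conv (conv (exp_char chark false t) (letter k true)) (exp_char chark false (- t)).

Definition conj_coef l b n : g := (phi_term (conj_letters l b) (conj_char 1) n.+1).2.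

Definition cocycle_letters l : bool -> h := pair_fun (theta l) (emb l).

Definition cocycle_char t : character k bool :=
  conv (exp_char chark false t) (exp_char chark true (- t)).

Definition cocycle_coef l n : g := (phi_term (cocycle_letters l) (cocycle_char 1) n).2.

Lemma conj_letters1 l b : fil 1 0 l -> dg_gr (-1) b ->
  forall c, ev_fil 1 (conj_letters l b c).
Proof. by move=> l1 b0 c; apply: pair_fil1; [apply: emb_fil1 | apply: eps_fil1]. Qed.

Lemma cocycle_letters1 l : fil 1 0 l -> forall c, ev_fil 1 (cocycle_letters l c).
Proof. by move=> l1 c; apply: pair_fil1; [apply: theta_fil1 | apply: emb_fil1]. Qed.

Lemma conj_eps_phi l b t : fil 1 0 l -> dg_gr (-1) b ->
  conj_eps (t *: l) b = phi (conj_letters l b) (conj_char t).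
Proof.
move=> l1 b0; have x1 := conj_letters1 l1 b0.
rewrite /conj_eps /conj_char -(gmul_phi chark x1 true) -(gmul_phi chark x1 true).
have -> : phi (conj_letters l b) (letter k true) = eps b := phi_letter x1 true.
have expE s : phi (conj_letters l b) (exp_char chark false s) = gauge_exp (s *: l).
  by rewrite /gauge_exp embZ; apply/esym; apply: (gexp_phi chark false s x1).
by rewrite !expE scaleNr.
Qed.

Lemma cocycle_phi l t : fil 1 0 l ->
  cocycle (t *: l) = (phi (cocycle_letters l) (cocycle_char t)).2.
Proof.
move=> l1; have x1 := cocycle_letters1 l1.
suff E : gmul (theta_exp (t *: l)) (gauge_exp (- (t *: l)))
         = phi (cocycle_letters l) (cocycle_char t).
  exact: (congr1 (fun X : h => X.2) E).
rewrite /cocycle_char -(gmul_phi chark x1 true).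
have -> : phi (cocycle_letters l) (exp_char chark false t) = theta_exp (t *: l).
  by rewrite /theta_exp thetaZ; apply/esym; apply: (gexp_phi chark false t x1).
have -> : phi (cocycle_letters l) (exp_char chark true (- t)) = gauge_exp (- t *: l).
  by rewrite /gauge_exp embZ; apply/esym; apply: (gexp_phi chark true (- t) x1).
by rewrite scaleNr.
Qed.

(** A product of letters [emb l] and [eps b] has a second component only if
    [eps b] occurs exactly once. *)
Lemma eps_once l b n (col : 'I_n -> bool) E :
  #|[set w | col w]| != 1%N ->
  \sum_u gopg setT E (upd (fun w => (conj_letters l b (col w)).1) u
                          (conj_letters l b (col u)).2) = 0.
Proof.
move=> n1; apply: big1 => u _.
case: (boolP (col u)) => cu; last first.
  apply: (@gopg0 _ _ _ _ _ _ u); first by rewrite inE.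
  by rewrite /upd eqxx.
have /existsP[w /andP[cw nw]] : [exists w, col w && (w != u)].
  apply: contraNT n1 => /existsPn H; rewrite -(cards1 u); apply/eqP/eq_card => w.
  rewrite !inE; case: eqVneq => [->|nw]; first by rewrite cu.
  by have := H w; rewrite nw andbT => /negPf.
apply: (@gopg0 _ _ _ _ _ _ w); first by rewrite inE.
by rewrite /upd (negPf nw) /conj_letters /pair_fun cw.
Qed.

Lemma conj_term l b t n :
  (phi_term (conj_letters l b) (conj_char t) n.+1).2 = t ^+ n *: conj_coef l b n.
Proof.
have hX : homogeneous negb t (conj_char 1) (conj_char t).
  apply: homogeneous_conv; first apply: homogeneous_conv.
  - by have := @homogeneous_exp bool negb t false 1 isT; rewrite mulr1.
  - exact: homogeneous_letter.
  - by have := @homogeneous_exp bool negb t false (-1) isT; rewrite mulrN1.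
rewrite /conj_coef !phi_term_snd scalerA mulrC -scalerA; congr (_ *: _).
rewrite scaler_sumr; apply: eq_bigr => col _; rewrite scaler_sumr; apply: eq_bigr => E _.
rewrite hX; case: (eqVneq #|[set w | col w]| 1%N) => [c1|nc1]; last first.
  by rewrite eps_once // !scaler0.
rewrite -scalerA; congr (_ ^+ _ *: _).
have := cardsC [set w | col w]; rewrite c1 card_ord add1n => -[En].
by rewrite -[RHS]En; apply: eq_card => w; rewrite !inE.
Qed.

Lemma cocycle_term l t n :
  (phi_term (cocycle_letters l) (cocycle_char t) n).2 = t ^+ n *: cocycle_coef l n.
Proof.
have hX : homogeneous predT t (cocycle_char 1) (cocycle_char t).
  apply: homogeneous_conv.
    by have := @homogeneous_exp bool predT t false 1 isT; rewrite mulr1.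
  by have := @homogeneous_exp bool predT t true (-1) isT; rewrite mulrN1.
rewrite /cocycle_coef !phi_term_snd scalerA mulrC -scalerA; congr (_ *: _).
rewrite scaler_sumr; apply: eq_bigr => col _; rewrite scaler_sumr; apply: eq_bigr => E _.
rewrite hX -scalerA; congr (_ ^+ _ *: _).
by rewrite -[RHS]card_ord -cardsT; apply: eq_card => w; rewrite !inE.
Qed.

Lemma conj_expansion l b t N : fil 1 0 l -> dg_gr (-1) b ->
  fil N (-1) (conj (t *: l) b - \sum_(n < N) t ^+ n *: conj_coef l b n).
Proof.
move=> l1 b0; have x1 := conj_letters1 l1 b0.
have := sums_to_snd N (phiP x1 (conj_char t)).
rewrite -(conj_eps_phi t l1 b0) big_ord_recl phi_term0 add0r; congr (fil _ _ (_ - _)).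
by apply: eq_bigr => n _; apply: conj_term.
Qed.

Lemma cocycle_expansion l t N : fil 1 0 l ->
  fil N (-1) (cocycle (t *: l) - \sum_(n < N.+1) t ^+ n *: cocycle_coef l n).
Proof.
move=> l1; have x1 := cocycle_letters1 l1.
have := sums_to_snd N (phiP x1 (cocycle_char t)).
rewrite -(cocycle_phi t l1); congr (fil _ _ (_ - _)).
by apply: eq_bigr => n _; apply: cocycle_term.
Qed.

Lemma conj_coef_fil l b n : fil 1 0 l -> dg_gr (-1) b -> fil n (-1) (conj_coef l b n).
Proof.
move=> l1 b0.
by have [_] := phi_term_fil (conj_char 1) n.+1 (conj_letters1 l1 b0).
Qed.

Lemma cocycle_coef_fil l n : fil 1 0 l -> fil n.-1 (-1) (cocycle_coef l n).
Proof.
by move=> l1; have [_] := phi_term_fil (cocycle_char 1) n (cocycle_letters1 l1).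
Qed.

End Expansion.

Section FirstCoefficients.
Variables (k : fieldType) (g : completeLieGraph k).
Hypothesis chark : [pchar k] =i pred0.
Local Opaque gmul gexp.
Notation h := (extension g).
Implicit Types (l a b : g) (s t : k).

Lemma conj0 b : dg_gr (-1) b -> conj 0 b = b.
Proof.
move=> b0; have e1 := eps_fil1 b0.
suff E : conj_eps 0 b = eps b by apply: (congr1 (fun X : h => X.2) E).
have U0 : gauge_exp (0 : g) = 0 by rewrite /gauge_exp [emb 0](_ : _ = 0) // gexp0.
by rewrite /conj_eps oppr0 U0 gmul0u // gmulu0.
Qed.

Lemma conj_coef0 l b : fil 1 0 l -> dg_gr (-1) b -> conj_coef chark l b 0 = b.
Proof.
move=> l1 b0; apply/esym/(@fil_eq _ _ (-1)) => N; apply: (@fil_le _ _ _ N.+1) => //.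
have := conj_expansion chark 0 N.+1 l1 b0; rewrite scale0r conj0 //.
rewrite big_ord_recl expr0 scale1r big1 ?addr0 // => i _.
by rewrite expr0n scale0r.
Qed.

Lemma cocycle_coef0 l : cocycle_coef chark l 0 = 0.
Proof. by rewrite /cocycle_coef phi_term0. Qed.

Lemma phi_exp_term1 (C : finType) (x : C -> h) c s : (forall c, ev_fil 1 (x c)) ->
  phi_term x (exp_char chark c s) 1 = s *: x c.
Proof.
by move=> x1; rewrite -gexp_term_phi gexp_term1.
Qed.

Lemma cocycle_coef1 l : fil 1 0 l -> cocycle_coef chark l 1 = dg_d g l.
Proof.
move=> l1; have x1 := cocycle_letters1 l1.
rewrite /cocycle_coef /cocycle_char phi_term_linear !phi_exp_term1 //.
by rewrite /= scale1r scaler0 addr0.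
Qed.

(** * Two-vertex graphs *)

Definition edge2 (u v : 'I_2) : {set 'I_2 * 'I_2} := [set (u, v)].

Lemma ord2_cases (u w : 'I_2) (P : 'I_2 -> Prop) : u != w -> P u -> P w -> forall v, P v.
Proof.
move=> uw Pu Pw v.
have : v = u \/ v = w.
  case: u uw {Pu} => [[|[|//]] lu]; case: w {Pw} => [[|[|//]] lw] // _;
    case: v => [[|[|//]] lv]; (by left; apply: val_inj) || (by right; apply: val_inj).
by case=> ->.
Qed.

Lemma good_edge2 E (u w : 'I_2) : u != w -> good_graph setT E ->
  (E == edge2 u w) || (E == edge2 w u).
Proof.
move=> uw gE; have /good_graphP[_ _ cE [ht htE]] := gE.
have irr := good_loopless _ gE.
have edge (a b : 'I_2) : (a, b) \in E -> E = edge2 a b.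
  move=> Eab; have ab : a != b by apply: contraTneq Eab => ->; rewrite irr.
  have nba : (b, a) \notin E.
    by apply/negP=> /htE; apply/negP; rewrite -leqNgt ltnW // htE.
  apply/setP=> -[c d]; rewrite !inE xpair_eqE.
  move: c d; apply: (ord2_cases ab) => d; move: d; apply: (ord2_cases ab);
    rewrite ?irr ?Eab ?(negPf nba) ?eqxx ?(negPf ab) ?[b == a]eq_sym ?(negPf ab) //.
case: (boolP ((u, w) \in E)) => [/edge -> |nuw]; first by rewrite eqxx.
case: (boolP ((w, u) \in E)) => [/edge -> |nwu]; first by rewrite eqxx orbT.
suff : pred1 u u = pred1 u w by rewrite /= eqxx eq_sym (negPf uw).
apply: cE; rewrite ?inE // => a b; move: a b.
apply: (ord2_cases uw) => b; move: b; apply: (ord2_cases uw); rewrite ?irr //.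
  by rewrite (negPf nuw).
by rewrite (negPf nwu).
Qed.

Lemma gopg_edge2 (u w : 'I_2) (y : 'I_2 -> g) : u != w -> signless y ->
  gopg setT (edge2 u w) y = star (y w) (y u).
Proof.
move=> uw sy.
pose f (i : 'I_2) := if i == ord0 then w else u.
have inj_f : injective f.
  move=> i j; rewrite /f; move: i j.
  have o : (ord0 : 'I_2) != ord_max by [].
  apply: (ord2_cases o) => j; move: j; apply: (ord2_cases o) => //= E;
    by rewrite E eqxx in uw.
have fT : f @: setT = setT.
  apply/setP=> i; rewrite inE; apply/imsetP; move: i.
  apply: (ord2_cases uw); [by exists ord_max | by exists ord0].
rewrite -fT gopgE //; last by apply/subsetP=> e; rewrite fT !inE.
have -> : pullback f (edge2 u w) = edges star_graph.
  apply/setP=> -[i j]; rewrite pullbackE !inE !xpair_eqE.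
  have o : (ord0 : 'I_2) != ord_max by [].
  move: i j; apply: (ord2_cases o) => j; move: j; apply: (ord2_cases o);
    by rewrite /f /= ?eqxx ?[w == u]eq_sym ?(negPf uw) ?andbF.
rewrite opE_edges; congr dg_op; apply/ffunP=> i; rewrite !ffunE /f.
by case: (i == ord0).
Qed.

Lemma lex_set1 (W : finType) (E : {set W * W}) u : (u, u) \notin E -> lex k E [set u] = 1.
Proof.
move=> nu; apply: lex_cancel => //; rewrite cards1 // mulr1 (big_pred1 u).
  by rewrite setDv lex0.
move=> v; rewrite inE andb_idr // => /eqP ->.
by apply/bottomP=> b; rewrite inE => /eqP ->.
Qed.

(** With one letter [eps b] at [v], the other letter may be put below or above
    it, with a sign in the second case. *)
Lemma conj_char2 (u v : 'I_2) (col : 'I_2 -> bool) (E : {set 'I_2 * 'I_2}) : u != v ->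
    ~~ col u -> col v -> (u, u) \notin E -> (v, v) \notin E ->
  conj_char chark 1 _ col E setT = ((u, v) \notin E)%:R - ((v, u) \notin E)%:R.
Proof.
move=> uv cu cv Eu Ev.
have vu : v != u by rewrite eq_sym.
have expu c s : exp_fun c s col E [set u] = (c == false)%:R * s.
  rewrite /exp_fun cards1 expr1 lex_set1 // mulr1.
  have -> : [forall a in [set u], col a == c] = (c == false).
    apply/forall_inP/eqP => [/(_ u)|-> a]; rewrite inE ?eqxx.
      by move=> /(_ isT); rewrite (negPf cu) => /eqP <-.
    by move/eqP ->; rewrite (negPf cu).
  by case: eqP; rewrite ?mul1r ?mul0r.
have expv (A : {set 'I_2}) s : v \in A -> exp_fun false s col E A = 0.
  by move=> Av; rewrite /exp_fun ifF //; apply/negP=> /forall_inP/(_ v Av); rewrite cv.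
have letv : letter_fun k true col E [set v] = 1.
  rewrite /letter_fun; case: letterP => // -[]; split=> [a|a b]; rewrite !inE.
    by move/eqP->.
  by move=> /eqP -> /eqP ->.
have letu (A : {set 'I_2}) : u \in A -> letter_fun k true col E A = 0.
  by move=> Au; rewrite /letter_fun; case: letterP => // -[/(_ u Au)]; rewrite (negPf cu).
have T2 : [set: 'I_2] = [set u; v].
  by apply/setP=> w; rewrite !inE; apply/esym; move: w; apply: (ord2_cases uv); rewrite eqxx ?orbT.
have low (a b : 'I_2) : a != b -> (forall w, w = a \/ w = b) -> lower E setT [set a] = ((a, b) \notin E).
  move=> ab cases; apply/lowerP/idP => [[_ H]|nab].
    by apply: H; rewrite !inE // eq_sym.
  split=> [|c d]; rewrite ?subsetT // !inE => /eqP -> _ nda.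
  by case: (cases d) nda => ->; rewrite ?eqxx.
have casesuv w : w = u \/ w = v by move: w; apply: (ord2_cases uv); [left|right].
have casesvu w : w = v \/ w = u by case: (casesuv w); [right|left].
have lowT : lower E setT setT by apply/lowerP; split=> // a b _ _; rewrite inE.
have sT (a : 'I_2) : [set a] != setT :> {set 'I_2}.
  apply/eqP=> /(congr1 (fun A : {set 'I_2} => #|A|)).
  by rewrite cards1 cardsT card_ord.
have Dv : [set: 'I_2] :\ v = [set u].
  by rewrite T2 setUC setU1K // inE eq_sym.
have Du : [set: 'I_2] :\ u = [set v] by rewrite T2 setU1K // inE.
have inner_v : conv_fun (exp_char chark false 1) (letter k true) col E [set v] = 1.
  rewrite /conv_fun (bigD1 set0) /=; last first.
    by apply/lowerP; split=> [|a b]; rewrite ?sub0set // in_set0.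
  rewrite setD0 letv mulr1 exp_0 big1 ?addr0 // => B /andP[/lowerP[sB _] nB0].
  rewrite /= expv ?mul0r //; case/set0Pn: nB0 => w Bw.
  by have := subsetP sB w Bw; rewrite inE => /eqP <-.
have inner_T : conv_fun (exp_char chark false 1) (letter k true) col E setT = ((u, v) \notin E)%:R.
  rewrite /conv_fun (bigID (pred1 [set u])) /= [X in _ + X]big1 ?addr0; last first.
    move=> B /andP[_ nBu]; case Bv : (v \in B); first by rewrite expv ?mul0r.
    rewrite letu ?mulr0 // !inE andbT; apply: contra nBu => Bu; apply/eqP/setP=> w.
    by move: w; apply: (ord2_cases uv); rewrite !inE ?Bu ?Bv ?eqxx ?(negPf vu).
  rewrite big_andbC big_mkcondr big_pred1_eq (low u v) // Du letv expu mulr1.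
  by case: ((u, v) \in E); rewrite /= ?mulr1 ?eqxx.
rewrite /conj_char [LHS]/= {1}/conv_fun.
rewrite (bigD1 setT) //= setDv exp_0 mulr1 inner_T; congr (_ + _).
rewrite (bigID (pred1 [set v])) /= [X in _ + X]big1 ?addr0; last first.
  move=> B /andP[/andP[_ nBT] nBv]; case Bv : (v \in B); last first.
    by rewrite expv ?mulr0 // !inE Bv.
  case Bu : (u \in B).
    case/negP: nBT; apply/eqP/setP=> w; move: w; apply: (ord2_cases uv); by rewrite inE ?Bu ?Bv.
  case/negP: nBv; apply/eqP/setP=> w; move: w; apply: (ord2_cases uv);
    by rewrite !inE ?Bu ?Bv ?eqxx ?(negPf uv).
rewrite (eq_bigl (fun B : {set 'I_2} => (B == [set v]) && ((v, u) \notin E))); last first.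
  move=> B; case: (eqVneq B [set v]) => [->|]; last by rewrite andbF.
  by rewrite (low v u) // (sT v) andbT andbT.
rewrite big_mkcondr big_pred1_eq Dv expu.
by case: ((v, u) \in E); rewrite /= ?oppr0 // inner_v !mul1r.
Qed.

Lemma bracketE l b : bracket 0 (-1) l b = star l b - star b l.
Proof. by rewrite /bracket mul0r expr0z scale1r. Qed.

Lemma conj_coef1 l b : fil 1 0 l -> dg_gr (-1) b ->
  conj_coef chark l b 1 = bracket 0 (-1) l b.
Proof.
move=> l1 b0; rewrite /conj_coef phi_term_snd bracketE.
pose colv (v : 'I_2) : {ffun 'I_2 -> bool} := [ffun w => w == v].
have o : (ord0 : 'I_2) != ord_max by [].
have o' : (ord_max : 'I_2) != ord0 by [].
have colT (col : {ffun 'I_2 -> bool}) : col != colv ord0 -> col != colv ord_max ->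
    #|[set w | col w]| != 1%N.
  move=> n0 nm; apply/negP => /cards1P[v Ev].
  have colE : col = colv v.
    by apply/ffunP=> w; rewrite ffunE -in_set1 -Ev inE.
  move: v Ev colE n0 nm; apply: (ord2_cases o) => _ ->; by rewrite ?eqxx.
have term (u v : 'I_2) : u != v ->
    \sum_E conj_char chark 1 _ (colv v) E setT *: \sum_u0
      gopg setT E (upd (fun w => (conj_letters l b (colv v w)).1) u0
                       (conj_letters l b (colv v u0)).2) = star l b - star b l.
  move=> uv; have vu : v != u by rewrite eq_sym.
  have cvu : colv v u = false by rewrite ffunE (negPf uv).
  have cvv : colv v v by rewrite ffunE eqxx.
  pose y w := if w == v then b else l.
  have sy : signless y.
    exists (fun w => if w == v then -1 else 0); split=> [w|w w' ne].
      by rewrite /y; case: ifP => // _; apply: fil_gr l1.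
    move: w w' ne; apply: (ord2_cases uv) => w'; move: w'; apply: (ord2_cases uv) => // _;
      by rewrite ?(negPf uv) ?mul0r ?mulr0.
  have innerE E : \sum_u0 gopg setT E (upd (fun w => (conj_letters l b (colv v w)).1) u0
                       (conj_letters l b (colv v u0)).2) = gopg setT E y.
    rewrite (bigD1 v) //= [X in _ + X]big1 ?addr0 => [|u0 nu0].
      apply: gopg_ext => w _; rewrite /upd cvv /y; case: (eqVneq w v) => // nwv.
      by rewrite ffunE (negPf nwv).
    apply: (@gopg0 _ _ _ _ _ _ u0); first by rewrite inE.
    by rewrite /upd eqxx ffunE (negPf nu0).
  pose F E := conj_char chark 1 _ (colv v) E setT *: gopg setT E y.
  rewrite (eq_bigr F) => [|E _]; last by rewrite innerE.
  rewrite (bigD1 (edge2 v u)) //= (bigD1 (edge2 u v)) /=; last first.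
    by apply/eqP=> /setP/(_ (u, v)); rewrite !inE !xpair_eqE !eqxx (negPf uv).
  rewrite big1 ?addr0 => [|E /andP[n1 n2]]; last first.
    rewrite /F gopg_bad ?scaler0 //; apply/negP=> /(good_edge2 uv).
    by rewrite (negPf n1) (negPf n2).
  rewrite /F !gopg_edge2 // !(@conj_char2 u v) ?cvu // ?inE ?xpair_eqE ?eqxx ?(negPf uv) ?(negPf vu) ?andbF //.
  by rewrite /y eqxx (negPf uv) subr0 sub0r scale1r scaleN1r.
pose T (col : {ffun 'I_2 -> bool}) := \sum_E conj_char chark 1 _ col E setT *: \sum_u0
      gopg setT E (upd (fun w => (conj_letters l b (col w)).1) u0
                       (conj_letters l b (col u0)).2).
rewrite (eq_bigr T) //.
rewrite (bigD1 (colv ord0)) //= (bigD1 (colv ord_max)) /=; last first.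
  by apply/eqP=> /ffunP/(_ ord0); rewrite !ffunE.
rewrite [X in _ + (_ + X)]big1 ?addr0; last first.
  move=> col /andP[n0 nm]; rewrite /T big1 // => E _.
  by rewrite eps_once ?scaler0 // colT.
rewrite /T (term ord_max ord0) // (term ord0 ord_max) // -mulr2n -scaler_nat scalerA.
by rewrite mulVf ?scale1r // natf_neq0.
Qed.

End FirstCoefficients.

(** * The classical gauge action as a conjugation *)

Section Star.
Variables (k : fieldType) (g : dgLieGraph k).
Implicit Types (x y z : g) (c : k).

Let pairf x y : {ffun 'I_2 -> g} := [ffun v => if v == ord0 then x else y].

Lemma subst_star0 x y u : subst_at (pairf x y) ord0 u = pairf u y.
Proof. by apply/ffunP=> v; rewrite !ffunE; case: eqP. Qed.

Lemma subst_star1 x y u : subst_at (pairf x y) ord_max u = pairf x u.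
Proof.
apply/ffunP=> v; rewrite !ffunE; move: v.
by have o : (ord0 : 'I_2) != ord_max by []; apply: (ord2_cases o).
Qed.

Lemma star_linl x y z c : star (c *: x + y) z = c *: star x z + star y z.
Proof.
rewrite /star -!/(pairf _ _) -(subst_star0 0 z (c *: x + y)) dg_op_multilinear.
by rewrite !subst_star0.
Qed.

Lemma star_linr x y z c : star x (c *: y + z) = c *: star x y + star x z.
Proof.
rewrite /star -!/(pairf _ _) -(subst_star1 x 0 (c *: y + z)) dg_op_multilinear.
by rewrite !subst_star1.
Qed.

Lemma starDl x y z : star (x + y) z = star x z + star y z.
Proof. by rewrite -[x in LHS]scale1r star_linl scale1r. Qed.

Lemma starDr x y z : star x (y + z) = star x y + star x z.
Proof. by rewrite -[y in LHS]scale1r star_linr scale1r. Qed.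

Lemma star0l x : star 0 x = 0.
Proof. by have := star_linl 0 0 x (-1); rewrite scaler0 addr0 scaleN1r addNr. Qed.

Lemma star0r x : star x 0 = 0.
Proof. by have := star_linr x 0 0 (-1); rewrite scaler0 addr0 scaleN1r addNr. Qed.

Lemma starZl x y c : star (c *: x) y = c *: star x y.
Proof. by rewrite -[c *: x]addr0 star_linl star0l addr0. Qed.

Lemma starZr x y c : star x (c *: y) = c *: star x y.
Proof. by rewrite -[c *: y]addr0 star_linr star0r addr0. Qed.

Lemma starNl x y : star (- x) y = - star x y.
Proof. by rewrite -!scaleN1r starZl. Qed.

Lemma starNr x y : star x (- y) = - star x y.
Proof. by rewrite -!scaleN1r starZr. Qed.

Lemma star_suml (I : Type) (s : seq I) (P : pred I) (F : I -> g) y :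
  star (\sum_(i <- s | P i) F i) y = \sum_(i <- s | P i) star (F i) y.
Proof.
by elim/big_rec2: _ => [|i u v _ <-]; rewrite ?star0l ?starDl.
Qed.

Lemma star_sumr (I : Type) (s : seq I) (P : pred I) (F : I -> g) y :
  star y (\sum_(i <- s | P i) F i) = \sum_(i <- s | P i) star y (F i).
Proof.
by elim/big_rec2: _ => [|i u v _ <-]; rewrite ?star0r ?starDr.
Qed.

Lemma star_gr e f x y : dg_gr e x -> dg_gr f y -> dg_gr (e + f) (star x y).
Proof.
move=> xe yf; have := @dg_op_gr k g 2 star_graph (fun v => if v == ord0 then e else f)
  (pairf x y).
rewrite !big_ord_recl big_ord0 addr0; apply=> v; by rewrite ffunE; case: ifP.
Qed.

Lemma star_d e x y : dg_gr e x -> (exists f, dg_gr f y) ->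
  dg_d g (star x y) = star (dg_d g x) y + (-1) ^ e *: star x (dg_d g y).
Proof.
move=> xe [f yf]; rewrite /star -!/(pairf _ _).
rewrite (@dg_op_derivation k g 2 star_graph (fun v => if v == ord0 then e else f)); last first.
  by move=> v; rewrite ffunE; case: ifP.
rewrite !big_ord_recl big_ord0 addr0 /= big_pred0 ?expr0z ?scale1r; last by move=> v; rewrite ltn0.
rewrite (_ : lift ord0 ord0 = ord_max); last exact: val_inj.
rewrite subst_star0 subst_star1 !ffunE /=; congr (_ + _ ^ _ *: _).
by rewrite (big_pred1 ord0) // => v; case: v => [[|[|]]].
Qed.

End Star.

Section Ode.
Variables (k : fieldType) (g : completeLieGraph k).
Hypothesis chark : [pchar k] =i pred0.
Local Opaque gmul gexp.
Implicit Types (l a b x y : g) (s t : k).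

Lemma star_fil i j e f x y : fil i e x -> fil j f y -> fil (i + j) (e + f) (star x y).
Proof.
move=> xe yf; have := @fil_op k g 2 star_graph (fun v => if v == ord0 then i else j)
  (fun v => if v == ord0 then e else f) [ffun v => if v == ord0 then x else y].
rewrite !big_ord_recl !big_ord0 addr0 addn0; apply=> v; by rewrite ffunE; case: ifP.
Qed.

Definition ad l x := bracket 0 (-1) l x.

Lemma adE l x : ad l x = star l x - star x l.
Proof. exact: bracketE. Qed.

Lemma ad_lin l (c : k) x y : ad l (c *: x + y) = c *: ad l x + ad l y.
Proof.
by rewrite !adE star_linl star_linr scalerBr opprD !addrA; congr (_ - _); rewrite addrAC.
Qed.

Lemma adD l x y : ad l (x + y) = ad l x + ad l y.
Proof. by rewrite -[x in LHS]scale1r ad_lin scale1r. Qed.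

Lemma ad0 l : ad l 0 = 0.
Proof. by rewrite adE star0l star0r subrr. Qed.

Lemma adZ l c x : ad l (c *: x) = c *: ad l x.
Proof. by rewrite -[c *: x]addr0 ad_lin ad0 addr0. Qed.

Lemma adB l x y : ad l (x - y) = ad l x - ad l y.
Proof. by rewrite -[- y]scaleN1r adD adZ scaleN1r. Qed.

Lemma ad_sum l (I : Type) (s : seq I) (P : pred I) (F : I -> g) :
  ad l (\sum_(i <- s | P i) F i) = \sum_(i <- s | P i) ad l (F i).
Proof. by elim/big_rec2: _ => [|i u v _ <-]; rewrite ?ad0 ?adD. Qed.

Lemma ad_fil l i x : fil 1 0 l -> fil i (-1) x -> fil i.+1 (-1) (ad l x).
Proof.
move=> l1 xi; rewrite adE; have := star_fil l1 xi; have := star_fil xi l1.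
by rewrite addr0 add0r addn1 add1n => H1 H2; apply: fil_sub.
Qed.

(** Comparing the coefficients of [s t^j] in [f (s + t) = r s + conj_s (f t)]. *)
Lemma coefficient_recursion l (a rho : nat -> g) (f r : k -> g) :
    fil 1 0 l -> (forall t, dg_gr (-1) (f t)) -> (forall n, fil n.-1 (-1) (a n)) ->
    (forall t N, fil N (-1) (f t - \sum_(n < N.+1) t ^+ n *: a n)) ->
    (forall s N, fil N (-1) (r s - \sum_(n < N.+1) s ^+ n *: rho n)) ->
    (forall s t, f (s + t) = r s + conj (s *: l) (f t)) ->
  forall j, (j.+1)%:R *: a j.+1 = ad l (a j) + (if j == 0%N then rho 1%N else 0).
Proof.
move=> l1 f0 aF fa rr fD j; apply: (@fil_eq _ _ (-1)) => N0.
pose N := (maxn N0 j).+1; have le_N0N : (N0 <= N)%N by rewrite leqW // leq_maxl.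
have ltjN : (j < N)%N by rewrite ltnS leq_maxr.
apply: (fil_le le_N0N).
pose R t i := \sum_(n < N.+1) ('C(n, i)%:R * t ^+ (n - i)) *: a n.
have powE s t (n : 'I_N.+1) :
    (s + t) ^+ n = \sum_(i < N.+1) s ^+ i * ('C(n, i)%:R * t ^+ (n - i)).
  rewrite addrC exprDn.
  rewrite -(big_mkord xpredT (fun i => t ^+ (n - i) * s ^+ i *+ 'C(n, i))).
  rewrite -(big_mkord xpredT (fun i => s ^+ i * ('C(n, i)%:R * t ^+ (n - i)))).
  rewrite [RHS](big_cat_nat (leq0n n.+1)) ?ltn_ord //= [X in _ + X]big_nat.
  rewrite [X in _ + X]big1 ?addr0; last first.
    by move=> i /andP[lt_ni _]; rewrite bin_small // mul0r mulr0.
  by apply: eq_bigr => i _; rewrite mulrC -mulrnAr mulr_natl.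
have expand s t : fil N (-1) (\sum_(i < N.+1) s ^+ i *:
    (rho i + conj_coef chark l (f t) i - R t i)).
  have H1 := fil_opp (fa (s + t) N); have H2 := rr s N.
  have H3 := fil_decr (conj_expansion chark s N.+1 l1 (f0 t)).
  have := fil_opp (fil_add H1 (fil_add H2 H3)); congr (fil _ _ _).
  rewrite [RHS](eq_bigr (fun i : 'I_N.+1 => s ^+ i *: rho i + s ^+ i *: conj_coef chark l (f t) i
       - s ^+ i *: R t i)); last by move=> i _; rewrite scalerBr scalerDr.
  rewrite [RHS]sumrB big_split /=.
  have -> : \sum_(i < N.+1) s ^+ i *: R t i = \sum_(n < N.+1) (s + t) ^+ n *: a n.
    under eq_bigr => i _ do rewrite /R scaler_sumr.
    rewrite exchange_big /=; apply: eq_bigr => n _; rewrite powE scaler_suml.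
    by apply: eq_bigr => i _; rewrite scalerA.
  by rewrite fD [X in - (_ + X)]addrACA -opprD opprB addrA subrK opprB.
have first t : fil N (-1) (rho 1%N + ad l (f t) - R t 1%N).
  have := @coefficients_in k g (fil N (-1)) chark (fil_zero g N (-1)) (@filP k g N (-1))
    (fun i => rho i + conj_coef chark l (f t) i - R t i) N.+1 (fun s => expand s t) 1 isT.
  by rewrite conj_coef1.
pose Q j := (if j == 0%N then rho 1%N else 0) + ad l (a j) - (j.+1)%:R *: a j.+1.
suff /(_ ltjN) : (j < N)%N -> fil N (-1) (Q j).
  by move/fil_opp; congr (fil _ _ _); rewrite /Q opprB addrC [_ + ad _ _]addrC addrC.
apply: (@coefficients_in k g (fil N (-1)) chark (fil_zero g N (-1)) (@filP k g N (-1)) Q N).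
move=> t; have H1 := first t; have H2 := fil_decr (ad_fil l1 (fa t N)).
have := fil_sub H1 H2; rewrite adB ad_sum big_ord_recr /=.
rewrite /R big_ord_recl bin0n mul0r scale0r add0r => H3.
have H4 : fil N (-1) (ad l (t ^+ N *: a N)).
  by rewrite adZ; apply: fil_scale; have := aF N; rewrite /N; apply: ad_fil.
have alg (p F X Y Z : g) : p + F - X - (F - (Y + Z)) - Z = p + Y - X.
  rewrite opprB [p + F - X]addrAC -[p - X + F + _]addrA [F + _]addrC subrK addrA addrK.
  by rewrite addrAC.
have := fil_add H3 (fil_opp H4); rewrite alg; congr (fil _ _ _).
rewrite [RHS](eq_bigr (fun i : 'I_N => (if i == 0%N :> nat then rho 1%N else 0)
    + ad l (t ^+ i *: a i) - ('C(i.+1, 1)%:R * t ^+ i) *: a i.+1)).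
  rewrite [RHS]sumrB [in X in _ = X - _]big_split /=; congr (_ + _ - _).
    by rewrite big_ord_recl /= big1 ?addr0.
  by apply: eq_bigr => i _; rewrite /bump /= add1n subn1.
move=> i _; rewrite /Q scalerBr scalerDr adZ bin1 scalerA [t ^+ i * _]mulrC.
congr (_ + _ - _); case: eqP => [->|_]; first by rewrite expr0 scale1r.
by rewrite scaler0.
Qed.

Lemma iter_ad_fil l x n : fil 1 0 l -> dg_gr (-1) x -> fil n (-1) (iter n (ad l) x).
Proof. by move=> l1 x0; elim: n => [|n IH] /=; [apply/fil_0 | apply: ad_fil]. Qed.

Lemma conj_coefE l b n : fil 1 0 l -> dg_gr (-1) b ->
  conj_coef chark l b n = (n`!%:R)^-1 *: iter n (ad l) b.
Proof.
move=> l1 b0; elim: n => [|n IH]; first by rewrite conj_coef0 // fact0 invr1 scale1r.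
have rec := @coefficient_recursion l (conj_coef chark l b) (fun=> 0)
  (fun t => conj (t *: l) b) (fun=> 0) l1.
have : (n.+1)%:R *: conj_coef chark l b n.+1 = ad l (conj_coef chark l b n).
  rewrite rec ?if_same ?addr0 //.
  - by move=> t; apply: conj_gr => //; apply: fil_scale.
  - by move=> m; apply: fil_le (conj_coef_fil chark m l1 b0); apply: leq_pred.
  - by move=> t N; apply: fil_decr; apply: conj_expansion.
  - move=> s N; rewrite big1 ?subr0; first exact: fil_zero.
    by move=> i _; rewrite scaler0.
  - by move=> s t; rewrite add0r conjD.
rewrite IH adZ iterS => E.
have n0 := natf_neq0 chark (ltn0Sn n).
by apply: (scalerI n0); rewrite E scalerA factS natrM invfM mulrA mulfV // mul1r.
Qed.

Lemma cocycle_coefE l n : fil 1 0 l ->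
  cocycle_coef chark l n.+1 = (n.+1`!%:R)^-1 *: iter n (ad l) (dg_d g l).
Proof.
move=> l1; elim: n => [|n IH]; first by rewrite cocycle_coef1 // factS fact0 invr1 scale1r.
have rec := @coefficient_recursion l (cocycle_coef chark l) (cocycle_coef chark l)
  (fun t => cocycle (t *: l)) (fun t => cocycle (t *: l)) l1.
have : (n.+2)%:R *: cocycle_coef chark l n.+2 = ad l (cocycle_coef chark l n.+1).
  rewrite rec ?addr0 //.
  - by move=> t; apply: cocycle_gr; apply: fil_scale.
  - by move=> m; apply: cocycle_coef_fil.
  - by move=> t N; apply: cocycle_expansion.
  - by move=> t N; apply: cocycle_expansion.
  - by move=> s t; apply: cocycleD.
rewrite IH adZ iterS => E.
have n0 := natf_neq0 chark (ltn0Sn n.+1).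
by apply: (scalerI n0); rewrite E scalerA (factS n.+1) natrM invfM mulrA mulfV // mul1r.
Qed.

Lemma converges_uniq e u x y : converges e u x -> converges e u y -> x = y :> g.
Proof.
move=> [_ ux] [_ uy]; apply: (@fil_eq _ _ e) => i.
have [N1 H1] := ux i; have [N2 H2] := uy i.
have := fil_sub (H2 _ (leq_maxr N1 N2)) (H1 _ (leq_maxl N1 N2)).
by rewrite opprB addrC addrA subrK.
Qed.

Lemma series_eq e (t : nat -> g) x : converges e (fun N => \sum_(n < N) t n) x -> series e t = x.
Proof.
move=> tx; apply: converges_uniq (tx); apply: epsilon_spec; by exists x.
Qed.

Lemma series_shift e (t : nat -> g) x d : dg_gr e x ->
  (forall N, fil N e (x - \sum_(n < N + d) t n)) -> series e t = x.
Proof.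
move=> x0 tx; apply: series_eq; split=> // i; exists (i + d)%N => n le_n.
have le_dn : (d <= n)%N by apply: leq_trans le_n; apply: leq_addl.
have := fil_opp (tx (n - d)%N); rewrite subnK // opprB; apply: fil_le.
by rewrite leq_subRL // addnC.
Qed.

Lemma exp_adE l b : fil 1 0 l -> dg_gr (-1) b -> exp_ad l b = conj l b.
Proof.
move=> l1 b0; apply: (@series_shift _ _ _ 0); first exact: conj_gr.
move=> N; have := conj_expansion chark 1 N l1 b0; rewrite scale1r addn0.
congr (fil _ _ (_ - _)); apply: eq_bigr => n _.
by rewrite expr1n scale1r conj_coefE.
Qed.

Lemma exp_ad_quotE l : fil 1 0 l -> exp_ad_quot l (dg_d g l) = - cocycle l.
Proof.
move=> l1; apply: (@series_shift _ _ _ 0).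
  by rewrite -scaleN1r -[_ *: _]addr0; apply: dg_grP; [apply: cocycle_gr | apply: dg_gr0].
move=> N; have := fil_opp (cocycle_expansion chark 1 N l1); rewrite scale1r addn0.
rewrite big_ord_recl cocycle_coef0 scaler0 add0r opprD; congr (fil _ _ (_ - _)).
rewrite -sumrN; apply: eq_bigr => n _.
by rewrite expr1n scale1r cocycle_coefE // scaleNr.
Qed.

Lemma classical_gaugeE l a : fil 1 0 l -> dg_gr (-1) a ->
  classical_gauge l a = conj l a - cocycle l.
Proof. by move=> l1 a0; rewrite /classical_gauge exp_adE // exp_ad_quotE. Qed.

End Ode.

(** * Sums over isomorphism classes *)

Section OrbitSums.
Variables (k : fieldType) (V : lmodType k) (n : nat) (T : finType).
Hypothesis chark : [pchar k] =i pred0.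
Variable iso : 'S_n -> T -> T -> bool.
Hypothesis iso1 : forall L, iso 1%g L L.
Hypothesis isoM : forall s t L M N, iso s L M -> iso t M N -> iso (s * t)%g L N.
Hypothesis isoV : forall s L M, iso s L M -> iso (s^-1)%g M L.
Hypothesis iso_ex : forall s L, exists M, iso s L M.
Hypothesis iso_uniq : forall s L M M', iso s L M -> iso s L M' -> M = M'.

Let R L M := [exists s, iso s L M].

Lemma iso_equiv (D : {set T}) : {in D & &, equivalence_rel R}.
Proof.
move=> L M N _ _ _; split; first by apply/existsP; exists 1%g.
move=> /existsP[s LM]; apply/existsP/existsP => -[t tN].
  by exists (s^-1 * t)%g; apply: isoM tN; apply: isoV.
by exists (s * t)%g; apply: isoM tN.
Qed.

Lemma card_iso_class L : (#|[set M | R L M]| * #|[set s | iso s L L]| = n`!)%N.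
Proof.
rewrite -(card_Sn n) -[RHS]sum1_card.
have exM s : {M | iso s L M} by apply: sigW; apply: iso_ex.
rewrite (partition_big (fun s => sval (exM s)) (R L)) /=; last first.
  by move=> s _; apply/existsP; exists s; apply: (svalP (exM s)).
rewrite -sum_nat_const; rewrite [LHS](eq_bigl (R L)); last by move=> M; rewrite inE.
apply: eq_bigr => M /existsP[s0 LM].
rewrite sum1_card -[LHS](card_imset _ (@mulIg _ s0)); apply: eq_card => s.
rewrite -[RHS]/(sval (exM s) == M).
have -> : (sval (exM s) == M) = iso s L M.
  apply/eqP/idP => [<-|]; first exact: (svalP (exM s)).
  by apply: iso_uniq; apply: (svalP (exM s)).
apply/imsetP/idP => [[t + ->]|LsM]; first by rewrite inE => /isoM; apply.
exists (s * s0^-1)%g; last by rewrite mulgKV.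
by rewrite inE; apply: isoM LsM _; apply: isoV.
Qed.

(** Orbit counting: a sum over one representative of each class, divided by the
    orders of the automorphism groups, is a sum over all labelled objects. *)
Lemma orbit_sum (D : {set T}) (w : T -> V) :
    (forall s L M, iso s L M -> L \in D -> M \in D) ->
    (forall s L M, iso s L M -> L \in D -> w L = w M) ->
  \sum_(L in transversal (equivalence_partition R D) D) (#|[set s | iso s L L]|%:R)^-1 *: w L
  = (n`!%:R)^-1 *: \sum_(L in D) w L.
Proof.
move=> isoD isow; set P := equivalence_partition R D.
have partP : partition P D by apply: equivalence_partitionP; apply: iso_equiv.
have trX := transversalP partP; move: (transversal P D) trX => X trX.
have sXD : {subset X <= D} by apply/subsetP; have := transversal_sub trX.
have -> : \sum_(L in D) w L = \sum_(B in P) \sum_(L in B) w L.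
  have [_ tP _] := and3P partP.
  by rewrite -[RHS](big_trivIset _ tP) (cover_partition partP).
rewrite -(pblock_transversal trX) big_imset /=; last exact: pblock_inj trX.
rewrite scaler_sumr; apply: eq_bigr => L XL; have DL := sXD _ XL.
have pbE M : (M \in pblock P L) = R L M.
  case DM: (M \in D); first by rewrite pblock_equivalence_partition //; apply: iso_equiv.
  apply/idP/existsP => [pM|[s LM]]; last by rewrite (isoD _ _ _ LM DL) in DM.
  have : M \in cover P by apply/bigcupP; exists (pblock P L); rewrite ?pblock_mem ?(cover_partition partP).
  by rewrite (cover_partition partP) DM.
rewrite (eq_bigr (fun _ => w L)) => [|M]; last by rewrite pbE => /existsP[s /isow->].
rewrite sumr_const -scaler_nat scalerA; congr (_ *: _).
have := card_iso_class L; have -> : #|[set M | R L M]| = #|pblock P L|.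
  by apply: eq_card => M; rewrite inE pbE.
set a := #|pblock P L|; set b := #|_| => ab.
have n0 := fact_neq0 chark n; rewrite -ab natrM in n0 *.
move: n0; rewrite mulf_eq0 negb_or => /andP[a0 b0].
by rewrite invfM mulrAC mulVf ?mul1r.
Qed.

End OrbitSums.

Section GraphClasses.
Variables (k : fieldType).
Hypothesis chark : [pchar k] =i pred0.

Lemma graph_isoP n (s : 'S_n) (G H : dsgraph n) :
  reflect (edges H = pushforward s (edges G)) (graph_iso s G H).
Proof.
apply: (iffP idP) => [isoGH|HG].
  apply/setP=> -[a b]; apply/idP/imsetP => [Hab|[[u v] Guv [-> ->]]].
    exists ((s^-1)%g a, (s^-1)%g b); last by rewrite !permKV.
    have /forallP/(_ ((s^-1)%g b))/eqP <- := forallP isoGH ((s^-1)%g a).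
    by rewrite !permKV.
  by have /forallP/(_ v)/eqP -> := forallP isoGH u.
apply/forallP=> a; apply/forallP=> b; apply/eqP; rewrite HG.
by rewrite -pullbackE pullback_push //; apply: perm_inj.
Qed.

Lemma graph_iso1 n (G : dsgraph n) : graph_iso 1%g G G.
Proof. by apply/forallP=> a; apply/forallP=> b; rewrite !perm1. Qed.

Lemma graph_isoM n s t (G H K : dsgraph n) :
  graph_iso s G H -> graph_iso t H K -> graph_iso (s * t)%g G K.
Proof.
move=> GH HK; apply/forallP=> a; apply/forallP=> b; rewrite !permM.
have /forallP/(_ (s b))/eqP -> := forallP HK (s a).
exact: (forallP (forallP GH a) b).
Qed.

Lemma graph_isoV n s (G H : dsgraph n) : graph_iso s G H -> graph_iso (s^-1)%g H G.
Proof.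
move=> GH; apply/forallP=> a; apply/forallP=> b.
have /forallP/(_ ((s^-1)%g b))/eqP <- := forallP GH ((s^-1)%g a).
by rewrite !permKV.
Qed.

Lemma perm_setT n (s : 'S_n) : s @: setT = setT.
Proof.
apply/setP=> a; rewrite inE; apply/imsetP; exists ((s^-1)%g a) => //; by rewrite permKV.
Qed.

Lemma graph_iso_ex n s (G : dsgraph n) : exists H : dsgraph n, graph_iso s G H.
Proof.
have dH : is_dsgraph (pushforward s (edges G)).
  rewrite -good_graph_setT -(perm_setT s) -good_pullback ?pullback_push.
  - by rewrite good_graph_setT (dsgraphP G).
  - exact: perm_inj.
  - exact: perm_inj.
  - by rewrite perm_setT; apply/subsetP=> e; rewrite !inE.
by exists (DSGraph dH); apply/graph_isoP.
Qed.

Lemma graph_iso_uniq n s (G H H' : dsgraph n) :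
  graph_iso s G H -> graph_iso s G H' -> H = H'.
Proof. by move=> /graph_isoP GH /graph_isoP GH'; apply: val_inj; rewrite /= GH GH'. Qed.

Section Leveled.
Variables (n p : nat).
Implicit Types (L M N : lgraph n p).

Lemma lgraph_isoP s L M :
  reflect (graph_iso s L.1 M.1 /\ forall v, M.2 (s v) = L.2 v) (lgraph_iso s L M).
Proof.
apply: (iffP andP) => -[G H]; split=> //; first by move=> v; apply/eqP/(forallP H).
by apply/forallP=> v; apply/eqP.
Qed.

Lemma lgraph_iso1 L : lgraph_iso 1%g L L.
Proof. by apply/lgraph_isoP; split=> [|v]; [apply: graph_iso1 | rewrite perm1]. Qed.

Lemma lgraph_isoM s t L M N : lgraph_iso s L M -> lgraph_iso t M N -> lgraph_iso (s * t)%g L N.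
Proof.
move=> /lgraph_isoP[G1 H1] /lgraph_isoP[G2 H2]; apply/lgraph_isoP.
by split=> [|v]; [apply: graph_isoM G1 G2 | rewrite permM H2 H1].
Qed.

Lemma lgraph_isoV s L M : lgraph_iso s L M -> lgraph_iso (s^-1)%g M L.
Proof.
move=> /lgraph_isoP[G1 H1]; apply/lgraph_isoP.
by split=> [|v]; [apply: graph_isoV | rewrite -H1 permKV].
Qed.

Lemma lgraph_iso_ex s L : exists M, lgraph_iso s L M.
Proof.
have [H GH] := graph_iso_ex s L.1; exists (H, [ffun v => L.2 ((s^-1)%g v)]).
by apply/lgraph_isoP; split=> //= v; rewrite ffunE permK.
Qed.

Lemma lgraph_iso_uniq s L M M' : lgraph_iso s L M -> lgraph_iso s L M' -> M = M'.
Proof.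
case: M => M1 M2; case: M' => M1' M2' /lgraph_isoP[/= G1 H1] /lgraph_isoP[/= G2 H2].
congr (_, _); first exact: graph_iso_uniq G1 G2.
by apply/ffunP=> v; rewrite -[v](permKV s) H1 H2.
Qed.

Lemma leveled_iso s L M : lgraph_iso s L M -> leveled L -> leveled M.
Proof.
move=> /lgraph_isoP[/graph_isoP GM HM] /forall_inP lL; apply/forall_inP=> e.
by rewrite GM => /imsetP[[u v] Luv ->] /=; rewrite !HM; apply: (lL (u, v)).
Qed.

Lemma lgraph_sumE (g : completeLieGraph k) (P : pred (lgraph n p)) (w : lgraph n p -> g) :
    (forall s L M, lgraph_iso s L M -> P L -> P M) ->
    (forall s L M, lgraph_iso s L M -> leveled L -> P L -> w L = w M) ->
  lgraph_sum P w = (n`!%:R)^-1 *: \sum_(L | leveled L && P L) w L.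
Proof.
move=> isoP isow; rewrite /lgraph_sum /lgraph_classes /lAut.
rewrite (orbit_sum chark lgraph_iso1 lgraph_isoM lgraph_isoV lgraph_iso_ex lgraph_iso_uniq).
- by congr (_ *: _); apply: eq_bigl => L; rewrite inE.
- move=> s L M LM; rewrite !inE => /andP[/(leveled_iso LM) -> /(isoP _ _ _ LM) ->] //.
- by move=> s L M LM; rewrite inE => /andP[lL PL]; apply: isow LM lL PL.
Qed.

End Leveled.

End GraphClasses.

(** * Leveled sums and the products of the gauge group *)

Section LevelWeight.
Variables (k : fieldType) (q : nat).
Notation C := 'I_q.+1.

Definition below (i : nat) (W : finType) (col : W -> C) (E : {set W * W}) (A : {set W}) : bool :=
  [forall a in A, (col a < i)%N]
  && [forall a in A, forall b in A, ((a, b) \in E) ==> (col b < col a)%N].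

Lemma belowP i (W : finType) (col : W -> C) (E : {set W * W}) (A : {set W}) :
  reflect ((forall a, a \in A -> (col a < i)%N) /\
           (forall a b, a \in A -> b \in A -> (a, b) \in E -> (col b < col a)%N))
          (below i col E A).
Proof.
apply: (iffP andP) => -[H1 H2]; split.
- by move=> a; apply: (forall_inP H1).
- by move=> a b Aa Ab; apply/implyP; apply: (forall_inP (forall_inP H2 a Aa)).
- exact/forall_inP.
- by apply/forall_inP=> a Aa; apply/forall_inP=> b Ab; apply/implyP; apply: H2.
Qed.

Definition level_letter (i : nat) : character k C := letter k (inord i).

Lemma level_letter0 (W : finType) (col : W -> C) (E : {set W * W}) (A : {set W}) :
  level_letter 0 W col E A = (below 1 col E A)%:R.
Proof.
congr (_%:R); congr nat_of_bool; apply/letterP/belowP => -[H1 H2]; split.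
- by move=> a Aa; rewrite H1 // inordK.
- by move=> a b Aa Ab; rewrite (negPf (H2 _ _ Aa Ab)).
- by move=> a Aa; apply: val_inj; rewrite /= inordK //; have := H1 a Aa; case: (nat_of_ord _).
- move=> a b Aa Ab; apply/negP=> /(H2 _ _ Aa Ab).
  by have := H1 _ Aa; case: (nat_of_ord (col a)).
Qed.

Lemma conv_level (X : character k C) i : (0 < i <= q)%N ->
    (forall (W : finType) (col : W -> C) E A, X W col E A = (below i col E A)%:R) ->
  forall (W : finType) (col : W -> C) E A, conv X (level_letter i) W col E A = (below i.+1 col E A)%:R.
Proof.
case/andP=> i0 leiq XE W col E A.
pose B0 := [set a in A | (col a < i)%N].
rewrite /= /conv_fun (bigID (pred1 B0)) /= [X in _ + X]big1 ?addr0; last first.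
  move=> B /andP[/lowerP[/subsetP sBA _] nB]; rewrite XE.
  case: belowP => [[H1 _]|_]; last by rewrite mul0r.
  rewrite /letter_fun; case: letterP => [[H2 _]|_]; last by rewrite mulr0.
  case/negP: nB; apply/eqP/setP=> a; rewrite inE.
  apply/idP/andP => [Ba|[Aa lta]]; first by rewrite sBA // H1.
  apply: contraTT lta => nBa; rewrite H2 ?inE ?nBa // inordK ?ltnS // -leqNgt //.
rewrite big_andbC big_mkcondr big_pred1_eq XE /letter_fun -natrM mulnb.
rewrite -[RHS]/((below i.+1 col E A)%:R) -[X in if X then _ else _]/(lower E A B0).
have Ei a : a \in A :\: B0 -> (col a < i.+1)%N -> col a = inord i.
  rewrite !inE => /andP[+ Aa]; rewrite Aa /= -leqNgt => lei lti.
  by apply: val_inj; rewrite /= inordK ?ltnS //; apply/eqP; rewrite eqn_leq -ltnS lti.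
have colB a : a \in B0 -> (col a < i)%N by rewrite inE => /andP[].
have AB a : a \in B0 -> a \in A by rewrite inE => /andP[].
case: (belowP i.+1 col E A) => [[H1 H2]|nH].
  have -> : lower E A B0.
    apply/lowerP; split; first by apply/subsetP.
    move=> a b Ba Ab nB; apply/negP=> /(H2 _ _ (AB _ Ba) Ab) lt.
    by case/negP: nB; rewrite inE Ab (ltn_trans lt) // colB.
  have -> : below i col E B0.
    by apply/belowP; split=> // a b Ba Bb; apply: H2; apply: AB.
  rewrite (introT (letterP _ _ _ _)) //; split=> [a|a b] ABa.
    by apply: Ei => //; apply: H1; case/setDP: ABa.
  move=> ABb; have /setDP[Aa _] := ABa; have /setDP[Ab _] := ABb.
  apply/negP=> /(H2 _ _ Aa Ab); rewrite (Ei a ABa (H1 _ Aa)) (Ei b ABb (H1 _ Ab)).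
  by rewrite ltnn.
case: lowerP => // -[_ H1]; case: belowP => [[_ H2]|]; last by [].
case: letterP => [[H3 H4]|]; last by rewrite andbF.
have D a : a \in A -> (a \in B0) = false -> a \in A :\: B0 by move=> Aa Ba; rewrite in_setD Ba Aa.
case: nH; split=> [a Aa|a b Aa Ab Eab].
  case Ba: (a \in B0); first by apply: leq_trans (colB _ Ba) _.
  by rewrite (H3 a (D _ Aa Ba)) inordK ?ltnS.
case Ba: (a \in B0).
  case Bb: (b \in B0); first exact: H2.
  by have := H1 _ _ Ba Ab; rewrite Bb Eab => /(_ isT).
case Bb: (b \in B0); last first.
  by have := H4 a b (D _ Aa Ba) (D _ Ab Bb); rewrite Eab.
by rewrite (H3 a (D _ Aa Ba)) inordK ?ltnS // colB.
Qed.

Lemma below_leveled n (lev : {ffun 'I_n -> C}) (G : dsgraph n) :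
  below q.+1 lev (edges G) setT = leveled (G, lev).
Proof.
apply/belowP/forall_inP => [[_ H] [a b] Gab|H]; first exact: H.
by split=> [a _|a b _ _ Gab]; [apply: ltn_ord | apply: (H (a, b))].
Qed.

End LevelWeight.

Section LeveledTerms.
Variables (k : fieldType) (g : completeLieGraph k) (q : nat).
Hypothesis chark : [pchar k] =i pred0.
Local Opaque gmul gexp.
Notation h := (extension g).
Variables (x : 'I_q.+1 -> h) (X : character k 'I_q.+1).
Hypothesis x1 : forall c, ev_fil 1 (x c).
Hypothesis XE : forall (W : finType) (col : W -> 'I_q.+1) E A, X W col E A = (below q.+1 col E A)%:R.

(** The value of a leveled graph, with [x i] on the level [i]. *)
Definition level_value n (L : lgraph n q.+1) : h :=
  gop setT (edges L.1) (fun v => x (L.2 v)).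

Lemma level_value_iso n s (L M : lgraph n q.+1) :
  lgraph_iso s L M -> level_value L = level_value M.
Proof.
case/lgraph_isoP=> /graph_isoP GM HM; rewrite /level_value GM -(perm_setT s).
rewrite (@gop_inj k h _ _ s setT (edges L.1) (fun v => x (M.2 v))) ?perm_setT //.
  by apply: (@gop_ext k h) => v _ /=; rewrite HM.
exact: perm_inj.
Qed.

Lemma phi_term_level n :
  phi_term x X n = (n`!%:R)^-1 *: \sum_(L : lgraph n q.+1 | leveled L) level_value L.
Proof.
congr (_ *: _).
transitivity (\sum_(lev : {ffun 'I_n -> 'I_q.+1}) \sum_(G : dsgraph n | leveled (G, lev))
    level_value (G, lev)); last first.
  rewrite (exchange_big_dep xpredT) //= pair_big_dep /=.
  by apply: eq_big => [[]|[]].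
apply: eq_bigr => lev _.
pose F (E : {set 'I_n * 'I_n}) := (below q.+1 lev E setT)%:R *: gop setT E (fun v => x (lev v)).
rewrite [RHS]big_mkcond /= [LHS](eq_bigr F) => [|E _]; last by rewrite XE.
apply/esym; rewrite (bigID (fun E => is_dsgraph E)) /= [X in _ = _ + X]big1 ?addr0; last first.
  by move=> E bE; rewrite /F gop_bad ?scaler0 // good_graph_setT.
rewrite [RHS](reindex_omap (@edges n) insub) /=; last by move=> E dE; rewrite insubT.
apply: eq_big => [G|G _]; first by rewrite (dsgraphP G) valK eqxx.
by rewrite /F below_leveled; case: ifP => _; rewrite ?scale1r ?scale0r.
Qed.

End LeveledTerms.

Section DgOp.
Variables (k : fieldType) (g : completeLieGraph k).

Lemma dg_op_gopg n (G : dsgraph n) (x : 'I_n -> g) : signless x ->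
  dg_op G [ffun v => x v] = gopg setT (edges G) x.
Proof.
move=> sx; have E : id @: [set: 'I_n] = setT by rewrite imset_id.
rewrite -[setT in RHS]E gopgE //; last by rewrite E; apply/subsetP=> e; rewrite !inE.
have -> : pullback id (edges G) = edges G by apply/setP=> -[a b]; rewrite pullbackE.
by rewrite opE_edges.
Qed.

Lemma dg_op_upd n (G : dsgraph n) (x : 'I_n -> g) u y :
    (forall v, dg_gr 0 (x v)) -> dg_gr (-1) y ->
  dg_op G (subst_at [ffun v => x v] u y) = gopg setT (edges G) (upd x u y).
Proof.
move=> x0 y0; rewrite -dg_op_gopg; last by exact: (signless_upd _ x0 y0).
by congr (dg_op G _); apply/ffunP=> v; rewrite !ffunE.
Qed.

End DgOp.

Section LeveledSeries.
Variables (k : fieldType) (g : completeLieGraph k) (q : nat).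
Hypothesis chark : [pchar k] =i pred0.
Local Opaque gmul gexp.
Notation h := (extension g).
Variables (x : 'I_q.+1 -> h) (X : character k 'I_q.+1).
Hypothesis x1 : forall c, ev_fil 1 (x c).
Hypothesis XE : forall (W : finType) (col : W -> 'I_q.+1) E A, X W col E A = (below q.+1 col E A)%:R.

Lemma level_value_fst n (L : lgraph n q.+1) :
  (level_value x L).1 = dg_op L.1 [ffun v => (x (L.2 v)).1].
Proof.
rewrite dg_op_gopg //; apply: signless0 => v; by have [/fil_gr] := x1 (L.2 v).
Qed.

Lemma level_value_snd n (L : lgraph n q.+1) :
  (level_value x L).2 =
  \sum_u dg_op L.1 (subst_at [ffun v => (x (L.2 v)).1] u (x (L.2 u)).2).
Proof.
transitivity (\sum_(u in [set: 'I_n])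
   gopg setT (edges L.1) (upd (fun v => (x (L.2 v)).1) u (x (L.2 u)).2)) => //.
apply: eq_big => [u|u _]; first by rewrite inE.
rewrite dg_op_upd // => [v|]; first by have [/fil_gr] := x1 (L.2 v).
by have [_ /fil_gr] := x1 (L.2 u).
Qed.

Lemma level_series_fst (w : forall n, lgraph n q.+1 -> g) :
    (forall n (L : lgraph n q.+1), w n L = (level_value x L).1) ->
  series 0 (fun n => lgraph_sum predT (@w n)) = (phi x X).1.
Proof.
move=> wE; have f1 := phi_fil1 x1 X; have P1 := phiP x1 X.
apply: (@series_shift _ _ _ _ _ 0); first by have [/fil_gr] := f1.
move=> N; have := sums_to_fst N P1; rewrite addn0; congr (fil _ _ (_ - _)).
apply: eq_bigr => n _; rewrite (lgraph_sumE chark) //; last first.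
  by move=> s L M LM _ _; rewrite !wE (level_value_iso x1 LM).
rewrite (phi_term_level x XE) /= fst_sum; congr (_ *: _).
by apply: eq_big => [L|L _]; rewrite ?andbT ?wE.
Qed.

Lemma level_series_snd (P : forall n, pred (lgraph n q.+1))
    (w : forall n, lgraph n q.+1 -> g) :
    (forall n s (L M : lgraph n q.+1), lgraph_iso s L M -> P n L -> P n M) ->
    (forall n (L : lgraph n q.+1), P n L -> w n L = (level_value x L).2) ->
    (forall n (L : lgraph n q.+1), ~~ P n L -> (level_value x L).2 = 0) ->
  series (-1) (fun n => lgraph_sum (@P n) (@w n)) = (phi x X).2.
Proof.
move=> isoP wE w0; have f1 := phi_fil1 x1 X; have P1 := phiP x1 X.
apply: (@series_shift _ _ _ _ _ 1); first by have [_ /fil_gr] := f1.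
move=> N; have := sums_to_snd N P1; rewrite addn1; congr (fil _ _ (_ - _)).
apply: eq_bigr => n _; rewrite (lgraph_sumE chark).
- rewrite (phi_term_level x XE) /= snd_sum; congr (_ *: _).
  rewrite [LHS](bigID (@P n)) /= [X in _ + X]big1 ?addr0 => [|L /andP[_ /w0]//].
  by apply: eq_bigr => L /andP[_ PL]; rewrite wE.
- exact: isoP.
- move=> s L M LM _ PL; rewrite !wE ?(level_value_iso x1 LM) //; exact: isoP LM PL.
Qed.

End LeveledSeries.

Section Products.
Variables (k : fieldType) (g : completeLieGraph k).
Hypothesis chark : [pchar k] =i pred0.
Local Opaque gmul gexp.
Notation h := (extension g).

Implicit Types (x y z a : g).

Definition level2 (u v : h) (c : 'I_2) : h := if c == 0%N :> nat then u else v.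

Definition stack2 : character k 'I_2 := conv (level_letter k 1 0) (level_letter k 1 1).
Definition stack3 : character k 'I_3 := conv (conv (letter3 k 0) (letter3 k 1)) (letter3 k 2).

Lemma stack2E (W : finType) (col : W -> 'I_2) E A : stack2 W col E A = (below 2 col E A)%:R.
Proof. by apply: conv_level => // W' *; apply: level_letter0. Qed.

Lemma stack3E (W : finType) (col : W -> 'I_3) E A : stack3 W col E A = (below 3 col E A)%:R.
Proof.
apply: conv_level => // {W col E A} W col E A.
by apply: conv_level => // W' *; apply: level_letter0.
Qed.

Lemma level2_fil1 (u v : h) c : ev_fil 1 u -> ev_fil 1 v -> ev_fil 1 (level2 u v c).
Proof. by rewrite /level2; case: ifP. Qed.

Lemma gmul_level (u v : h) : ev_fil 1 u -> ev_fil 1 v -> gmul u v = phi (level2 u v) stack2.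
Proof.
move=> u1 v1; have x1 c := level2_fil1 c u1 v1.
have E0 : phi (level2 u v) (level_letter k 1 0) = u.
  by rewrite /level_letter phi_letter // /level2 inordK.
have E1 : phi (level2 u v) (level_letter k 1 1) = v.
  by rewrite /level_letter phi_letter // /level2 inordK.
exact: (etrans (esym (congr2 (@gmul k h) E0 E1)) (gmul_phi chark x1 ord0 _ _)).
Qed.

Lemma gauge_mulE x y : fil 1 0 x -> fil 1 0 y ->
  gauge_mul x y = (gmul (emb x) (emb y)).1.
Proof.
move=> /emb_fil1 x1 /emb_fil1 y1; have z1 c := level2_fil1 c x1 y1.
rewrite gmul_level //; apply: (level_series_fst chark z1 stack2E) => n L.
rewrite (level_value_fst z1); congr (dg_op _ _); apply/ffunP=> v; rewrite !ffunE /level2.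
by case: ifP.
Qed.

Lemma gauge_mul_linlE x y z : fil 1 0 x -> dg_gr (-1) y -> fil 1 0 z ->
  gauge_mul_linl x y z = (gmul ((x, y) : h) (emb z)).2.
Proof.
move=> x0 y0 /emb_fil1 z1.
have x1 : ev_fil 1 ((x, y) : h) by split=> //; apply/fil_0.
have w1 c := level2_fil1 c x1 z1.
rewrite gmul_level //; apply: (level_series_snd chark w1 stack2E) => // n L _.
rewrite (level_value_snd w1) [RHS](bigID (fun u => L.2 u == 0%N :> nat)) /=.
rewrite [X in _ = _ + X]big1 ?addr0.
  apply: eq_bigr => u u0; congr (dg_op _ (subst_at _ _ _)); last by rewrite /level2 u0.
  by apply/ffunP=> v; rewrite !ffunE /level2; case: ifP.
move=> u /negPf u0; rewrite /level2 u0 dg_op_upd //.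
- by rewrite (@gopg0 _ _ _ _ _ _ u) ?inE // /upd eqxx.
- by move=> v; case: ifP => _; [exact: fil_gr x0 | have [/fil_gr] := z1].
- exact: dg_gr0.
Qed.

Lemma ord2_neq0 (c : 'I_2) : (c == 1%N :> nat) = (c != 0%N :> nat).
Proof. by case: c => -[|[]]. Qed.

Lemma gauge_mul_linrE z x y : fil 1 0 z -> fil 1 0 x -> dg_gr (-1) y ->
  gauge_mul_linr z x y = (gmul (emb z) ((x, y) : h)).2.
Proof.
move=> /emb_fil1 z1 x0 y0.
have x1 : ev_fil 1 ((x, y) : h) by split=> //; apply/fil_0.
have w1 c := level2_fil1 c z1 x1.
rewrite gmul_level //; apply: (level_series_snd chark w1 stack2E) => // n L _.
rewrite (level_value_snd w1) [RHS](bigID (fun u => L.2 u == 1%N :> nat)) /=.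
rewrite [X in _ = _ + X]big1 ?addr0.
  apply: eq_bigr => u; rewrite ord2_neq0 => /negPf u0.
  congr (dg_op _ (subst_at _ _ _)); last by rewrite /level2 u0.
  by apply/ffunP=> v; rewrite !ffunE /level2; case: ifP.
move=> u; rewrite ord2_neq0 negbK => u0; rewrite /level2 u0 dg_op_upd //.
- by rewrite (@gopg0 _ _ _ _ _ _ u) ?inE // /upd eqxx.
- by move=> v; case: ifP => _; [have [/fil_gr] := z1 | exact: fil_gr x0].
- exact: dg_gr0.
Qed.

Lemma is_bowtie_iso n s (L M : lgraph n 3) : lgraph_iso s L M -> is_bowtie L -> is_bowtie M.
Proof.
move=> /lgraph_isoP[_ LM] /eqP cL; apply/eqP; apply: etrans cL.
rewrite -[RHS](card_imset _ (@perm_inj _ s)); apply: eq_card => v.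
rewrite inE; apply/idP/imsetP => [Mv|[u + ->]]; last by rewrite inE LM.
by exists ((s^-1)%g v); rewrite ?permKV // inE -LM permKV.
Qed.

(** Since [eps a] squares to zero, only the graphs with one vertex on the level
    of [eps a] contribute. *)
Lemma bowtieE x a y : fil 1 0 x -> dg_gr (-1) a -> fil 1 0 y ->
  bowtie x a y = (gmul (gmul (emb x) (eps a)) (emb y)).2.
Proof.
move=> x0 a0 y0; have x1 := emb_fil1 x0; have y1 := emb_fil1 y0; have a1 := eps_fil1 a0.
rewrite (gmul3 chark) //; set w := triple_fun _ _ _.
have w1 c : ev_fil 1 (w c) by rewrite /w /triple_fun; do ?case: ifP => _.
have w0 c : dg_gr 0 (w c).1 by have [/fil_gr] := w1 c.
have v0 c : dg_gr (-1) (w c).2 by have [_ /fil_gr] := w1 c.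
have midE (c : 'I_3) : (c == 1%N :> nat) = false -> (w c).2 = 0.
  by rewrite /w /triple_fun => ->; do ?case: ifP => _.
have mid1 (c : 'I_3) : (c == 1%N :> nat) -> (w c).1 = 0 /\ (w c).2 = a.
  by rewrite /w /triple_fun => /eqP ->.
apply: (level_series_snd chark w1 stack3E) => [n s L M|n L|n L].
- exact: is_bowtie_iso.
- move=> /cards1P[u Lu]; rewrite (level_value_snd w1) (bigD1 u) //= [X in _ = _ + X]big1 ?addr0.
    have cu v : (L.2 v == 1%N :> nat) = (v == u).
      by have := congr1 (fun A : {set 'I_n} => v \in A) Lu; rewrite !inE.
    congr (dg_op _ _); apply/ffunP=> v; rewrite !ffunE; case: (eqVneq v u) => [->|nv].
      have := cu u; rewrite eqxx => c1; have [_ ->] := mid1 _ c1.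
      by rewrite (eqP c1).
    by rewrite cu (negPf nv) /w /triple_fun cu (negPf nv); case: ifP.
  move=> v nv; rewrite dg_op_upd // (@gopg0 _ _ _ _ _ _ v) ?inE // /upd eqxx midE //.
  by have := congr1 (fun A : {set 'I_n} => v \in A) Lu; rewrite !inE (negPf nv).
move=> nL; rewrite (level_value_snd w1) big1 // => u _; rewrite dg_op_upd //.
case cu: (L.2 u == 1%N :> nat); last first.
  by rewrite (@gopg0 _ _ _ _ _ _ u) ?inE // /upd eqxx midE.
have /existsP[v /andP[cv nv]] : [exists v, (L.2 v == 1%N :> nat) && (v != u)].
  apply: contraNT nL => /existsPn H; apply/eqP; apply: etrans (cards1 u); apply: eq_card => v.
  rewrite !inE; case: (eqVneq v u) => [->|nv]; first by rewrite cu.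
  by have := H v; rewrite nv andbT => /negPf.
rewrite (@gopg0 _ _ _ _ _ _ v) ?inE // /upd (negPf nv).
by have [->] := mid1 _ cv.
Qed.

End Products.

(** * The graph exponential *)

Section LinearExtensions.
Variables (k : fieldType) (W : finType) (E : {set W * W}).
Hypothesis chark : [pchar k] =i pred0.
Hypothesis irrE : forall a, (a, a) \notin E.

Let increasing := pairwise (fun a b => (a, b) \notin E).

Lemma count_increasing (s : seq W) : uniq s ->
  (count increasing (permutations s))%:R = (size s)`!%:R * lex k E [set a in s].
Proof.
move: {2}(size s) (erefl (size s)) => n; elim: n s => [|n IH] s sn us.
  move/size0nil: sn => ->; rewrite /= mul1r.
  by have -> : [set a in [::]] = set0 :> {set W} by []; rewrite lex0.
have s0 : (0 < size s)%N by rewrite sn.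
have cs : #|[set a in s]| = n.+1 by rewrite cardsE (card_uniqP us).
rewrite sn factS natrM mulrAC (seq.permP (permutationsE s0)) -cs (lexE chark) mulrC.
rewrite count_flatten -map_comp sumnE big_map natr_sum undup_id // big_uniq //=.
rewrite mulr_sumr [RHS]big_mkcondr /= [RHS](eq_bigl (mem s)) => [|v]; last by rewrite inE.
apply: eq_bigr => v sv; rewrite count_map.
have sr : size (rem v s) = n by rewrite size_rem // sn.
have rE : [set a in rem v s] = [set a in s] :\ v.
  by apply/setP=> a; rewrite !inE (rem_filter _ us) mem_filter.
have allE t : t \in permutations (rem v s) ->
    all (fun b => (v, b) \notin E) t = bottom E [set a in s] v.
  rewrite mem_permutations => /perm_mem tE; apply/allP/bottomP => H b.
    rewrite inE => sb; case: (eqVneq b v) => [->|nb]; first exact: irrE.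
    by apply: H; rewrite tE (rem_filter _ us) mem_filter /= nb.
  by rewrite tE (rem_filter _ us) mem_filter => /andP[_ sb]; apply: H; rewrite inE.
rewrite -rE; have := IH _ sr (rem_uniq v us); rewrite sr => <-.
case: ifP => bv; last first.
  rewrite (@eq_in_count _ _ pred0) ?count_pred0 // => t /allE; by rewrite bv /= => ->.
congr _%:R; apply: eq_in_count => t /allE; by rewrite bv /= => ->.
Qed.

End LinearExtensions.

Section Levelisations.
Variables (k : fieldType) (n : nat).
Hypothesis chark : [pchar k] =i pred0.
Implicit Types (G H : dsgraph n) (f : 'S_n).

Lemma card_total_levelisations G :
  #|total_levelisations G|%:R = n`!%:R * lex k (edges G) setT.
Proof.
have irr a : (a, a) \notin edges G by rewrite dsgraph_irr.
have := @count_increasing k _ (edges G) chark irr (enum 'I_n) (enum_uniq _).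
rewrite size_enum_ord; have -> : [set a in enum 'I_n] = setT.
  by apply/setP=> a; rewrite !inE mem_enum.
move=> <-; congr _%:R; rewrite -size_filter cardE.
pose F f := [seq (f^-1)%g i | i <- enum 'I_n].
have injF : injective F.
  move=> f f' /eq_in_map ff; apply/invg_inj/permP=> i; apply: ff; exact: mem_enum.
rewrite -(size_map F); apply: perm_size; apply: uniq_perm.
- by rewrite map_inj_uniq ?enum_uniq.
- by rewrite filter_uniq ?permutations_uniq.
have incP f : (f \in total_levelisations G)
    = pairwise (fun a b => (a, b) \notin edges G) (F f).
  rewrite inE; apply/forall_inP/idP => [lf|incf].
    rewrite pairwise_map.
    have : pairwise (fun i j : 'I_n => (i < j)%N) (enum 'I_n).
      rewrite -(@pairwise_map _ _ val ltn) val_enum_ord -sorted_pairwise ?iota_ltn_sorted //.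
      exact: ltn_trans.
    apply: sub_pairwise => i j ltij /=; apply/negP=> /lf /=; rewrite !permKV.
    by rewrite ltnNge ltnW.
  move=> [a b] Gab /=; rewrite ltnNge leq_eqVlt negb_or; apply/andP; split.
    apply/eqP=> /val_inj/perm_inj ab; by rewrite ab (negPf (irr b)) in Gab.
  apply: contraL Gab => ltab.
  have /(pairwiseP a)/(_ (f a) (f b)) := incf.
  rewrite !inE size_map size_enum_ord !ltn_ord => /(_ isT isT ltab).
  have nE c : nth a (F f) (f c) = c.
    by rewrite /F (nth_map a) ?size_enum_ord // nth_ord_enum permK.
  by rewrite !nE.
move=> t; rewrite mem_filter mem_permutations; apply/mapP/andP.
  case=> f; rewrite mem_enum incP => incf ->; split=> //.
  have -> : enum 'I_n = ord_tuple n by rewrite val_ord_tuple.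
  apply/tuple_permP; exists (f^-1)%g; rewrite /F /=.
  by apply: eq_map => i; rewrite tnth_ord_tuple.
case=> inct; rewrite -val_ord_tuple => /tuple_permP[p tE].
have tF : t = F (p^-1)%g.
  by rewrite tE /F invgK /=; apply: eq_map => i; rewrite tnth_ord_tuple.
by exists (p^-1)%g => //; rewrite mem_enum incP -tF.
Qed.

(** The automorphisms act freely on the total levelisations. *)
Lemma nb_levelisationsE G :
  #|total_levelisations G| = (nb_levelisations G * #|[set s | graph_iso s G G]|)%N.
Proof.
pose R (f f' : 'S_n) := [exists s, graph_iso s G G && [forall v, f' (s v) == f v]].
have RP f f' : reflect (exists2 s, graph_iso s G G & f = (s * f')%g) (R f f').
  apply: (iffP existsP) => [[s /andP[Gs /forallP fs]]|[s Gs ->]].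
    by exists s => //; apply/permP=> v; rewrite permM; apply/esym/eqP.
  by exists s; rewrite Gs; apply/forallP=> v; rewrite permM.
have eqR : {in total_levelisations G & &, equivalence_rel R}.
  move=> f f' f'' _ _ _; split; first by apply/RP; exists 1%g; rewrite ?mul1g ?graph_iso1.
  move=> /RP[s Gs ->]; apply/RP/RP => -[t Gt tE].
    exists (s^-1 * t)%g; last by rewrite -mulgA -tE mulKg.
    by apply: graph_isoM Gt; apply: graph_isoV.
  by exists (s * t)%g; rewrite ?tE ?mulgA //; apply: graph_isoM Gt.
have partP := equivalence_partitionP eqR.
apply: (card_uniform_partition _ partP) => B PB.
have [f fD BE] : exists2 f, f \in total_levelisations G &
    B = [set f' in total_levelisations G | R f f'].
  by case/imsetP: PB => f fD ->; exists f.
rewrite BE -(card_imset [set s | graph_iso s G G] (@mulIg _ f)).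
apply: eq_card => f'; rewrite inE; apply/andP/imsetP => [[_ /RP[s Gs fE]]|[s + ->]].
  exists (s^-1)%g; first by rewrite inE; apply: graph_isoV.
  by rewrite fE mulKg.
rewrite inE => Gs; split; last first.
  by apply/RP; exists (s^-1)%g; rewrite ?mulKg //; apply: graph_isoV.
move: fD; rewrite !inE => /forall_inP fD; apply/forall_inP=> -[a b] Gab /=.
rewrite !permM; apply: (fD (s a, s b)).
by have /forallP/(_ a)/forallP/(_ b)/eqP -> := Gs.
Qed.

End Levelisations.

Section GraphExponential.
Variables (k : fieldType) (g : completeLieGraph k).
Hypothesis chark : [pchar k] =i pred0.
Local Opaque gmul gexp.
Notation h := (extension g).
Implicit Types (l m a b x y : g).

Lemma gauge_exp_fst1 l : fil 1 0 l -> fil 1 0 (gauge_exp l).1.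
Proof. by move=> l1; have [] := gauge_exp1 l1. Qed.

Lemma lex_iso n s (G H : dsgraph n) :
  graph_iso s G H -> lex k (edges G) setT = lex k (edges H) setT.
Proof.
move=> /graph_isoP ->; rewrite -[setT in RHS](perm_setT s) (lex_inj chark); last exact: perm_inj.
by rewrite pullback_push //; apply: perm_inj.
Qed.

Lemma graph_expE l : fil 1 0 l -> graph_exp l = (gauge_exp l).1.
Proof.
move=> l1; have l0 : dg_gr 0 l := fil_gr l1.
have f1 := gauge_exp_fst1 l1; have e1 := emb_fil1 l1.
apply: (@series_shift _ _ _ _ _ 0); first exact: fil_gr f1.
have P1 : sums_to (gexp_term (emb l)) (gauge_exp l).
  by apply: hsumP => n; apply: gexp_term_fil.
move=> N; have := sums_to_fst N P1; rewrite addn0; congr (fil _ _ (_ - _)).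
apply: eq_bigr => n _.
pose w (G : dsgraph n) : g := lex k (edges G) setT *: dg_op G [ffun=> l].
have wE (G : dsgraph n) : ((nb_levelisations G)%:R / n`!%:R) *: dg_op G [ffun=> l]
    = (#|[set s | graph_iso s G G]|%:R)^-1 *: w G.
  have := nb_levelisationsE G; move/(congr1 (fun c => c%:R : k)).
  rewrite (card_total_levelisations chark) natrM scalerA => E; congr (_ *: _).
  have n0 := fact_neq0 chark n; have a0 : #|[set s | graph_iso s G G]|%:R != 0 :> k.
    apply: natf_neq0 => //; apply/card_gt0P; exists 1%g; rewrite inE; exact: graph_iso1.
  apply: (mulIf n0); rewrite divfK //; apply: (mulIf a0); rewrite -E.
  by rewrite [RHS]mulrC !mulrA mulfV // mul1r mulrC.
rewrite [RHS](eq_bigr _ (fun G _ => wE G)).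
rewrite (orbit_sum chark (@graph_iso1 n) (@graph_isoM n) (@graph_isoV n)
  (@graph_iso_ex n) (@graph_iso_uniq n)) //; last first.
  move=> s G H GH _; rewrite /w (lex_iso GH); congr (_ *: _).
  rewrite (@dg_op_equivariant _ _ _ s G H (fun=> 0)) // => [|v]; last by rewrite ffunE.
  rewrite koszul_signless ?mulr0 // scale1r; congr (dg_op _ _).
  by apply/ffunP=> v; rewrite !ffunE.
rewrite /gexp_term /= fst_sum; congr (_ *: _).
pose F (E : {set 'I_n * 'I_n}) := lex k E setT *: gopg setT E (fun=> l).
rewrite [LHS](eq_bigr F) //.
rewrite [LHS](bigID (fun E => is_dsgraph E)) /= [X in _ + X]big1 ?addr0; last first.
  by move=> E bE; rewrite /F gopg_bad ?scaler0 // good_graph_setT.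
rewrite [LHS](reindex_omap (@edges n) insub) /=; last by move=> E dE; rewrite insubT.
apply: eq_big => [G|G _]; first by rewrite (dsgraphP G) valK eqxx inE.
rewrite /F /w; congr (_ *: _).
by rewrite -(dg_op_gopg G (x := fun=> l)) //; apply: signless0.
Qed.

Lemma graph_exp1 l : fil 1 0 l -> fil 1 0 (graph_exp l).
Proof. by move=> l1; rewrite graph_expE //; apply: gauge_exp_fst1. Qed.

Lemma emb_graph_exp l : fil 1 0 l -> emb (graph_exp l) = gauge_exp l.
Proof. by move=> l1; rewrite graph_expE // -gauge_expE. Qed.

Lemma theta_graph_exp l : fil 1 0 l -> theta (graph_exp l) = theta_exp l.
Proof. by move=> l1; rewrite graph_expE // -theta_expE. Qed.

Lemma graph_exp_inj l m : fil 1 0 l -> fil 1 0 m -> graph_exp l = graph_exp m -> l = m.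
Proof.
move=> l1 m1 E; have E' : gexp (emb l) = gexp (emb m).
  by rewrite -!/(gauge_exp _) -!emb_graph_exp // E.
have E2 := gexp_inj chark (emb_fil1 l1) (emb_fil1 m1) E'.
exact: (congr1 (fun X : h => X.1) E2).
Qed.

Lemma graph_exp_surj x : fil 1 0 x -> exists2 l, fil 1 0 l & graph_exp l = x.
Proof.
move=> x1; have [L [L1 L2] LE] := gexp_surj chark (emb_fil1 x1).
have L0 : ev_fil 1 L by split.
have l1 : fil 1 0 L.1 by apply: L1.
exists L.1 => //; rewrite (graph_expE l1) /gauge_exp.
have -> : (gexp (emb L.1)).1 = (gexp L).1.
  have e1 := emb_fil1 l1; rewrite (gexp_phi1 chark e1) (gexp_phi1 chark L0).
  by apply: phi_fst.
by rewrite LE.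
Qed.

Lemma graph_logP x : fil 1 0 x -> fil 1 0 (graph_log x) /\ graph_exp (graph_log x) = x.
Proof.
move=> /graph_exp_surj[l l1 lE]; apply: (@epsilon_spec g (inhabits 0) (fun l => fil 1 0 l /\ graph_exp l = x)); by exists l.
Qed.

Lemma graph_expK l : fil 1 0 l -> graph_log (graph_exp l) = l.
Proof.
by move=> l1; have [L1 LE] := graph_logP (graph_exp1 l1); apply: graph_exp_inj.
Qed.

End GraphExponential.

(** * The associator of the star product *)

Definition vtx0 : 'I_3 := @Ordinal 3 0 isT.
Definition vtx1 : 'I_3 := @Ordinal 3 1 isT.
Definition vtx2 : 'I_3 := @Ordinal 3 2 isT.

Lemma ord3_cases (P : 'I_3 -> Prop) : P vtx0 -> P vtx1 -> P vtx2 -> forall u, P u.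
Proof.
move=> P0 P1 P2 [[|[|[|u]]] lu] //.
- by rewrite (_ : Ordinal lu = vtx0) //; apply: val_inj.
- by rewrite (_ : Ordinal lu = vtx1) //; apply: val_inj.
- by rewrite (_ : Ordinal lu = vtx2) //; apply: val_inj.
Qed.

(** The subgraphs of the total order on three vertices. *)
Definition subtournament (b10 b20 b21 : bool) : {set 'I_3 * 'I_3} :=
  [set e | [|| b10 && (e == (vtx1, vtx0)), b20 && (e == (vtx2, vtx0))
             | b21 && (e == (vtx2, vtx1))]].

Lemma set3P (H H' : {set 'I_3 * 'I_3}) :
  (forall u v, ((u, v) \in H) = ((u, v) \in H')) -> H = H'.
Proof. by move=> HH; apply/setP=> -[u v]. Qed.

Section Associator.
Variables (k : fieldType) (g : dgLieGraph k).
Implicit Types (x y z : g).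

Definition triplef x y z : {ffun 'I_3 -> g} :=
  [ffun v => if v == vtx0 then x else if v == vtx1 then y else z].

Definition op3 b10 b20 b21 x y z : g := opE (subtournament b10 b20 b21) (triplef x y z).

Lemma opE_loop n (E : {set 'I_n * 'I_n}) (f : {ffun 'I_n -> g}) v :
  (v, v) \in E -> opE E f = 0.
Proof.
move=> Evv; apply: opE_bad; apply/negP=> dE.
by have := @dsgraph_irr n (DSGraph dE) v; rewrite /= Evv.
Qed.

Definition arrow : {set 'I_2 * 'I_2} := edges star_graph.

Lemma star_edges u v : ((u, v) \in arrow) = (u == ord_max) && (v == ord0).
Proof. by rewrite inE xpair_eqE. Qed.

Let rotate3 (A B C : g) : A + B + (C + 0) = B + C + A.
Proof. by rewrite addr0 -addrA addrC. Qed.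

Lemma starA_left x y z :
  star (star x y) z
  = op3 true true false x y z + op3 true false true x y z + op3 true true true x y z.
Proof.
have i0 : inner_lab (ord0 : 'I_2) (ord0 : 'I_2) = vtx0
  by apply: val_inj; apply: etrans (val_inner _ _) _.
have i1 : inner_lab (ord0 : 'I_2) (ord_max : 'I_2) = vtx1
  by apply: val_inj; apply: etrans (val_inner _ _) _.
have o1 : outer_lab 1 (ord0 : 'I_2) ord_max = vtx2
  by apply: val_inj; apply: etrans (val_outer _ _ _) _.
have c0 : collapse (ord0 : 'I_2) vtx0 = ord0 by rewrite -i0 collapse_inner.
have c1 : collapse (ord0 : 'I_2) vtx1 = ord0 by rewrite -i1 collapse_inner.
have c2 : collapse (ord0 : 'I_2) vtx2 = ord_max by rewrite -o1 collapse_outer.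
have nm : (ord0 : 'I_2) != ord_max by [].
have := @dg_op_insert k g 1 1 star_graph ord0 star_graph (triplef x y z).
move=> E; transitivity (\sum_(H : {set 'I_3 * 'I_3} |
    (pullback (inner_lab (ord0 : 'I_2)) H == arrow)
    && (contract (collapse (ord0 : 'I_2)) H == arrow)) opE H (triplef x y z)).
  apply: etrans E; congr (dg_op _ _); apply/ffunP; apply: (ord2_cases nm); rewrite !ffunE /=.
    congr (dg_op _ _); apply/ffunP; apply: (ord2_cases nm).
      by rewrite !ffunE i0.
    by rewrite !ffunE i1.
  by rewrite o1.
rewrite (bigID (fun H : {set 'I_3 * 'I_3} => (vtx2, vtx2) \notin H)) /= [X in _ + X]big1 ?addr0; last first.
  by move=> H /andP[_]; rewrite negbK; apply: opE_loop.
rewrite (reindex_onto (fun b : bool * bool => subtournament true b.1 b.2)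
   (fun H => ((vtx2, vtx0) \in H, (vtx2, vtx1) \in H))) /=; last first.
  move=> H /andP[/andP[/eqP/setP pE /eqP/setP cE] n22]; apply: set3P.
  have e00 := pE (ord0, ord0); have e01 := pE (ord0, ord_max).
  have e10 := pE (ord_max, ord0); have e11 := pE (ord_max, ord_max).
  rewrite !(pullbackE, i0, i1, star_edges) /= in e00 e01 e10 e11.
  have e2 u : collapse (ord0 : 'I_2) u = ord0 -> ((u, vtx2) \in H) = false.
    move=> cu; apply/negP=> Hu; have := cE (ord0, ord_max); rewrite star_edges /= => /negP[].
    by apply/contractP; split=> //; exists u, vtx2.
  apply: ord3_cases; apply: ord3_cases; rewrite !inE /= ?andbT ?andbF ?orbF;
    rewrite ?e00 ?e01 ?e10 ?e11 ?(negPf n22) ?e2 //.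
rewrite (eq_bigl (fun b : bool * bool => b.1 || b.2)) => [|[b20 b21]].
  by rewrite big_mkcond -(pair_bigA _ (fun i j : bool => if i || j then
     opE (subtournament true i j) (triplef x y z) else 0)) !big_bool; apply: rotate3.
have -> : pullback (inner_lab (ord0 : 'I_2)) (subtournament true b20 b21) = arrow.
  apply/setP=> -[u v]; rewrite pullbackE star_edges; move: u v.
  by apply: (ord2_cases nm); apply: (ord2_cases nm); rewrite ?i0 ?i1 !inE /= ?andbF.
rewrite eqxx !inE /= ?andbF ?andbT ?orbF eqxx andbT.
apply/eqP/idP => [/setP/(_ (ord_max, ord0))|b2].
  rewrite star_edges => /contractP[_ [u [v [+ cu cv]]]]; rewrite inE.
  case/or3P=> [/eqP[uE _]|/andP[-> _]|/andP[-> _]] //; last by rewrite orbT.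
  by move: cu; rewrite uE c1.
apply/setP=> -[a b]; rewrite star_edges; apply/contractP/andP => [[ab [u [v [+ cu cv]]]]|].
  rewrite inE; case/or3P=> [/andP[_]|/andP[_]|/andP[_]] /eqP[uE vE];
    by move: ab; rewrite -cu -cv uE vE ?c0 ?c1 ?c2 // => _; split.
case=> /eqP -> /eqP ->; split=> //; case/orP: b2 => ->; [exists vtx2, vtx0 | exists vtx2, vtx1];
  by rewrite !inE /= ?eqxx ?orbT.
Qed.

Lemma starA_right x y z :
  star x (star y z)
  = op3 true false true x y z + op3 false true true x y z + op3 true true true x y z.
Proof.
have i0 : inner_lab (ord_max : 'I_2) (ord0 : 'I_2) = vtx1
  by apply: val_inj; apply: etrans (val_inner _ _) _.
have i1 : inner_lab (ord_max : 'I_2) (ord_max : 'I_2) = vtx2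
  by apply: val_inj; apply: etrans (val_inner _ _) _.
have o0 : outer_lab 1 (ord_max : 'I_2) ord0 = vtx0
  by apply: val_inj; apply: etrans (val_outer _ _ _) _.
have c1 : collapse (ord_max : 'I_2) vtx1 = ord_max by rewrite -i0 collapse_inner.
have c2 : collapse (ord_max : 'I_2) vtx2 = ord_max by rewrite -i1 collapse_inner.
have c0 : collapse (ord_max : 'I_2) vtx0 = ord0 by rewrite -o0 collapse_outer.
have nm : (ord0 : 'I_2) != ord_max by [].
have := @dg_op_insert k g 1 1 star_graph ord_max star_graph (triplef x y z).
move=> E; transitivity (\sum_(H : {set 'I_3 * 'I_3} |
    (pullback (inner_lab (ord_max : 'I_2)) H == arrow)
    && (contract (collapse (ord_max : 'I_2)) H == arrow)) opE H (triplef x y z)).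
  apply: etrans E; congr (dg_op _ _); apply/ffunP; apply: (ord2_cases nm); rewrite !ffunE /=.
    by rewrite o0.
  congr (dg_op _ _); apply/ffunP; apply: (ord2_cases nm).
    by rewrite !ffunE i0.
  by rewrite !ffunE i1.
rewrite (bigID (fun H : {set 'I_3 * 'I_3} => (vtx0, vtx0) \notin H)) /= [X in _ + X]big1 ?addr0; last first.
  by move=> H /andP[_]; rewrite negbK; apply: opE_loop.
rewrite (reindex_onto (fun b : bool * bool => subtournament b.1 b.2 true)
   (fun H => ((vtx1, vtx0) \in H, (vtx2, vtx0) \in H))) /=; last first.
  move=> H /andP[/andP[/eqP/setP pE /eqP/setP cE] n00]; apply: set3P.
  have e00 := pE (ord0, ord0); have e01 := pE (ord0, ord_max).
  have e10 := pE (ord_max, ord0); have e11 := pE (ord_max, ord_max).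
  rewrite !(pullbackE, i0, i1, star_edges) /= in e00 e01 e10 e11.
  have e0 u : collapse (ord_max : 'I_2) u = ord_max -> ((vtx0, u) \in H) = false.
    move=> cu; apply/negP=> Hu; have := cE (ord0, ord_max); rewrite star_edges /= => /negP[].
    by apply/contractP; split=> //; exists vtx0, u.
  apply: ord3_cases; apply: ord3_cases; rewrite !inE /= ?andbT ?andbF ?orbF;
    rewrite ?e00 ?e01 ?e10 ?e11 ?(negPf n00) ?e0 //.
rewrite (eq_bigl (fun b : bool * bool => b.1 || b.2)) => [|[b10 b20]].
  by rewrite big_mkcond -(pair_bigA _ (fun i j : bool => if i || j then
     opE (subtournament i j true) (triplef x y z) else 0)) !big_bool; apply: rotate3.
have -> : pullback (inner_lab (ord_max : 'I_2)) (subtournament b10 b20 true) = arrow.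
  apply/setP=> -[u v]; rewrite pullbackE star_edges; move: u v.
  by apply: (ord2_cases nm); apply: (ord2_cases nm); rewrite ?i0 ?i1 !inE /= ?andbF.
rewrite eqxx !inE /= ?andbF ?andbT ?orbF eqxx andbT.
apply/eqP/idP => [/setP/(_ (ord_max, ord0))|b2].
  rewrite star_edges => /contractP[_ [u [v [+ cu cv]]]]; rewrite inE.
  case/or3P=> [/andP[-> _]|/andP[-> _]|/eqP[_ vE]] //; first by rewrite orbT.
  by move: cv; rewrite vE c1.
apply/setP=> -[a b]; rewrite star_edges; apply/contractP/andP => [[ab [u [v [+ cu cv]]]]|].
  rewrite inE; case/or3P=> [/andP[_]|/andP[_]|/andP[_]] /eqP[uE vE];
    by move: ab; rewrite -cu -cv uE vE ?c0 ?c1 ?c2 // => _; split.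
case=> /eqP -> /eqP ->; split=> //; case/orP: b2 => ->; [exists vtx1, vtx0 | exists vtx2, vtx0];
  by rewrite !inE /= ?eqxx ?orbT.
Qed.

Lemma opE_sym n (s : 'S_n) (E : {set 'I_n * 'I_n}) (e : 'I_n -> int) (f : {ffun 'I_n -> g}) :
    (forall u v, ((s u, s v) \in E) = ((u, v) \in E)) -> (forall u, dg_gr (e u) (f u)) ->
  opE E f = koszul_sign k s e *: opE E [ffun u => f (s u)].
Proof.
move=> sE fe; rewrite /opE; case: insubP => [G _ GE|_]; last by rewrite scaler0.
apply: dg_op_equivariant fe; apply/forallP=> u; apply/forallP=> v.
by rewrite -[edges G]/(val G) GE sE.
Qed.

Section Symmetry.
Variables (ex ey ez : int) (x y z : g).
Hypotheses (xe : dg_gr ex x) (ye : dg_gr ey y) (ze : dg_gr ez z).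

Let deg (v : 'I_3) : int := if v == vtx0 then ex else if v == vtx1 then ey else ez.

Let degP v : dg_gr (deg v) (triplef x y z v).
Proof. by rewrite ffunE /deg; do ?case: ifP. Qed.

(** Two vertices attached to the same vertex below them can be exchanged. *)
Lemma op3_swap_top : op3 true true false x y z = (-1) ^ (ez * ey) *: op3 true true false x z y.
Proof.
pose s := tperm vtx1 vtx2.
have s0 : s vtx0 = vtx0 by rewrite tpermD.
have s1 : s vtx1 = vtx2 by rewrite tpermL.
have s2 : s vtx2 = vtx1 by rewrite tpermR.
rewrite /op3 (opE_sym (s := s) _ degP); last first.
  by apply: ord3_cases; apply: ord3_cases; rewrite ?s0 ?s1 ?s2 !inE.
congr (_ *: _).
  rewrite /koszul_sign (big_pred1 (vtx1, vtx2)); first by rewrite s1 s2.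
  by case=> a b; move: a b; apply: ord3_cases; apply: ord3_cases; rewrite /= ?s0 ?s1 ?s2.
congr opE; apply/ffunP; apply: ord3_cases; by rewrite !ffunE ?s0 ?s1 ?s2.
Qed.

Lemma op3_swap_bottom : op3 false true true x y z = (-1) ^ (ey * ex) *: op3 false true true y x z.
Proof.
pose s := tperm vtx0 vtx1.
have s0 : s vtx0 = vtx1 by rewrite tpermL.
have s1 : s vtx1 = vtx0 by rewrite tpermR.
have s2 : s vtx2 = vtx2 by rewrite tpermD.
rewrite /op3 (opE_sym (s := s) _ degP); last first.
  by apply: ord3_cases; apply: ord3_cases; rewrite ?s0 ?s1 ?s2 !inE.
congr (_ *: _).
  rewrite /koszul_sign (big_pred1 (vtx0, vtx1)); first by rewrite s0 s1.
  by case=> a b; move: a b; apply: ord3_cases; apply: ord3_cases; rewrite /= ?s0 ?s1 ?s2.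
congr opE; apply/ffunP; apply: ord3_cases; by rewrite !ffunE ?s0 ?s1 ?s2.
Qed.

End Symmetry.

End Associator.

Section Derivation.
Variables (k : fieldType) (g : completeLieGraph k).
Implicit Types (l a b x y z : g).

Lemma associatorE x y z :
  star (star x y) z - star x (star y z) = op3 true true false x y z - op3 false true true x y z.
Proof.
have cancel (A B C D : g) : (A + B + C) - (B + D + C) = A - D.
  by rewrite opprD addrACA subrr addr0 addrKA.
by rewrite starA_left starA_right cancel.
Qed.

Lemma ad_star l a b : dg_gr 0 l -> dg_gr (-1) a -> dg_gr (-1) b ->
  star (ad l a) b + star a (ad l b) - ad l (star a b)
  = op3 true true false l a b - op3 false true true a b l.
Proof.
move=> l0 a1 b1.
have regroup (A B C D E F : g) : (A - B) + (C - D) - (E - F) = (A - E) - (B - C) + (F - D).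
  rewrite !opprB !addrA; by rewrite [LHS](ACl (1*6*3*2*5*4))%AC.
rewrite !adE !starDl !starDr !starNl !starNr regroup !associatorE.
rewrite (op3_swap_bottom l0 a1 b1) (op3_swap_top a1 l0 b1) !mulr0 !expr0z !scale1r.
have collect (A B C D E : g) : (A - B) - (C - B) + (C - D) = A - D.
  by rewrite opprB subrKA subrKA.
exact: collect.
Qed.

(** Since [ad l] is even and the degrees of [a] and [b] are odd, it derives the
    graded commutative part of the star product. *)
Lemma ad_star_sym l a b : dg_gr 0 l -> dg_gr (-1) a -> dg_gr (-1) b ->
  star (ad l a) b + star a (ad l b) + (star (ad l b) a + star b (ad l a))
  = ad l (star a b + star b a).
Proof.
move=> l0 a1 b1; apply/eqP; rewrite adD -subr_eq0 opprD addrACA !ad_star //.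
rewrite (op3_swap_top l0 a1 b1) (op3_swap_bottom a1 b1 l0).
have cancel (A B : g) : - A - - B + (A - B) = 0 by rewrite opprK addrACA addNr subrr addr0.
by rewrite mulrNN mulr1 expr1z !scaleN1r cancel.
Qed.

End Derivation.

(** * The gauge action preserves the Maurer-Cartan equation *)

Section MaurerCartan.
Variables (k : fieldType) (g : completeLieGraph k).
Hypothesis chark : [pchar k] =i pred0.
Variables (l a : g).
Hypotheses (l1 : fil 1 0 l) (a1 : dg_gr (-1) a).

Let dl1 : fil 1 (-1) (dg_d g l) := fil_d' l1.
Let l0 : dg_gr 0 l := fil_gr l1.

Definition gauge_coef n : g := conj_coef chark l a n - cocycle_coef chark l n.

Lemma gauge_coef_fil n : fil n (-1) (gauge_coef n).
Proof.
apply: fil_sub; first by rewrite conj_coefE //; apply: fil_scale; apply: iter_ad_fil.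
case: n => [|n]; first by rewrite cocycle_coef0; apply: fil_zero.
rewrite cocycle_coefE //; apply: fil_scale.
by elim: n => [|n IH] //=; apply: ad_fil.
Qed.

Lemma gauge_coef_gr n : dg_gr (-1) (gauge_coef n).
Proof. exact: fil_gr (gauge_coef_fil n). Qed.

Lemma factS_scale n (x : g) : n.+1%:R *: ((n.+1`!%:R)^-1 *: x) = (n`!%:R)^-1 *: x.
Proof.
by rewrite scalerA factS natrM invfM mulrA mulfV ?mul1r //; apply: natf_neq0.
Qed.

Lemma gauge_coefS n : n.+1%:R *: gauge_coef n.+1
  = ad l (gauge_coef n) - (if n == 0%N then dg_d g l else 0).
Proof.
rewrite scalerBr adB -addrA -opprD; congr (_ - _).
  by rewrite !conj_coefE // factS_scale adZ.
rewrite cocycle_coefE // factS_scale; case: n => [|n].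
  by rewrite cocycle_coef0 ad0 add0r fact0 invr1 scale1r.
by rewrite cocycle_coefE // adZ addr0.
Qed.

Lemma d_ad x : dg_gr (-1) x ->
  dg_d g (ad l x) = ad l (dg_d g x) + (star (dg_d g l) x + star x (dg_d g l)).
Proof.
move=> x1; rewrite !adE linearB /= (star_d l0); last by exists (-1).
rewrite (star_d x1); last by exists 0.
rewrite expr0z scale1r -[(-1) ^ (-1)]/((-1)^-1) invrN1 scaleN1r opprB.
by rewrite [X in X + _]addrC [X in _ + X]addrC addrACA.
Qed.

Definition curvature_coef n : g :=
  dg_d g (gauge_coef n) + \sum_(i < n.+1) star (gauge_coef i) (gauge_coef (n - i)).

Lemma ad_star_sum n :
  \sum_(i < n.+1) (star (ad l (gauge_coef i)) (gauge_coef (n - i))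
                   + star (gauge_coef i) (ad l (gauge_coef (n - i))))
  = ad l (\sum_(i < n.+1) star (gauge_coef i) (gauge_coef (n - i))).
Proof.
have two0 : (2%:R : k) != 0 by apply: natf_neq0.
apply: (scalerI two0); rewrite -[in RHS]adZ !scaler_nat !mulr2n.
have revE (F : nat -> nat -> g) : \sum_(i < n.+1) F i (n - i)%N = \sum_(i < n.+1) F (n - i)%N i.
  rewrite (reindex_inj rev_ord_inj); apply: eq_bigr => i _ /=.
  by rewrite subSS subKn // -ltnS ltn_ord.
rewrite {2}(revE (fun i j => star (ad l (gauge_coef i)) (gauge_coef j)
                           + star (gauge_coef i) (ad l (gauge_coef j)))).
rewrite {2}(revE (fun i j => star (gauge_coef i) (gauge_coef j))).
rewrite -!big_split /= ad_sum; apply: eq_bigr => i _.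
by rewrite ad_star_sym //; apply: gauge_coef_gr.
Qed.

Lemma curvature_coefS n : n.+1%:R *: curvature_coef n.+1 = ad l (curvature_coef n).
Proof.
pose b i := i.+1%:R *: gauge_coef i.+1.
have bE i : b i = ad l (gauge_coef i) - (if i == 0%N then dg_d g l else 0) := gauge_coefS i.
have starS : n.+1%:R *: \sum_(i < n.+2) star (gauge_coef i) (gauge_coef (n.+1 - i))
  = \sum_(i < n.+1) star (b i) (gauge_coef (n - i))
    + \sum_(i < n.+1) star (gauge_coef i) (b (n - i)%N).
  transitivity (\sum_(i < n.+2) star (i%:R *: gauge_coef i) (gauge_coef (n.+1 - i))
    + \sum_(i < n.+2) star (gauge_coef i) ((n.+1 - i)%:R *: gauge_coef (n.+1 - i))).
    rewrite scaler_sumr -big_split /=; apply: eq_bigr => i _.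
    by rewrite starZl starZr -scalerDl -natrD subnKC // -ltnS ltn_ord.
  rewrite [X in X + _]big_ord_recl /= scale0r star0l add0r.
  rewrite [X in _ + X]big_ord_recr /= subnn scale0r star0r addr0.
  congr (_ + _); apply: eq_bigr => i _ /=; rewrite /bump /= ?add1n ?subSS //.
  by rewrite subSn // -ltnS ltn_ord.
rewrite scalerDr starS -linearZ /= -/(b n) adD -ad_star_sum.
have bl : \sum_(i < n.+1) star (b i) (gauge_coef (n - i))
  = \sum_(i < n.+1) star (ad l (gauge_coef i)) (gauge_coef (n - i))
    - star (dg_d g l) (gauge_coef n).
  under eq_bigr => i _ do rewrite bE starDl starNl.
  rewrite big_split /= sumrN; congr (_ - _).
  by rewrite big_ord_recl /= subn0 big1 ?addr0 // => i _; rewrite star0l.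
have br : \sum_(i < n.+1) star (gauge_coef i) (b (n - i)%N)
  = \sum_(i < n.+1) star (gauge_coef i) (ad l (gauge_coef (n - i)))
    - star (gauge_coef n) (dg_d g l).
  under eq_bigr => i _ do rewrite bE starDr starNr.
  rewrite big_split /= sumrN; congr (_ - _).
  rewrite big_ord_recr /= subnn eqxx big1 ?add0r // => i _.
  by rewrite subn_eq0 leqNgt ltn_ord star0r.
rewrite bl br addrACA -opprD -big_split /= bE linearB /= d_ad; last exact: gauge_coef_gr.
have -> : dg_d g (if n == 0%N then dg_d g l else 0) = 0.
  by case: ifP => _; rewrite ?dg_dd ?linear0.
rewrite subr0 -addrA; congr (_ + _).
by rewrite addrCA subrr addr0.
Qed.

Lemma curvature_coef_eq0 n : dg_d g a + star a a = 0 -> curvature_coef n = 0.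
Proof.
move=> MCa; elim: n => [|n IH].
  rewrite /curvature_coef big_ord_recl big_ord0 addr0 subn0.
  have -> : gauge_coef 0 = a.
    by rewrite /gauge_coef conj_coefE // cocycle_coef0 subr0 fact0 invr1 scale1r.
  exact: MCa.
have n0 : (n.+1%:R : k) != 0 by apply: natf_neq0.
by apply: (scalerI n0); rewrite curvature_coefS IH ad0 scaler0.
Qed.

Lemma gauge_expansion N :
  fil N (-1) (classical_gauge l a - \sum_(n < N) gauge_coef n).
Proof.
suff F : fil N (-1) (classical_gauge l a - \sum_(n < N.+1) gauge_coef n).
  have := fil_add F (gauge_coef_fil N).
  by rewrite big_ord_recr /= opprD [X in X + _]addrA subrK.
have E1 := fil_le (leqnSn N) (conj_expansion chark 1 N.+1 l1 a1).
have E2 := cocycle_expansion chark 1 N l1.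
have E3 : \sum_(n < N.+1) gauge_coef n = \sum_(n < N.+1) 1 ^+ n *: conj_coef chark l a n
                                       - \sum_(n < N.+1) 1 ^+ n *: cocycle_coef chark l n.
  by rewrite -sumrB; apply: eq_bigr => n _; rewrite expr1n !scale1r.
have := fil_sub E1 E2; rewrite (classical_gaugeE chark) // E3 !scale1r; congr fil.
by rewrite !opprD !opprK addrACA.
Qed.

Lemma classical_gauge_gr : dg_gr (-1) (classical_gauge l a).
Proof. by have := fil_gr (gauge_expansion 0); rewrite big_ord0 subr0. Qed.

(** The sum over a square of indices and the sum over the triangle below its
    diagonal differ by terms of large filtration. *)
Lemma square_triangle (N : nat) (F : nat -> nat -> g) e :
    (forall p q, fil (p + q) e (F p q)) ->
  fil N e (\sum_(p < N) \sum_(q < N) F p q - \sum_(n < N) \sum_(p < n.+1) F p (n - p)%N).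
Proof.
move=> FF.
have -> : \sum_(n < N) \sum_(p < n.+1) F p (n - p)%N = \sum_(p < N) \sum_(q < N - p) F p q.
  transitivity (\sum_(n < N) \sum_(p < N | (p <= n)%N) F p (n - p)%N).
    apply: eq_bigr => n _.
    by rewrite (big_ord_widen N (fun p => F p (n - p)%N)) // ; apply: ltn_ord.
  rewrite (exchange_big_dep xpredT) //=; apply: eq_bigr => p _.
  rewrite -(big_mkord (fun n => p <= n)%N (fun n => F p (n - p)%N)).
  rewrite -(big_mkord xpredT (F p)).
  rewrite (big_cat_nat (leq0n p) (ltnW (ltn_ord p))) /=.
  rewrite big_nat_cond big_pred0 ?add0r; last first.
    by move=> n; apply/negP=> /andP[/andP[_ lt]]; rewrite leqNgt lt.
  rewrite big_nat_cond (eq_bigl (fun n => p <= n < N)%N) -?big_nat; last first.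
    by move=> n /=; case: (p <= n)%N; rewrite ?andbT ?andbF.
  rewrite -{1}(add0n p) big_addn; apply: eq_bigr => n _; by rewrite addnK.
rewrite -sumrB; apply: fil_sum => p _.
rewrite -!(big_mkord xpredT (F p)) (big_cat_nat (leq0n (N - p)) (leq_subr p N)) /=.
rewrite addrAC subrr add0r big_nat; apply: fil_sum => q /andP[le_q _].
by apply: fil_le (FF p q); rewrite -leq_subLR.
Qed.

Lemma classical_gauge_MC : dg_d g a + star a a = 0 -> MC (classical_gauge l a).
Proof.
move=> MCa; split; first exact: classical_gauge_gr.
apply: (@fil_separated _ _ (-2)) => N; set A := classical_gauge l a.
pose S := \sum_(n < N) gauge_coef n.
have AS : fil N (-1) (A - S) := gauge_expansion N.
have A1 : fil 0 (-1) A by apply/fil_0; apply: classical_gauge_gr.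
have S1 : fil 0 (-1) S by apply: fil_sum => n _; apply: fil_le (gauge_coef_fil n).
have e2 : (-1 - 1 : int) = -2 by [].
have dAS : fil N (-2) (dg_d g A - dg_d g S) by rewrite -linearB -e2; apply: fil_d.
have sAS : fil N (-2) (star A A - star S S).
  have -> : star A A - star S S = star (A - S) A + star S (A - S).
    by rewrite starDl starDr starNl starNr addrA subrK.
  apply: fil_add; first by have := star_fil AS A1; rewrite addn0.
  exact: (star_fil S1 AS).
have SS : fil N (-2) (dg_d g S + star S S).
  have -> : star S S = \sum_(p < N) \sum_(q < N) star (gauge_coef p) (gauge_coef q).
    by rewrite star_suml; apply: eq_bigr => p _; rewrite star_sumr.
  have sq : forall p q, fil (p + q) (-2) (star (gauge_coef p) (gauge_coef q)).
    by move=> p q; exact: (star_fil (gauge_coef_fil p) (gauge_coef_fil q)).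
  have := square_triangle N sq.
  have -> : \sum_(n < N) \sum_(p < n.+1) star (gauge_coef p) (gauge_coef (n - p)) = - dg_d g S.
    apply/eqP; rewrite -subr_eq0 opprK linear_sum /= -big_split /= big1 // => n _.
    by rewrite addrC; apply: curvature_coef_eq0.
  by rewrite opprK addrC.
have := fil_add (fil_add dAS sAS) SS.
by rewrite addrACA !subrK.
Qed.

End MaurerCartan.

(** * The action of the gauge group *)

Lemma gmul_cancel (k : fieldType) (h : evenLieGraph k) (chark : [pchar k] =i pred0)
    (x v u s : h) : ev_fil 1 x -> ev_fil 1 v -> ev_fil 1 u -> ev_fil 1 s -> gmul v u = 0 ->
  gmul (gmul x v) (gmul u s) = gmul x s.
Proof.
move=> x1 v1 u1 s1 vu; have us1 : ev_fil 1 (gmul u s) by apply: gmul_fil1.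
by rewrite (gmulA chark x1 v1 us1) -(gmulA chark v1 u1 s1) vu (gmul0u chark s1).
Qed.

Lemma gmul_cancelr (k : fieldType) (h : evenLieGraph k) (chark : [pchar k] =i pred0)
    (x s t : h) : ev_fil 1 x -> ev_fil 1 s -> ev_fil 1 t -> gmul s t = 0 ->
  gmul (gmul x s) t = x.
Proof. by move=> x1 s1 t1 st; rewrite (gmulA chark x1 s1 t1) st (gmulu0 chark x1). Qed.

Section Action.
Variables (k : fieldType) (g : completeLieGraph k).
Hypothesis chark : [pchar k] =i pred0.
Local Opaque gmul gexp.
Notation h := (extension g).
Implicit Types (l a b x y : g).

Lemma fst_gmul_inv l : fil 1 0 l -> (gmul (gauge_exp l) (theta_exp (- l))).1 = 0.
Proof.
move=> l1; have Nl1 := fil_opp l1; have U1 := gauge_exp1 l1.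
have T1 := theta_exp1 Nl1; have V1 := gauge_exp1 Nl1.
have E : (theta_exp (- l)).1 = (gauge_exp (- l)).1 by rewrite (theta_expE chark Nl1).
rewrite (gmul_fst U1 T1 U1 V1 erefl E).
exact: (congr1 (fun X : h => X.1) (gauge_expN chark l1)).
Qed.

Lemma gmul_exp_theta l : fil 1 0 l ->
  gmul (gauge_exp l) (theta_exp (- l)) = eps (- cocycle l).
Proof.
move=> l1; have Nl1 := fil_opp l1; have U1 := gauge_exp1 l1; have V1 := gauge_exp1 Nl1.
have T1 := theta_exp1 l1; have S1 := theta_exp1 Nl1.
have c0 := cocycle_gr l1.
have Nc0 : dg_gr (-1) (- cocycle l) by apply/fil_0/fil_opp/fil_0.
have e1 := eps_fil1 c0; have Ne1 := eps_fil1 Nc0.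
have X1 : ev_fil 1 (gmul (gauge_exp l) (theta_exp (- l))) by apply: gmul_fil1.
have E : gmul (eps (cocycle l)) (gmul (gauge_exp l) (theta_exp (- l))) = 0.
  have C := cocycleE chark l1; have E := gmul_cancel chark T1 V1 U1 S1 (gauge_expVN chark l1).
  exact: (etrans (congr1 (fun Y : h => gmul Y _) (esym C)) (etrans E (theta_expN chark l1))).
have ce : gmul (eps (- cocycle l)) (eps (cocycle l)) = 0 by rewrite gmul_eps // addNr.
have E' := gmul_cancel chark (ev_fil_zero h 1) Ne1 e1 X1 ce.
rewrite E (gmulu0 chark (gmul_fil1 (ev_fil_zero h 1) Ne1)) in E'.
by rewrite (gmul0u chark Ne1) (gmul0u chark X1) in E'.
Qed.

(** The classical gauge action is the twisted conjugation of infinitesimal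
    elements, by an element on the left and its derivative on the right. *)
Lemma eps_classical_gauge l a : fil 1 0 l -> dg_gr (-1) a ->
  eps (classical_gauge l a) = gmul (gmul (gauge_exp l) (eps a)) (theta_exp (- l)).
Proof.
move=> l1 a0; have Nl1 := fil_opp l1; have U1 := gauge_exp1 l1; have V1 := gauge_exp1 Nl1.
have S1 := theta_exp1 Nl1; have e1 := eps_fil1 a0.
have Ue : ev_fil 1 (gmul (gauge_exp l) (eps a)) by apply: gmul_fil1.
have Nc0 : dg_gr (-1) (- cocycle l) by apply/fil_0/fil_opp/fil_0/cocycle_gr.
have E : gmul (conj_eps l a) (gmul (gauge_exp l) (theta_exp (- l)))
    = gmul (gmul (gauge_exp l) (eps a)) (theta_exp (- l)).
  exact: (gmul_cancel chark Ue V1 U1 S1 (gauge_expVN chark l1)).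
have c0 := conj_gr l1 a0.
by rewrite (classical_gaugeE chark l1 a0) -E (gmul_exp_theta l1) (conjE chark l1 a0) (gmul_eps c0 Nc0).
Qed.

Lemma gauge_actE x a : fil 1 0 x -> dg_gr (-1) a ->
  gmul (eps (gauge_act x a)) (theta x) = gmul (emb x) (eps a).
Proof.
move=> x1 a0; have [l1 lE] := graph_logP chark x1; rewrite /gauge_act.
move: (graph_log x) l1 lE => l l1 <-; have Nl1 := fil_opp l1.
have U1 := gauge_exp1 l1; have S1 := theta_exp1 Nl1; have T1 := theta_exp1 l1.
have e1 := eps_fil1 a0.
have Ue : ev_fil 1 (gmul (gauge_exp l) (eps a)) by apply: gmul_fil1.
rewrite (emb_graph_exp chark l1) (theta_graph_exp chark l1) (eps_classical_gauge l1 a0).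
exact: (gmul_cancelr chark Ue S1 T1 (theta_expVN chark l1)).
Qed.

Lemma gmul_theta_inj x b b' : fil 1 0 x -> dg_gr (-1) b -> dg_gr (-1) b' ->
  gmul (eps b) (theta x) = gmul (eps b') (theta x) -> b = b'.
Proof.
move=> x1 b0 b0'; have [l1 lE] := graph_logP chark x1.
rewrite -lE (theta_graph_exp chark l1); move: (graph_log x) l1 {lE} => l l1 E.
have S1 := theta_exp1 (fil_opp l1); have T1 := theta_exp1 l1.
have cancelr c : dg_gr (-1) c ->
    gmul (gmul (eps c) (theta_exp l)) (theta_exp (- l)) = eps c.
  by move=> /eps_fil1 c1; apply: (gmul_cancelr chark c1 T1 S1 (theta_expN chark l1)).
have E' : eps b = eps b' by rewrite -(cancelr b b0) E (cancelr b' b0').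
exact: (congr1 (fun X : h => X.2) E').
Qed.

Lemma gauge_act_gr x a : fil 1 0 x -> dg_gr (-1) a -> dg_gr (-1) (gauge_act x a).
Proof. by move=> /(graph_logP chark)[l1 _] a0; apply: classical_gauge_gr. Qed.

Lemma gauge_act0 a : dg_gr (-1) a -> gauge_act 0 a = a.
Proof.
move=> a0; have z1 := fil_zero g 1 0.
have e1 := eps_fil1 a0; apply: (gmul_theta_inj z1 (gauge_act_gr z1 a0) a0).
have t0 : theta (0 : g) = 0 by congr (_, _); rewrite linear0.
rewrite (gauge_actE z1 a0) t0 (gmulu0 chark e1); exact: (gmul0u chark e1).
Qed.

Lemma gauge_actM x y a : fil 1 0 x -> fil 1 0 y -> dg_gr (-1) a ->
  gauge_act (gauge_mul x y) a = gauge_act x (gauge_act y a).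
Proof.
move=> x1 y1 a0; have b0 := gauge_act_gr y1 a0; have c0 := gauge_act_gr x1 b0.
have ex := emb_fil1 x1; have ey := emb_fil1 y1; have ea := eps_fil1 a0.
have tx := theta_fil1 x1; have ty := theta_fil1 y1.
have eb := eps_fil1 b0; have ec := eps_fil1 c0.
have xy1 : fil 1 0 (gauge_mul x y).
  by rewrite (gauge_mulE chark x1 y1); have [] := gmul_fil1 ex ey.
apply: (gmul_theta_inj xy1 (gauge_act_gr xy1 a0) c0).
have tE : theta (gauge_mul x y) = gmul (theta x) (theta y).
  rewrite (gauge_mulE chark x1 y1); exact: (esym (gmul_theta x1 y1)).
have eE : emb (gauge_mul x y) = gmul (emb x) (emb y).
  rewrite (gauge_mulE chark x1 y1); exact: (esym (gmul_emb x1 y1)).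
rewrite (gauge_actE xy1 a0) tE eE.
have A1 := gmulA chark ex ey ea.
have A2 := gauge_actE y1 a0.
have A3 := gmulA chark ex eb ty.
have A4 := gauge_actE x1 b0.
have A5 := gmulA chark ec tx ty.
exact: (etrans A1 (etrans (congr1 (gmul (emb x)) (esym A2))
  (etrans (esym A3) (etrans (congr1 (fun X : h => gmul X (theta y)) (esym A4)) A5)))).
Qed.

Lemma bowtie_graph_exp l a : fil 1 0 l -> dg_gr (-1) a ->
  bowtie (graph_exp l) a (graph_exp (- l)) = conj l a.
Proof.
move=> l1 a0; have Nl1 := fil_opp l1.
have x1 := graph_exp1 chark l1; have y1 := graph_exp1 chark Nl1.
by rewrite (bowtieE chark x1 a0 y1) (emb_graph_exp chark l1) (emb_graph_exp chark Nl1).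
Qed.

Lemma gauge_mul_linl_graph_exp l : fil 1 0 l ->
  gauge_mul_linl (graph_exp l) (dg_d g (graph_exp l)) (graph_exp (- l)) = cocycle l.
Proof.
move=> l1; have Nl1 := fil_opp l1.
have x1 := graph_exp1 chark l1; have y1 := graph_exp1 chark Nl1.
rewrite (gauge_mul_linlE chark x1 (fil_gr (fil_d' x1)) y1) -[(_, _)]/(theta _).
by rewrite (theta_graph_exp chark l1) (emb_graph_exp chark Nl1).
Qed.

Lemma gauge_mul_linr_graph_exp l : fil 1 0 l ->
  gauge_mul_linr (graph_exp l) (graph_exp (- l)) (dg_d g (graph_exp (- l))) = - cocycle l.
Proof.
move=> l1; have Nl1 := fil_opp l1.
have x1 := graph_exp1 chark l1; have y1 := graph_exp1 chark Nl1.
rewrite (gauge_mul_linrE chark x1 y1 (fil_gr (fil_d' y1))) -[(_, dg_d g _)]/(theta _).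
by rewrite (theta_graph_exp chark Nl1) (emb_graph_exp chark l1) (gmul_exp_theta l1).
Qed.

End Action.

Section InternalDifferential.
Variables (k : fieldType) (g : completeLieGraph k) (gp : internalLieGraph k).
Variable eta : {linear g -> gp}.
Hypothesis chark : [pchar k] =i pred0.
Hypothesis etaP : is_morphism eta.
Implicit Types (l a x : g).

Lemma morphism_star x y : eta (star x y) = star (eta x) (eta y).
Proof.
have [_ _ eta_op] := etaP; rewrite /star eta_op; congr (dg_op _ _).
by apply/ffunP=> v; rewrite !ffunE; case: ifP.
Qed.

Lemma morphism_ad l n x : eta (iter n (ad l) x) = iter n (ad (eta l)) (eta x).
Proof. by elim: n => //= n IH; rewrite !adE linearB /= !morphism_star IH. Qed.

Lemma iter_adB (m x y : gp) n :
  iter n (ad m) (x - y) = iter n (ad m) x - iter n (ad m) y.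
Proof. by elim: n => //= n ->; rewrite adB. Qed.

Lemma morphism_fil1 l : fil 1 0 l -> fil 1 0 (eta l).
Proof. by have [eta_fil _ _] := etaP; apply: eta_fil. Qed.

Lemma ad_delta l : fil 1 0 l -> ad (eta l) (delta gp) = - eta (dg_d g l).
Proof.
move=> l1; have [_ eta_d _] := etaP.
by rewrite eta_d (delta_d (fil_gr (morphism_fil1 l1))) expr0z scale1r opprB adE.
Qed.

Lemma exp_ad_delta l a : fil 1 0 l -> dg_gr (-1) a ->
  exp_ad (eta l) (delta gp + eta a) = delta gp + eta (classical_gauge l a).
Proof.
move=> l1 a0; have [eta_fil _ _] := etaP; have cg := classical_gauge_gr chark l1 a0.
have d0 := delta_gr gp.
apply: (@series_shift _ _ _ _ _ 1).
  by apply/fil_0/fil_add; apply/fil_0 => //; apply/fil_0/eta_fil/fil_0.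
move=> N; have := eta_fil _ _ _ (fil_le (leqnSn N) (gauge_expansion chark l1 a0 N.+1)).
rewrite linearB linear_sum addn1 /=; congr fil.
rewrite !big_ord_recl /= fact0 invr1 scale1r !opprD !addrA.
have -> : gauge_coef chark l a 0 = a.
  by rewrite /gauge_coef conj_coefE // cocycle_coef0 subr0 fact0 invr1 scale1r.
congr (_ - _); first by rewrite [delta gp + _]addrC addrK.
apply: eq_bigr => n _; rewrite -[bump 0 n]/(n.+1).
rewrite /gauge_coef conj_coefE // cocycle_coefE // -scalerBr linearZ /=.
congr (_ *: _); rewrite linearB /= -/(iter n.+1 (ad l) a) !morphism_ad.
rewrite -/(ad (eta l) _) -iterS !iterSr adD (ad_delta l1).
by rewrite [- _ + _]addrC -[(0 + n)%N]/(n : nat) [RHS]iter_adB.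
Qed.

End InternalDifferential.

Theorem theorem2p29 (k : fieldType) (chark : [pchar k] =i pred0)
    (g : completeLieGraph k) :
  is_group_action (@gauge_group k g) (@gauge_mul k g) 0
                  (@MC k g) (@gauge_act k g) /\
  (forall (l a : g), fil 1 0 l -> MC a ->
    [/\ gauge_act (graph_exp l) a = classical_gauge l a,
        classical_gauge l a
        = bowtie (graph_exp l) a (graph_exp (- l))
          - gauge_mul_linl (graph_exp l) (dg_d g (graph_exp l)) (graph_exp (- l))
      & classical_gauge l a
        = bowtie (graph_exp l) a (graph_exp (- l))
          + gauge_mul_linr (graph_exp l)
              (graph_exp (- l)) (dg_d g (graph_exp (- l)))]) /\
  (forall (gp : internalLieGraph k) (eta : {linear g -> gp}),
    is_differential_extension eta ->
    forall (l a : g), fil 1 0 l -> MC a ->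
      let alpha : gp := delta gp + eta a in
      delta gp + eta (gauge_act (graph_exp l) a) = exp_ad (eta l) alpha /\
      exp_ad (eta l) alpha
      = bowtie (graph_exp (eta l)) alpha (graph_exp (- eta l))).
Proof.
split; last split.
- split=> [u a u1 [a0 MCa]|a [a0 _]|u v a u1 v1 [a0 _]].
  + have [l1 _] := graph_logP chark u1; exact: (classical_gauge_MC chark l1 a0 MCa).
  + exact: (gauge_act0 chark a0).
  + exact: (gauge_actM chark u1 v1 a0).
- move=> l a l1 [a0 _]; have gE := classical_gaugeE chark l1 a0; split.
  + by rewrite /gauge_act (graph_expK chark l1).
  + by rewrite (bowtie_graph_exp chark l1 a0) (gauge_mul_linl_graph_exp chark l1).
  + by rewrite (bowtie_graph_exp chark l1 a0) (gauge_mul_linr_graph_exp chark l1).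
- move=> gp eta [etaP _] l a l1 [a0 _] alpha.
  have el1 := morphism_fil1 etaP l1.
  have alpha0 : dg_gr (-1) alpha.
    have [eta_fil _ _] := etaP; apply/fil_0/fil_add; apply/fil_0; first exact: delta_gr.
    by apply/fil_0/eta_fil/fil_0.
  split; first by rewrite /gauge_act (graph_expK chark l1) (exp_ad_delta chark etaP l1 a0).
  by rewrite (exp_adE chark el1 alpha0) (bowtie_graph_exp chark el1 alpha0).
Qed.
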